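(* Let $(\lambda,b)$ be one of the three pairs consisting of a number $\lambda>0$ and a function $b:\mathbb{R}\to\mathbb{R}$: $$\left(2,\ b(t)=\tfrac32\sin(2\pi t)+1\right),\qquad \left(2,\ b(t)=\tfrac12\sin(2\pi t)+1\right),\qquad \left(5,\ b(t)=\tfrac12\sin(2\pi t)+1\right).$$ Then the non-autonomous Chafee--Infante equation $$u_t=u_{xx}+\lambda u-b(t)u^3 \ \text{ for } x\in(0,\pi),\qquad u(t,0)=u(t,\pi)=0,$$ has a periodic orbit $u^*:\mathbb{R}\to C_0(0,\pi)$ with period $1$. Moreover, there exist $\delta>0$, $D>0$ and $\kappa>0$ such that for every initial time $t_0\in\mathbb{R}$ and every initial datum $u^0\in C_0(0,\pi)$ satisfying $\|u^*(t_0)-u^0\|_{C_0(0,\pi)}\le\delta$ there exists a solution $u:[t_0,\infty)\to C_0(0,\pi)$ with $u(t_0)=u^0$ such that $$\|u^*(t)-u(t)\|_{C_0(0,\pi)}\le D e^{-\kappa(t-t_0)}\|u^*(t_0)-u(t_0)\|_{C_0(0,\pi)}\quad\text{for all } t\in[t_0,\infty).$$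
   Context: $C_0(0,\pi)$ is the Banach space of continuous functions $f:[0,\pi]\to\mathbb{R}$ with $f(0)=f(\pi)=0$, with the supremum norm. Let $Lu=u_{xx}+\lambda u$ with domain $D(L)=\{u\in C_0(0,\pi): Lu\in C_0(0,\pi)\}$; it generates a $C_0$-semigroup $e^{tL}$ on $C_0(0,\pi)$. A solution on an interval $[t_0,t_1]$ or $[t_0,\infty)$ with initial datum $u(t_0)=u^0$ is a continuous $C_0(0,\pi)$-valued function satisfying the Duhamel formula $$u(t)=e^{L(t-t_0)}u^0-\int_{t_0}^t e^{L(t-s)}b(s)u(s)^3\,ds .$$ A periodic orbit with period $1$ is a function $u^*:\mathbb{R}\to C_0(0,\pi)$ with $u^*(t+1)=u^*(t)$ for all $t\in\mathbb{R}$ whose restriction to $[t_0,\infty)$ is, for every $t_0\in\mathbb{R}$, the solution with initial datum $u^*(t_0)$ at time $t_0$. *)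

(* Defs.v *)
From Stdlib Require Import Reals Lra.
From Stdlib Require Import Classical ClassicalEpsilon.
From Stdlib Require Import FunctionalExtensionality PropExtensionality ProofIrrelevance.
From Coquelicot Require Import Coquelicot.
Open Scope R_scope.

(** A continuous function on [0,pi] vanishing at both end points is represented
    by its extension by zero to the real line, so that Leibniz equality of
    elements is equality of functions on [0,pi]. *)
Record C0 : Type := mkC0 {
  C0_fun :> R -> R;
  C0_cont : forall x, continuous C0_fun x;
  C0_supp : forall x, ~ (0 < x < PI) -> C0_fun x = 0
}.

Lemma C0_ext (f g : C0) : (forall x, f x = g x) -> f = g.
Proof.
destruct f as [f fc fs], g as [g gc gs]; simpl; intros H.
assert (f = g) as E by now apply functional_extensionality.
subst g; f_equal; apply proof_irrelevance.
Qed.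

Definition C0_zero : C0.
Proof.
refine (mkC0 (fun _ => 0) _ _).
- intros x; apply continuous_const.
- reflexivity.
Defined.

Definition C0_plus (f g : C0) : C0.
Proof.
refine (mkC0 (fun x => f x + g x) _ _).
- intros x; apply (continuous_plus f g x); apply C0_cont.
- intros x Hx; rewrite !C0_supp by assumption; ring.
Defined.

Definition C0_opp (f : C0) : C0.
Proof.
refine (mkC0 (fun x => - f x) _ _).
- intros x; apply (continuous_opp f x); apply C0_cont.
- intros x Hx; rewrite C0_supp by assumption; ring.
Defined.

Definition C0_scal (k : R) (f : C0) : C0.
Proof.
refine (mkC0 (fun x => k * f x) _ _).
- intros x; apply (continuous_scal_r k f x); apply C0_cont.
- intros x Hx; rewrite C0_supp by assumption; ring.
Defined.

Definition C0_cube (f : C0) : C0.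
Proof.
refine (mkC0 (fun x => f x ^ 3) _ _).
- intros x; apply (continuous_comp f (fun y => y ^ 3)); [apply C0_cont|].
  apply (ex_derive_continuous (fun y : R => y ^ 3)); auto_derive; exact I.
- intros x Hx; rewrite C0_supp by assumption; ring.
Defined.

Definition C0_norm (f : C0) : R :=
  real (Lub_Rbar (fun y => exists x, 0 <= x <= PI /\ y = Rabs (f x))).

Lemma C0_bounded (f : C0) : exists M, forall x, Rabs (f x) <= M.
Proof.
destruct (continuity_ab_maj (fun x => Rabs (f x)) 0 PI) as [m [Hm _]].
- apply Rlt_le, PI_RGT_0.
- intros c _. apply continuity_pt_filterlim.
  apply (continuous_comp f Rabs); [apply C0_cont | apply continuous_Rabs].
- exists (Rabs (f m)); intros x.
  destruct (classic (0 <= x <= PI)) as [Hx|Hx]; [now apply Hm|].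
  rewrite C0_supp; [rewrite Rabs_R0; apply Rabs_pos | lra].
Qed.

Lemma C0_norm_lub (f : C0) :
  is_lub_Rbar (fun y => exists x, 0 <= x <= PI /\ y = Rabs (f x)) (Finite (C0_norm f)).
Proof.
unfold C0_norm.
set (E := fun y => _).
destruct (C0_bounded f) as [M HM].
pose proof (Lub_Rbar_correct E) as HL.
assert (E (Rabs (f 0))) as H0.
{ exists 0; split; [pose proof PI_RGT_0; lra | reflexivity]. }
assert (Rbar_le (Lub_Rbar E) M) as H1.
{ apply HL; intros y [x [_ ->]]; apply HM. }
assert (Rbar_le (Rabs (f 0)) (Lub_Rbar E)) as H2.
{ now apply HL. }
destruct (Lub_Rbar E); easy.
Qed.

Lemma C0_norm_ge (f : C0) x : Rabs (f x) <= C0_norm f.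
Proof.
destruct (C0_norm_lub f) as [H _].
destruct (classic (0 <= x <= PI)) as [Hx|Hx].
- apply (H (Rabs (f x))); now exists x.
- rewrite C0_supp by lra; rewrite Rabs_R0.
  apply Rle_trans with (Rabs (f 0)); [apply Rabs_pos|].
  apply (H (Rabs (f 0))); exists 0; pose proof PI_RGT_0; split; [lra | reflexivity].
Qed.

Lemma C0_norm_le (f : C0) M : (forall x, Rabs (f x) <= M) -> C0_norm f <= M.
Proof.
intros HM; destruct (C0_norm_lub f) as [_ H].
apply (H (Finite M)); intros y [x [_ ->]]; apply HM.
Qed.

Definition C0_AbelianMonoid_mixin : AbelianMonoid.mixin_of C0.
Proof.
apply (AbelianMonoid.Mixin C0 C0_plus C0_zero);
  intros; apply C0_ext; intros; simpl; ring.
Defined.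

Canonical C0_AbelianMonoid := AbelianMonoid.Pack C0 C0_AbelianMonoid_mixin C0.

Definition C0_AbelianGroup_mixin : AbelianGroup.mixin_of C0_AbelianMonoid.
Proof.
apply (AbelianGroup.Mixin C0_AbelianMonoid C0_opp);
  intros; apply C0_ext; intros; simpl; ring.
Defined.

Canonical C0_AbelianGroup :=
  AbelianGroup.Pack C0 (AbelianGroup.Class C0 _ C0_AbelianGroup_mixin) C0.

Definition C0_ModuleSpace_mixin : ModuleSpace.mixin_of R_Ring C0_AbelianGroup.
Proof.
apply (ModuleSpace.Mixin R_Ring C0_AbelianGroup C0_scal);
  intros; apply C0_ext; intros; simpl; unfold mult, plus, one; simpl; ring.
Defined.

Canonical C0_ModuleSpace :=
  ModuleSpace.Pack R_Ring C0 (ModuleSpace.Class R_Ring C0 _ C0_ModuleSpace_mixin) C0.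

Definition C0_ball (f : C0) (e : R) (g : C0) : Prop := C0_norm (minus g f) < e.

Lemma C0_norm_triangle (f g : C0) : C0_norm (plus f g) <= C0_norm f + C0_norm g.
Proof.
apply C0_norm_le; intros x; simpl.
eapply Rle_trans; [apply Rabs_triang|].
apply Rplus_le_compat; apply C0_norm_ge.
Qed.

Definition C0_UniformSpace_mixin : UniformSpace.mixin_of C0.
Proof.
apply (UniformSpace.Mixin C0 C0_zero C0_ball); unfold C0_ball.
- intros f e; eapply Rle_lt_trans; [|apply (cond_pos e)].
  apply C0_norm_le; intros x; simpl.
  rewrite Rplus_opp_r, Rabs_R0; apply Rle_refl.
- intros f g e; apply Rle_lt_trans; apply C0_norm_le; intros x.
  eapply Rle_trans; [|apply (C0_norm_ge _ x)]; simpl.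
  rewrite <- Rabs_Ropp; right; f_equal; ring.
- intros f g h e1 e2 H1 H2.
  eapply Rle_lt_trans; [|apply (Rplus_lt_compat _ _ _ _ H1 H2)].
  eapply Rle_trans; [|apply C0_norm_triangle].
  right; f_equal; apply C0_ext; intros x; simpl; ring.
Defined.

Canonical C0_UniformSpace := UniformSpace.Pack C0 C0_UniformSpace_mixin C0.

Canonical C0_NormedModuleAux :=
  NormedModuleAux.Pack R_AbsRing C0
    (NormedModuleAux.Class R_AbsRing C0
       (ModuleSpace.class R_Ring C0_ModuleSpace) C0_UniformSpace_mixin) C0.

Definition C0_NormedModule_mixin : NormedModule.mixin_of R_AbsRing C0_NormedModuleAux.
Proof.
apply (NormedModule.Mixin R_AbsRing C0_NormedModuleAux C0_norm 1).
- exact C0_norm_triangle.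
- intros k f; apply C0_norm_le; intros x.
  change (Rabs (k * f x) <= Rabs k * C0_norm f).
  rewrite Rabs_mult; apply Rmult_le_compat_l; [apply Rabs_pos | apply C0_norm_ge].
- intros f g e H; exact H.
- intros f g e H; rewrite Rmult_1_l; exact H.
- intros f H; apply C0_ext; intros x.
  pose proof (C0_norm_ge f x) as Hx; rewrite H in Hx; simpl.
  pose proof (Rabs_pos (f x)).
  destruct (Req_dec (f x) 0) as [E|E]; [exact E|].
  pose proof (Rabs_pos_lt _ E); lra.
Defined.

Canonical C0_NormedModule :=
  NormedModule.Pack R_AbsRing C0
    (NormedModule.Class R_AbsRing C0
       (NormedModuleAux.class R_AbsRing C0_NormedModuleAux) C0_NormedModule_mixin) C0.

Definition C0_lim (F : (C0 -> Prop) -> Prop) : C0 :=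
  epsilon (inhabits C0_zero) (fun l => forall eps : posreal, F (ball l eps)).

Lemma C0_complete (F : (C0 -> Prop) -> Prop) :
  ProperFilter F -> cauchy F -> exists l : C0, forall eps : posreal, F (ball l eps).
Proof.
intros FF HF.
set (G := filtermap (fun f : C0 => (f : R -> R)) F).
assert (ProperFilter G) as FG by (unfold G; apply filtermap_proper_filter, FF).
assert (forall eps : posreal, exists g : R -> R, G (ball g eps)) as HG.
{ intros eps; destruct (HF eps) as [f Hf]; exists f.
  unfold G, filtermap; revert Hf; apply filter_imp; intros g Hg x.
  eapply Rle_lt_trans; [|exact Hg].
  apply (C0_norm_ge (minus g f) x). }
pose proof (complete_cauchy_fct (U := R_CompleteSpace) G FG HG) as HL.
set (l := lim_fct G : R -> R) in HL.
assert (forall x, continuous l x) as lc.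
{ intros x; apply filterlim_locally; intros eps.
  pose (e := pos_div_2 (pos_div_2 eps)).
  destruct (filter_ex (F := F) _ (HL e)) as [f Hf].
  assert (locally x (fun y => ball (f x) e (f y))) as Hc.
  { apply (proj1 (filterlim_locally (F := locally x) f (f x)) (C0_cont f x) e). }
  revert Hc; apply filter_imp; intros y Hy.
  pose proof (Hf x) as Hx; pose proof (ball_sym _ _ _ (Hf y)) as Hy'.
  apply ball_le with (e + e + e).
  - simpl; pose proof (cond_pos eps); lra.
  - apply ball_triangle with (f y); [|exact Hy'].
    now apply ball_triangle with (f x). }
assert (forall x, ~ (0 < x < PI) -> l x = 0) as ls.
{ intros x Hx; apply NNPP; intros E.
  pose (e := mkposreal _ (Rabs_pos_lt _ E)).
  destruct (filter_ex (F := F) _ (HL e)) as [f Hf].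
  specialize (Hf x); rewrite (C0_supp f x Hx) in Hf.
  change (Rabs (0 - l x) < Rabs (l x)) in Hf.
  rewrite Rminus_0_l, Rabs_Ropp in Hf; lra. }
exists (mkC0 l lc ls); intros eps.
generalize (HL (pos_div_2 eps)); apply (filter_imp (F := F)); intros f Hf.
apply Rle_lt_trans with (eps / 2).
- apply C0_norm_le; intros x; apply Rlt_le, (Hf x).
- pose proof (cond_pos eps); lra.
Qed.

Definition C0_CompleteSpace_mixin : CompleteSpace.mixin_of C0_UniformSpace.
Proof.
apply (CompleteSpace.Mixin C0_UniformSpace C0_lim).
- intros F FF HF; unfold C0_lim; apply epsilon_spec.
  now apply C0_complete.
- intros F1 F2 H12 H21.
  replace F2 with F1; [intros eps; apply ball_center|].
  apply functional_extensionality; intros P; apply propositional_extensionality.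
  split; [apply H21 | apply H12].
Defined.

Canonical C0_CompleteSpace :=
  CompleteSpace.Pack C0
    (CompleteSpace.Class C0 C0_UniformSpace_mixin C0_CompleteSpace_mixin) C0.

Canonical C0_CompleteNormedModule :=
  CompleteNormedModule.Pack R_AbsRing C0
    (CompleteNormedModule.Class R_AbsRing C0
       (NormedModule.class R_AbsRing C0_NormedModule) C0_CompleteSpace_mixin) C0.

(** The graph of [L u = u_xx + lam u]: [L_graph lam u f] says that [u] is in
    [D(L)] and [L u = f]. Both derivatives are required to exist explicitly,
    because [Derive] is total and its value is meaningless at points where the
    function is not differentiable. *)
Definition L_graph (lam : R) (u f : C0) : Prop :=
  forall x, 0 < x < PI ->
    ex_derive u x /\ ex_derive (Derive u) x /\ f x = Derive_n u 2 x + lam * u x.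

Section Semigroup.

Context {V : NormedModule R_AbsRing}.

(** Only the values [S t] with [t >= 0] are constrained. *)
Record is_C0_semigroup (S : R -> V -> V) : Prop := {
  semigroup_linear : forall t, 0 <= t -> is_linear (S t);
  semigroup_0 : forall u, S 0 u = u;
  semigroup_plus : forall s t u, 0 <= s -> 0 <= t -> S (s + t) u = S s (S t u);
  semigroup_cont : forall u, filterlim (fun t => S t u) (at_right 0) (locally u)
}.

Definition generates (A : V -> V -> Prop) (S : R -> V -> V) : Prop :=
  is_C0_semigroup S /\
  forall u f : V,
    A u f <->
    filterlim (fun h : R => scal (/ h) (minus (S h u) u)) (at_right 0) (locally f).

End Semigroup.

(** [u] is a solution on [[t0, +oo)] with datum [u0]; its values before [t0]
    are irrelevant. The integral is the Riemann integral in the Banach space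
    [C0]. *)
Definition is_solution (S : R -> C0 -> C0) (b : R -> R) (t0 : R) (u0 : C0)
    (u : R -> C0) : Prop :=
  u t0 = u0 /\
  continuous_on (fun t => t0 <= t) u /\
  forall t, t0 <= t ->
    let integrand := fun s => S (t - s) (scal (b s) (C0_cube (u s))) in
    ex_RInt integrand t0 t /\
    u t = minus (S (t - t0) u0) (RInt integrand t0 t).

Definition is_periodic_orbit (S : R -> C0 -> C0) (b : R -> R) (u : R -> C0) : Prop :=
  (forall t, u (t + 1) = u t) /\
  forall t0, is_solution S b t0 (u t0) u.

(* Main.v *)
Require Import Defs.
From Stdlib Require Import Reals Lra Lia Arith.
From Stdlib Require Import Classical ClassicalEpsilon FunctionalExtensionality.
From Coquelicot Require Import Coquelicot.
Open Scope R_scope.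

(** Write a positive solution as [u = sin x * W^(-1/2)]: the equation for [W] has
    linear forcing, and profiles [W = A(t) + B(t) sin^2 x] solve it up to the error
    [6 B^2 y (1 - y) / W], [y = sin^2 x], when [A' = 6 B - 2 (lam - 1) A] and
    [B' = 2 b - (6 + 2 lam) B].  Periodic profiles [W2 <= W1] thus give periodic lower
    and upper barriers [sin x * W1^(-1/2) <= u <= sin x * W2^(-1/2)], even where [b]
    is negative.  For the linearization along any solution trapped between them,
    [psi = sin x * W1^(-3/2)] is a strict supersolution (in the ODE case, the cube of
    a solution solves the linearized equation up to an exponential factor), so
    trapped solutions contract exponentially: if [U] is one of them, the limit of
    [U (t + n)] is the periodic orbit.  Adding a small multiple of the concave
    function [1 + lam x (pi - x)] to [psi] makes it positive at the boundary and gives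
    the stability under arbitrary small perturbations.

    The barriers are compared with mild solutions of the equation with truncated
    nonlinearity, for the abstract semigroup, by regularizing a mild solution with
    [h^(-1) int_0^h S(s) ds], which maps into the domain of [L]. *)

(** * The space C_0(0, pi) *)

(** The substitution is Bernoulli's: in terms of [W] the cubic term becomes the source
    [2 b sin^2 x], and the linear part preserves functions affine in [sin^2 x]. The quadratic
    gradient error has a sign. It helps a lower barrier, so [W1] may follow the linear system up to
    rounding, whereas an upper barrier must pay for it with a smaller profile [W2]. A negative [b]
    does not disturb the ordering of the barriers; it harms the contraction, because [3 b v] is then
    worst for the largest admissible [v]. Hence [W2] must be close to [W1] where [b < 0], which
    dictates the numerical profiles. The semigroup is known only through its generator: no kernel,
    positivity or growth bound is given, and both order and growth are extracted from the maximum
    principle. Truncating the cube makes it globally Lipschitz, so that solutions exist for all time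
    before any bound is known; the barriers then show that the truncation is never active. *)

Ltac C0_ring :=
  apply C0_ext; intros; repeat (progress (unfold minus; simpl)); first [ring | field; lra].

Lemma norm_minus_sym (f g : C0) : norm (minus f g) = norm (minus g f).
Proof.
replace (minus f g) with (opp (minus g f)) by C0_ring.
apply (norm_opp (V := C0_NormedModule)).
Qed.

Lemma norm_minus_diag (f : C0) : norm (minus f f) = 0.
Proof.
apply Rle_antisym; [|apply (norm_ge_0 (V := C0_NormedModule))].
apply C0_norm_le; intros x; simpl; rewrite Rplus_opp_r, Rabs_R0; apply Rle_refl.
Qed.

Lemma norm_minus_triangle (f g h : C0) :
  norm (minus f h) <= norm (minus f g) + norm (minus g h).
Proof.
replace (minus f h) with (plus (minus f g) (minus g h)) by C0_ring.
apply (norm_triangle (V := C0_NormedModule)).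
Qed.

Lemma norm_le_minus (f g : C0) : norm f <= norm g + norm (minus f g).
Proof.
replace f with (plus g (minus f g)) at 1 by C0_ring.
apply (norm_triangle (V := C0_NormedModule)).
Qed.

(** The converse inequality is the usual one applied to [/ k] and [scal k f]. *)
Lemma norm_C0_scal (k : R) (f : C0) : norm (scal k f) = Rabs k * norm f.
Proof.
apply Rle_antisym; [apply (norm_scal (V := C0_NormedModule)) |].
destruct (Req_dec k 0) as [->|Hk].
- rewrite Rabs_R0, Rmult_0_l; apply (norm_ge_0 (V := C0_NormedModule)).
- replace f with (scal (/ k) (scal k f)) at 1.
  2:{ C0_ring. }
  pose proof (norm_scal (V := C0_NormedModule) (/ k) (scal k f)) as H.
  change (abs (/ k)) with (Rabs (/ k)) in H.
  apply Rabs_no_R0 in Hk as Hk'.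
  rewrite Rabs_inv in H.
  pose proof (Rabs_pos_lt _ Hk).
  apply Rmult_le_reg_l with (/ Rabs k); [now apply Rinv_0_lt_compat|].
  rewrite <- Rmult_assoc, Rinv_l, Rmult_1_l by lra; exact H.
Qed.

Lemma C0_eval_le (f g : C0) x : Rabs (f x - g x) <= norm (minus f g).
Proof. apply (C0_norm_ge (minus f g) x). Qed.

Lemma norm_minus_eq0 (f g : C0) : norm (minus f g) <= 0 -> f = g.
Proof.
intros H; apply C0_ext; intros x.
pose proof (C0_eval_le f g x) as Hx; pose proof (Rabs_pos (f x - g x)).
destruct (Req_dec (f x - g x) 0); [lra|].
pose proof (Rabs_pos_lt (f x - g x)); tauto || lra.
Qed.

Lemma continuous_C0P (f : R -> C0) t :
  continuous f t <->
  forall eps, 0 < eps -> exists d, 0 < d /\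
    forall s, Rabs (s - t) < d -> norm (minus (f s) (f t)) < eps.
Proof.
split.
- intros H eps He.
  destruct (proj1 (filterlim_locally (F := locally t) f (f t)) H (mkposreal _ He)) as [d Hd].
  exists d; split; [apply cond_pos|]; intros s Hs; apply (Hd s Hs).
- intros H; apply (filterlim_locally (F := locally t) f (f t)); intros eps.
  destruct (H eps (cond_pos eps)) as [d [Hd H']].
  exists (mkposreal d Hd); intros s Hs; apply (H' s Hs).
Qed.

Lemma at_right_C0P (f : R -> C0) (l : C0) :
  filterlim f (at_right 0) (locally l) <->
  forall eps, 0 < eps -> exists d, 0 < d /\
    forall s, 0 < s < d -> norm (minus (f s) l) < eps.
Proof.
split.
- intros H eps He.
  destruct (proj1 (filterlim_locally (F := at_right 0) f l) H (mkposreal _ He)) as [d Hd].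
  exists d; split; [apply cond_pos|]; intros s Hs; apply (Hd s); [|apply Hs].
  change (Rabs (s - 0) < d); rewrite Rminus_0_r, Rabs_pos_eq; lra.
- intros H; apply (filterlim_locally (F := at_right 0) f l); intros eps.
  destruct (H eps (cond_pos eps)) as [d [Hd H']].
  exists (mkposreal d Hd); intros s Hs Hs0; apply (H' s).
  change (Rabs (s - 0) < d) in Hs; rewrite Rminus_0_r, Rabs_pos_eq in Hs; lra.
Qed.

Lemma C0_complete_seq (x : nat -> C0) :
  (forall eps, 0 < eps -> exists N, forall n m, (N <= n)%nat -> (N <= m)%nat ->
     norm (minus (x n) (x m)) < eps) ->
  exists l, forall eps, 0 < eps -> exists N, forall n, (N <= n)%nat ->
     norm (minus (x n) l) < eps.
Proof.
intros H.
destruct (proj1 (filterlim_locally_cauchy (U := C0_CompleteSpace) (F := eventually) x))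
  as [l Hl].
- intros eps; destruct (H eps (cond_pos eps)) as [N HN].
  exists (fun n => (N <= n)%nat); split; [now exists N|].
  intros u v Hu Hv; apply (HN v u Hv Hu).
- exists l; intros eps He.
  destruct (proj1 (filterlim_locally (F := eventually) x l) Hl (mkposreal _ He)) as [N HN].
  exists N; intros n Hn; apply (HN n Hn).
Qed.

(** The steps telescope to a geometric tail. The explicit rate is kept because later limits, such as
    the one in Duhamel's formula, are taken by bounding every error by a multiple of [q ^ n]. *)
Lemma C0_geometric_limit (x : nat -> C0) (c q : R) :
  0 <= q < 1 -> (forall n, norm (minus (x (S n)) (x n)) <= c * q ^ n) ->
  exists l, forall n, norm (minus l (x n)) <= c / (1 - q) * q ^ n.
Proof.
intros Hq H.
assert (Hc : 0 <= c).
{ specialize (H O); rewrite pow_O, Rmult_1_r in H.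
  pose proof (norm_ge_0 (V := C0_NormedModule) (minus (x 1%nat) (x O))); lra. }
assert (Hpos : 0 <= c / (1 - q)) by (apply Rdiv_le_0_compat; lra).
assert (Hstep : forall n k, norm (minus (x (n + k)%nat) (x n)) <= c / (1 - q) * (q ^ n - q ^ (n + k))).
{ intros n k; induction k as [|k IH].
  - rewrite Nat.add_0_r, norm_minus_diag; right; ring.
  - eapply Rle_trans; [apply (norm_minus_triangle _ (x (n + k)%nat))|].
    rewrite Nat.add_succ_r; specialize (H (n + k)%nat).
    replace (q ^ S (n + k)) with (q * q ^ (n + k)) by reflexivity.
    replace (c / (1 - q) * (q ^ n - q * q ^ (n + k))) with
      (c * q ^ (n + k) + c / (1 - q) * (q ^ n - q ^ (n + k))) by (field; lra).
    lra. }
assert (Hk : forall n k, norm (minus (x (n + k)%nat) (x n)) <= c / (1 - q) * q ^ n).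
{ intros n k; eapply Rle_trans; [apply Hstep|].
  apply Rmult_le_compat_l; [exact Hpos|].
  pose proof (pow_le q (n + k) (proj1 Hq)); lra. }
assert (Hlim : forall eps, 0 < eps -> exists N, forall n, (N <= n)%nat -> c / (1 - q) * q ^ n < eps).
{ intros eps He.
  destruct (pow_lt_1_zero q) with (y := eps / (c / (1 - q) + 1)) as [N HN].
  - rewrite Rabs_pos_eq; lra.
  - apply Rdiv_lt_0_compat; lra.
  - exists N; intros n Hn; specialize (HN n Hn).
    rewrite Rabs_pos_eq in HN by (apply pow_le; lra).
    apply Rmult_lt_compat_l with (r := c / (1 - q) + 1) in HN; [|lra].
    replace ((c / (1 - q) + 1) * (eps / (c / (1 - q) + 1))) with eps in HN by (field; split; nra || lra).
    pose proof (pow_le q n (proj1 Hq)); lra. }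
destruct (C0_complete_seq x) as [l Hl].
- intros eps He; destruct (Hlim (eps / 2)) as [N HN]; [lra|].
  exists N; intros n m Hn Hm.
  apply Rle_lt_trans with (norm (minus (x n) (x N)) + norm (minus (x m) (x N))).
  { rewrite (norm_minus_sym (x m)); apply norm_minus_triangle. }
  pose proof (Hk N (n - N)%nat) as H1; pose proof (Hk N (m - N)%nat) as H2.
  replace (N + (n - N))%nat with n in H1 by lia.
  replace (N + (m - N))%nat with m in H2 by lia.
  specialize (HN N (le_n N)); lra.
- exists l; intros n; apply le_epsilon; intros eps He.
  destruct (Hl eps He) as [N HN].
  eapply Rle_trans; [apply (norm_minus_triangle _ (x (n + N)%nat))|].
  rewrite Rplus_comm; apply Rplus_le_compat; [apply Hk|].
  rewrite norm_minus_sym; left; apply HN; lia.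
Qed.

(** [is_linear] includes boundedness, so [l] commutes with Riemann sums and with their limit. *)
Lemma is_RInt_C0_linear (l : C0 -> C0) (f : R -> C0) a b I :
  is_linear l -> is_RInt f a b I -> is_RInt (fun s => l (f s)) a b (l I).
Proof.
intros Hl H.
assert (Hsum : forall ptd : SF_seq, Riemann_sum (fun s => l (f s)) ptd = l (Riemann_sum f ptd)).
{ intros ptd; apply (SF_cons_ind (fun ptd => Riemann_sum (fun s => l (f s)) ptd = l (Riemann_sum f ptd))).
  - intros x0; unfold Riemann_sum; simpl; symmetry; apply (linear_zero l Hl).
  - intros h s IH; rewrite !Riemann_sum_cons, IH, (linear_plus l Hl), (linear_scal l Hl).
    reflexivity. }
unfold is_RInt.
apply (filterlim_ext (fun ptd => l (scal (sign (b - a)) (Riemann_sum f ptd)))).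
- intros ptd; rewrite (linear_scal l Hl), Hsum; reflexivity.
- apply (filterlim_comp _ _ _ _ l _ _ _ H).
  apply (linear_cont l I Hl).
Qed.

Lemma RInt_C0_linear (l : C0 -> C0) (f : R -> C0) a b :
  is_linear l -> ex_RInt f a b -> RInt (fun s => l (f s)) a b = l (RInt f a b).
Proof.
intros Hl H; apply (is_RInt_unique (V := C0_CompleteNormedModule)).
apply (is_RInt_C0_linear l f a b _ Hl), (RInt_correct (V := C0_CompleteNormedModule)), H.
Qed.

Lemma ex_RInt_C0 (f : R -> C0) a b : (forall t, continuous f t) -> ex_RInt f a b.
Proof. intros H; apply (ex_RInt_continuous (V := C0_CompleteNormedModule)); intros; apply H. Qed.

Lemma norm_RInt_C0_le (f : R -> C0) (g : R -> R) a b :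
  a <= b -> (forall t, continuous f t) -> (forall s, a <= s <= b -> norm (f s) <= g s) ->
  ex_RInt g a b -> norm (RInt f a b) <= RInt g a b.
Proof.
intros Hab Hf Hg Ig.
apply (norm_RInt_le (V := C0_NormedModule) f g a b); try assumption.
- now apply (RInt_correct (V := C0_CompleteNormedModule)), ex_RInt_C0.
- now apply (RInt_correct (V := R_CompleteNormedModule)).
Qed.

Lemma norm_RInt_C0_le_const (f : R -> C0) c a b :
  a <= b -> (forall t, continuous f t) -> (forall s, a <= s <= b -> norm (f s) <= c) ->
  norm (RInt f a b) <= (b - a) * c.
Proof.
intros Hab Hf Hc.
apply (norm_RInt_le_const (V := C0_NormedModule) f a b); try assumption.
now apply (RInt_correct (V := C0_CompleteNormedModule)), ex_RInt_C0.
Qed.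

Lemma RInt_C0_minus (f g : R -> C0) a b :
  (forall t, continuous f t) -> (forall t, continuous g t) ->
  RInt (fun s => minus (f s) (g s)) a b = minus (RInt f a b) (RInt g a b).
Proof.
intros Hf Hg; apply (RInt_minus (V := C0_CompleteNormedModule)); now apply ex_RInt_C0.
Qed.

Lemma RInt_C0_shift (f : R -> C0) c a b :
  (forall t, continuous f t) -> RInt (fun s => f (s + c)) a b = RInt f (a + c) (b + c).
Proof.
intros Hf.
rewrite <- (RInt_ext (V := C0_CompleteNormedModule) (fun s => scal 1 (f (1 * s + c)))).
- rewrite (RInt_comp_lin (V := C0_CompleteNormedModule)), !Rmult_1_l; [reflexivity|].
  now apply ex_RInt_C0.
- intros s _; rewrite Rmult_1_l; C0_ring.
Qed.

Lemma continuous_C0_minus (f g : R -> C0) t :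
  continuous f t -> continuous g t -> continuous (fun s => minus (f s) (g s)) t.
Proof. apply (continuous_minus (V := C0_NormedModule)). Qed.

Lemma RInt_C0_mean_near (f : R -> C0) w a b eps : a < b ->
  (forall t, continuous f t) -> (forall s, a <= s <= b -> norm (minus (f s) w) <= eps) ->
  norm (minus (scal (/ (b - a)) (RInt f a b)) w) <= eps.
Proof.
intros Hab Hf H.
assert (Ew : RInt (fun _ : R => w) a b = scal (b - a) w).
{ apply (RInt_const (V := C0_CompleteNormedModule)). }
assert (Hw : forall t : R, continuous (fun _ : R => w) t) by (intros; apply continuous_const).
assert (minus (scal (/ (b - a)) (RInt f a b)) w =
  scal (/ (b - a)) (RInt (fun s => minus (f s) w) a b)) as ->.
{ rewrite RInt_C0_minus, Ew by assumption; C0_ring. }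
rewrite norm_C0_scal, Rabs_pos_eq by (left; apply Rinv_0_lt_compat; lra).
apply Rmult_le_reg_l with (b - a); [lra|].
rewrite <- Rmult_assoc, Rinv_r, Rmult_1_l by lra.
apply norm_RInt_C0_le_const; [lra | | exact H].
intros t; now apply continuous_C0_minus.
Qed.

(** * Strongly continuous semigroups *)

Lemma linear_C0_minus (l : C0 -> C0) f g :
  is_linear l -> l (minus f g) = minus (l f) (l g).
Proof.
intros Hl.
replace (minus f g) with (plus f (scal (-1) g)) by C0_ring.
rewrite (linear_plus l Hl), (linear_scal l Hl); C0_ring.
Qed.

(** Differences of points of the ball cover a ball around the origin, on which [l] is bounded by
    [2 * M]; a vector is rescaled to length [r / 2] to fall into it. *)
Lemma linear_bounded_of_ball (l : C0 -> C0) x r M :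
  is_linear l -> 0 < r -> (forall y, norm (minus y x) < r -> norm (l y) <= M) ->
  forall f, norm (l f) <= 4 * M / r * norm f.
Proof.
intros Hl Hr HM f.
destruct (linear_norm l Hl) as [c [Hc Hlc]].
destruct (Req_dec (norm f) 0) as [E|E].
- specialize (Hlc f); rewrite E in *; lra.
- pose proof (norm_ge_0 (V := C0_NormedModule) f) as Hf.
  assert (0 < norm f) as Hf' by lra.
  pose (k := r / 2 / norm f).
  assert (0 < k) as Hk by (unfold k; repeat apply Rdiv_lt_0_compat; lra).
  assert (l (scal k f) = minus (l (plus x (scal k f))) (l x)) as Ek.
  { rewrite (linear_plus l Hl); C0_ring. }
  assert (norm (l (scal k f)) <= M + M) as H1.
  { rewrite Ek; eapply Rle_trans; [apply (norm_triangle (V := C0_NormedModule))|].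
    rewrite (norm_opp (V := C0_NormedModule)).
    apply Rplus_le_compat; apply HM.
    - replace (minus (plus x (scal k f)) x) with (scal k f) by C0_ring.
      rewrite norm_C0_scal, Rabs_pos_eq by lra.
      replace (k * norm f) with (r / 2) by (unfold k; field; lra); lra.
    - rewrite norm_minus_diag; exact Hr. }
  rewrite (linear_scal l Hl), norm_C0_scal, Rabs_pos_eq in H1 by lra.
  apply Rmult_le_reg_l with k; [exact Hk|].
  replace (k * (4 * M / r * norm f)) with (M + M) by (unfold k; field; lra); exact H1.
Qed.

(* Baire-type argument: if the family were bounded on no ball, nested balls on
   which ever larger values are exceeded would shrink to a point of divergence. *)
Lemma uniform_boundedness (T : nat -> C0 -> C0) :
  (forall n, is_linear (T n)) -> (forall f, exists M, forall n, norm (T n f) <= M) ->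
  exists M, forall n f, norm (T n f) <= M * norm f.
Proof.
intros Hl Hb.
destruct (classic (exists x r M, 0 < r /\
  forall y, norm (minus y x) < r -> forall n, norm (T n y) <= M)) as [H|H].
{ destruct H as [x [r [M [Hr H]]]]; exists (4 * M / r); intros n f.
  apply (linear_bounded_of_ball (T n) x r M); auto. }
exfalso.
(* A pair is the centre and radius of a closed ball. [Q m p p']: the ball [p'] lies inside [p], has
   at most half its radius, and a single [T n] exceeds [m] on all of it. *)
pose (Q := fun (m : nat) (p p' : C0 * R) =>
  0 < snd p' <= snd p / 2 /\ norm (minus (fst p') (fst p)) <= snd p / 2 /\
  exists n, forall z, norm (minus z (fst p')) <= snd p' -> INR m < norm (T n z)).
assert (Hstep : forall m p, 0 < snd p -> exists p', Q m p p').
{ intros m [x r] Hr; simpl in Hr; apply NNPP; intros HQ; apply H.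
  exists x, (r / 2), (INR m); split; [lra|]; intros y Hy n.
  apply Rnot_lt_le; intros Hn; apply HQ.
  destruct (linear_norm (T n) (Hl n)) as [c [Hc Hlc]].
  (* The bound [c] of this one operator preserves half of the excess [gap] on a small ball around
     [y]. *)
  pose (gap := norm (T n y) - INR m).
  assert (0 < gap / (2 * c)) by (apply Rdiv_lt_0_compat; unfold gap; lra).
  exists (y, Rmin (r / 2) (gap / (2 * c))); split; [|split]; simpl.
  - split; [apply Rmin_glb_lt; lra | apply Rmin_l].
  - exact (Rlt_le _ _ Hy).
  - exists n; intros z Hz.
    pose proof (Rmin_r (r / 2) (gap / (2 * c))) as Hm.
    specialize (Hlc (minus z y)); rewrite (linear_C0_minus _ _ _ (Hl n)) in Hlc.
    pose proof (norm_le_minus (T n y) (T n z)) as Ht; rewrite norm_minus_sym in Ht.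
    assert (c * norm (minus z y) <= c * (gap / (2 * c))) as Hg.
    { apply Rmult_le_compat_l; [lra|]. eapply Rle_trans; [exact Hz | exact Hm]. }
    replace (c * (gap / (2 * c))) with (gap / 2) in Hg by (field; lra).
    unfold gap in *; lra. }
pose (step := fun m p => epsilon (inhabits p) (Q m p)).
pose (sq := fix sq n := match n with O => (C0_zero, 1) | S m => step m (sq m) end).
assert (Hpos : forall n, 0 < snd (sq n)).
{ intros n; induction n as [|n IH]; [simpl; lra|].
  apply (epsilon_spec (inhabits (sq n)) (Q n (sq n)) (Hstep n _ IH)). }
assert (HQ : forall n, Q n (sq n) (sq (S n))).
{ intros n; apply (epsilon_spec (inhabits (sq n)) (Q n (sq n)) (Hstep n _ (Hpos n))). }
assert (Hr : forall n, snd (sq n) <= (/ 2) ^ n).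
{ intros n; induction n as [|n IH]; [simpl; lra|].
  destruct (HQ n) as [[_ H1] _]; simpl pow; lra. }
assert (Hnest : forall n k, norm (minus (fst (sq (n + k)%nat)) (fst (sq n))) + snd (sq (n + k)%nat) <= snd (sq n)).
{ intros n k; induction k as [|k IH].
  - rewrite Nat.add_0_r, norm_minus_diag; lra.
  - rewrite Nat.add_succ_r.
    destruct (HQ (n + k)%nat) as [[_ H1] [H2 _]].
    pose proof (norm_minus_triangle (fst (sq (S (n + k)))) (fst (sq (n + k)%nat)) (fst (sq n))).
    lra. }
destruct (C0_geometric_limit (fun n => fst (sq n)) 1 (/ 2)) as [l Hlim]; [lra| |].
{ intros n; destruct (HQ n) as [_ [H2 _]]; specialize (Hr n); specialize (Hpos n); lra. }
assert (Hin : forall n, norm (minus l (fst (sq n))) <= snd (sq n)).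
{ intros n; apply le_epsilon; intros eps He.
  destruct (pow_lt_1_zero (/ 2)) with (y := eps / 2) as [N HN]; [rewrite Rabs_pos_eq; lra | lra |].
  specialize (Hlim (n + N)%nat); specialize (HN (n + N)%nat ltac:(lia)).
  rewrite Rabs_pos_eq in HN by (apply pow_le; lra).
  pose proof (norm_minus_triangle l (fst (sq (n + N)%nat)) (fst (sq n))).
  specialize (Hnest n N); specialize (Hpos (n + N)%nat).
  replace (1 / (1 - / 2)) with 2 in Hlim by field; lra. }
destruct (Hb l) as [M HM].
destruct (INR_unbounded M) as [m Hm].
destruct (HQ m) as [_ [_ [n Hn]]].
specialize (Hn l (Hin (S m))); specialize (HM n); lra.
Qed.

Section Semigroup.

Context (T : R -> C0 -> C0) (HT : is_C0_semigroup (V := C0_NormedModule) T).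

(** Otherwise there are times [t n <= / (n + 1)] at which [T (t n)] has norm above [n]. Strong
    continuity at 0 bounds each sequence [T (t n) f] for large [n], so uniform boundedness applies
    and contradicts this. *)
Lemma semigroup_bounded_near_0 :
  exists d M, 0 < d /\ forall t f, 0 <= t <= d -> norm (T t f) <= M * norm f.
Proof.
apply NNPP; intros H.
assert (Hn : forall n : nat, exists t, 0 <= t <= / (INR n + 1) /\
  exists f, INR n * norm f < norm (T t f)).
{ intros n; apply NNPP; intros H'; apply H.
  exists (/ (INR n + 1)), (INR n); split.
  - apply Rinv_0_lt_compat; pose proof (pos_INR n); lra.
  - intros t f Ht; apply Rnot_lt_le; intros Hf; apply H'; exists t; split; [exact Ht|].
    now exists f. }
apply choice in Hn; destruct Hn as [t Ht].
destruct (uniform_boundedness (fun n => T (t n))) as [M HM].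
- intros n; apply (semigroup_linear T HT), Ht.
- intros f.
  destruct (proj1 (at_right_C0P _ f) (semigroup_cont T HT f) 1 Rlt_0_1) as [d [Hd Hd']].
  assert (exists N, forall n, (N <= n)%nat -> norm (T (t n) f) <= norm f + 1) as [N HN].
  { destruct (INR_unbounded (/ d)) as [N HN]; exists N; intros n Hn.
    destruct (Ht n) as [[H0 H1] _].
    destruct (Rle_lt_or_eq_dec _ _ H0) as [H2|H2].
    - eapply Rle_trans; [apply (norm_le_minus _ f)|]; apply Rplus_le_compat_l, Rlt_le, Hd'.
      split; [exact H2|]; eapply Rle_lt_trans; [exact H1|].
      apply le_INR in Hn.
      rewrite <- (Rinv_inv d); apply Rinv_lt_contravar; [|lra].
      apply Rmult_lt_0_compat; [now apply Rinv_0_lt_compat|].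
      pose proof (Rinv_0_lt_compat d Hd); lra.
    - rewrite <- H2, (semigroup_0 T HT); lra. }
  assert (Hfin : forall k, exists M, forall n, (n < k)%nat -> norm (T (t n) f) <= M).
  { intros k; induction k as [|k [M HM]]; [exists 0; intros; lia|].
    exists (Rmax M (norm (T (t k) f))); intros n Hn.
    destruct (Nat.eq_dec n k) as [->|Hk]; [apply Rmax_r|].
    eapply Rle_trans; [apply HM; lia | apply Rmax_l]. }
  destruct (Hfin N) as [M HM]; exists (Rmax M (norm f + 1)); intros n.
  destruct (le_lt_dec N n) as [Hn|Hn].
  + eapply Rle_trans; [now apply HN | apply Rmax_r].
  + eapply Rle_trans; [now apply HM | apply Rmax_l].
- destruct (INR_unbounded M) as [n Hn]; destruct (Ht n) as [_ [f Hf]].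
  specialize (HM n f).
  pose proof (norm_ge_0 (V := C0_NormedModule) f).
  pose proof (Rmult_le_compat_r (norm f) M (INR n)); lra.
Qed.

Lemma semigroup_locally_bounded t1 :
  exists M, 0 < M /\ forall t f, 0 <= t <= t1 -> norm (T t f) <= M * norm f.
Proof.
destruct semigroup_bounded_near_0 as [d [M [Hd HM]]].
assert (Hn : forall n : nat, exists M', 0 < M' /\
  forall t f, 0 <= t <= INR n * d -> norm (T t f) <= M' * norm f).
{ intros n; induction n as [|n [M' [HM' IH]]].
  - exists 1; split; [lra|]; intros t f Ht; simpl in Ht.
    replace t with 0 by lra; rewrite (semigroup_0 T HT); lra.
  - exists ((Rabs M + 1) * M' + M'); split; [pose proof (Rabs_pos M); nra|].
    intros t f Ht; rewrite S_INR in Ht.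
    pose proof (norm_ge_0 (V := C0_NormedModule) f) as Hf; pose proof (Rabs_pos M).
    destruct (Rle_lt_dec t (INR n * d)) as [Htn|Htn].
    + specialize (IH t f ltac:(lra)).
      assert (0 <= (Rabs M + 1) * M' * norm f) by (repeat apply Rmult_le_pos; lra); lra.
    + pose proof (pos_INR n).
      assert (0 <= INR n * d) by nra.
      replace t with ((t - INR n * d) + INR n * d) by ring.
      rewrite (semigroup_plus T HT) by lra.
      specialize (IH (INR n * d) f ltac:(lra)).
      specialize (HM (t - INR n * d) (T (INR n * d) f) ltac:(lra)).
      pose proof (norm_ge_0 (V := C0_NormedModule) (T (INR n * d) f)) as Hg.
      pose proof (Rle_abs M).
      set (y := norm (T (INR n * d) f)) in *.
      assert (M * y <= Rabs M * y) by (apply Rmult_le_compat_r; lra).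
      assert (Rabs M * y <= Rabs M * (M' * norm f)) by (apply Rmult_le_compat_l; lra).
      assert (0 <= M' * norm f) by (apply Rmult_le_pos; lra).
      lra. }
destruct (INR_unbounded (t1 / d)) as [n Hn'].
destruct (Hn n) as [M' [HM' H]]; exists M'; split; [exact HM'|].
intros t f Ht; apply H; split; [lra|].
apply Rmult_lt_compat_r with (r := d) in Hn'; [|exact Hd].
unfold Rdiv in Hn'; rewrite Rmult_assoc, Rinv_l in Hn'; lra.
Qed.

(** Nothing is assumed about [T t] for [t < 0]. Clamping the time gives a family that is strongly
    continuous on the whole line, so that Duhamel integrands are continuous everywhere and
    integrable on every interval. *)
Definition forward (t : R) : C0 -> C0 := T (Rmax 0 t).

Lemma forward_linear t : is_linear (forward t).
Proof. apply (semigroup_linear T HT), Rmax_l. Qed.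

Lemma forward_eq t f : 0 <= t -> forward t f = T t f.
Proof. intros H; unfold forward; now rewrite Rmax_right. Qed.

Lemma forward_0 f : forward 0 f = f.
Proof. rewrite forward_eq by lra; apply (semigroup_0 T HT). Qed.

Lemma forward_plus s t f : 0 <= s -> 0 <= t -> forward (s + t) f = forward s (forward t f).
Proof. intros; rewrite !forward_eq by lra; now apply (semigroup_plus T HT). Qed.

Lemma forward_comm s t f : 0 <= s -> 0 <= t -> forward s (forward t f) = forward t (forward s f).
Proof. intros; rewrite <- !forward_plus by lra; f_equal; ring. Qed.

Lemma forward_bounded t1 :
  exists M, 0 < M /\ forall t f, t <= t1 -> norm (forward t f) <= M * norm f.
Proof.
destruct (semigroup_locally_bounded (Rmax 0 t1)) as [M [HM H]].
exists M; split; [exact HM|]; intros t f Ht; apply H; split; [apply Rmax_l|].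
now apply Rle_max_compat_l.
Qed.

(** Factoring out the propagator of the smaller time reduces continuity in time to continuity at
    time 0. *)
Lemma forward_diff_le t1 :
  exists M, 0 < M /\ forall s t f, s <= t1 -> t <= t1 ->
    exists r, 0 <= r <= Rabs (s - t) /\
      norm (minus (forward s f) (forward t f)) <= M * norm (minus (forward r f) f).
Proof.
destruct (forward_bounded t1) as [M [HM H]]; exists M; split; [exact HM|].
assert (Hle : forall s t f, s <= t -> t <= t1 -> exists r, 0 <= r <= Rabs (s - t) /\
      norm (minus (forward s f) (forward t f)) <= M * norm (minus (forward r f) f)).
{ intros s t f Hst Ht; exists (Rmax 0 t - Rmax 0 s); split.
  - rewrite Rabs_left1 by lra; unfold Rmax; repeat destruct Rle_dec; lra.
  - replace (forward t f) with (forward s (forward (Rmax 0 t - Rmax 0 s) f)).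
    + rewrite <- linear_C0_minus by apply forward_linear.
      eapply Rle_trans; [apply H; lra|].
      rewrite norm_minus_sym; apply Rle_refl.
    + unfold forward at 1 2; rewrite <- (semigroup_plus T HT); [|apply Rmax_l..].
      unfold forward; f_equal; unfold Rmax; repeat destruct Rle_dec; lra. }
intros s t f Hs Ht; destruct (Rle_lt_dec s t) as [Hst|Hst]; [now apply Hle|].
destruct (Hle t s f ltac:(lra) Hs) as [r [Hr Hr']].
exists r; split; [now rewrite Rabs_minus_sym|]; now rewrite norm_minus_sym.
Qed.

Lemma forward_at_0 f eps : 0 < eps -> exists d, 0 < d /\
  forall r, r <= d -> norm (minus (forward r f) f) < eps.
Proof.
intros He.
destruct (proj1 (at_right_C0P _ f) (semigroup_cont T HT f) eps He) as [d [Hd Hd']].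
exists (d / 2); split; [lra|]; intros r Hr; unfold forward.
destruct (Rle_lt_dec r 0) as [H|H].
- rewrite Rmax_left by lra; rewrite (semigroup_0 T HT), norm_minus_diag; exact He.
- rewrite Rmax_right by lra; apply Hd'; lra.
Qed.

Lemma forward_continuous_comp (a : R -> R) (g : R -> C0) t :
  continuous a t -> continuous g t -> continuous (fun s => forward (a s) (g s)) t.
Proof.
intros Ha Hg; apply continuous_C0P; intros eps He.
destruct (forward_diff_le (a t + 1)) as [M [HM H]].
destruct (forward_bounded (a t + 1)) as [M' [HM' H']].
destruct (forward_at_0 (g t) (eps / 2 / M)) as [d [Hd Hd']].
{ repeat apply Rdiv_lt_0_compat; lra. }
assert (0 < Rmin 1 d) as Hd1 by (apply Rmin_glb_lt; lra).
destruct (proj1 (filterlim_locally (F := locally t) a (a t)) Ha (mkposreal _ Hd1)) as [d2 Hd2].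
destruct (proj1 (continuous_C0P g t) Hg (eps / 2 / M')) as [d3 [Hd3 Hg']].
{ repeat apply Rdiv_lt_0_compat; lra. }
exists (Rmin d2 d3); split; [apply Rmin_glb_lt; [apply cond_pos | lra]|]; intros s Hs.
assert (Rabs (a s - a t) < Rmin 1 d) as Has.
{ apply (Hd2 s); eapply Rlt_le_trans; [exact Hs | apply Rmin_l]. }
pose proof (Rmin_l 1 d); pose proof (Rmin_r 1 d).
assert (a s <= a t + 1) by (apply Rabs_def2 in Has; lra).
eapply Rle_lt_trans; [apply (norm_minus_triangle _ (forward (a s) (g t)))|].
rewrite <- linear_C0_minus by apply forward_linear.
destruct (H (a s) (a t) (g t)) as [r [Hr Hr']]; [assumption | lra |].
specialize (Hd' r ltac:(lra)).
specialize (Hg' s ltac:(eapply Rlt_le_trans; [exact Hs | apply Rmin_r])).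
specialize (H' (a s) (minus (g s) (g t)) ltac:(assumption)).
apply Rmult_lt_compat_l with (r := M) in Hd'; [|exact HM].
apply Rmult_lt_compat_l with (r := M') in Hg'; [|exact HM'].
replace (M * (eps / 2 / M)) with (eps / 2) in Hd' by (field; lra).
replace (M' * (eps / 2 / M')) with (eps / 2) in Hg' by (field; lra).
lra.
Qed.

Lemma forward_continuous f t : continuous (fun s => forward s f) t.
Proof. apply forward_continuous_comp; [apply continuous_id | apply continuous_const]. Qed.

Lemma duhamel_continuous (g : R -> C0) t s :
  (forall r, continuous g r) -> continuous (fun s => forward (t - s) (g s)) s.
Proof.
intros Hg; apply forward_continuous_comp; [|apply Hg].
apply (continuous_minus (fun _ => t) (fun s => s)); [apply continuous_const | apply continuous_id].
Qed.

(* Compactness of [[a, b]] makes the strong continuity at time 0 uniform along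
   the curve [u]. *)
Lemma forward_at_0_uniform (u : R -> C0) a b eps :
  (forall t, continuous u t) -> 0 < eps -> exists d, 0 < d /\
  forall r t, r <= d -> a <= t <= b -> norm (minus (forward r (u t)) (u t)) < eps.
Proof.
intros Hu He.
destruct (forward_bounded 1) as [M [HM HM']].
assert (Hloc : forall t, exists d : posreal, forall r s, r <= d -> Rabs (s - t) < d ->
  norm (minus (forward r (u s)) (u s)) < eps).
{ intros t.
  destruct (forward_at_0 (u t) (eps / 3)) as [d [Hd Hd']]; [lra|].
  assert (0 < eps / 3 / (M + 1)) as He' by (repeat apply Rdiv_lt_0_compat; lra).
  destruct (proj1 (continuous_C0P u t) (Hu t) _ He') as [d2 [Hd2 Hu']].
  assert (0 < Rmin 1 (Rmin d d2)) as Hm by (repeat apply Rmin_glb_lt; lra).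
  pose proof (Rmin_l 1 (Rmin d d2)); pose proof (Rmin_r 1 (Rmin d d2)).
  pose proof (Rmin_l d d2); pose proof (Rmin_r d d2).
  exists (mkposreal _ Hm); simpl; intros r s Hr Hs.
  specialize (Hu' s ltac:(lra)); specialize (Hd' r ltac:(lra)).
  specialize (HM' r (minus (u s) (u t)) ltac:(lra)).
  rewrite (linear_C0_minus _ _ _ (forward_linear r)) in HM'.
  pose proof (norm_minus_triangle (forward r (u s)) (forward r (u t)) (u s)).
  pose proof (norm_minus_triangle (forward r (u t)) (u t) (u s)) as H4.
  rewrite (norm_minus_sym (u t) (u s)) in H4.
  apply Rmult_lt_compat_l with (r := M + 1) in Hu'; [|lra].
  replace ((M + 1) * (eps / 3 / (M + 1))) with (eps / 3) in Hu' by (field; lra).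
  lra. }
apply choice in Hloc; destruct Hloc as [delta Hdelta].
destruct (compactness_value_1d a b delta) as [d Hd].
exists d; split; [apply cond_pos|]; intros r t Hr Ht.
apply NNPP; intros Hn; apply (Hd t Ht); intros [s [Hs [Hts Hds]]]; apply Hn.
apply (Hdelta s); lra.
Qed.

(** The standard regularization of semigroup theory: it maps into the domain of the generator,
    commutes with the semigroup, and tends to [f] as [h] tends to 0. *)
Definition average (h : R) (f : C0) : C0 := scal (/ h) (RInt (fun s => forward s f) 0 h).

Lemma average_minus h f g : average h (minus f g) = minus (average h f) (average h g).
Proof.
unfold average.
rewrite (RInt_ext (V := C0_CompleteNormedModule) _
  (fun s => minus (forward s f) (forward s g))).
- rewrite RInt_C0_minus by (intros; apply forward_continuous); C0_ring.
- intros s _; apply linear_C0_minus, forward_linear.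
Qed.

Lemma average_near h f g eps : 0 < h ->
  (forall s, 0 <= s <= h -> norm (minus (forward s f) g) <= eps) ->
  norm (minus (average h f) g) <= eps.
Proof.
intros Hh H; unfold average.
pose proof (RInt_C0_mean_near _ g 0 h eps Hh (forward_continuous f) H) as Hm.
rewrite Rminus_0_r in Hm; exact Hm.
Qed.

Lemma average_bounded h : 0 < h ->
  exists M, 0 < M /\ forall f, norm (average h f) <= M * norm f.
Proof.
intros Hh; destruct (forward_bounded h) as [M [HM H]]; exists M; split; [exact HM|].
intros f; replace (average h f) with (minus (average h f) zero) by C0_ring.
apply average_near; [exact Hh|]; intros s Hs.
replace (minus (forward s f) zero) with (forward s f) by C0_ring; apply H; lra.
Qed.

Lemma forward_average h k f : 0 < h -> 0 <= k -> forward k (average h f) = average h (forward k f).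
Proof.
intros Hh Hk; unfold average.
rewrite (linear_scal _ (forward_linear k)).
rewrite <- RInt_C0_linear; [|apply forward_linear | apply ex_RInt_C0, forward_continuous].
f_equal; apply (RInt_ext (V := C0_CompleteNormedModule)); intros s Hs.
rewrite Rmin_left in Hs by lra; apply forward_comm; lra.
Qed.

(** Both sides are, up to the factors [/ h] and [/ k], the integral of the orbit over [[h, h + k]]
    minus the one over [[0, k]], which is also the one over [[k, h + k]] minus the one over
    [[0, h]]. The right side has a limit as [k] tends to 0, which identifies the generator on
    averages. *)
Lemma average_increment h k f : 0 < h -> 0 < k ->
  scal (/ k) (minus (forward k (average h f)) (average h f)) =
  average k (scal (/ h) (minus (forward h f) f)).
Proof.
intros Hh Hk; unfold average.
assert (Hc : forall t, continuous (fun s => forward s f) t) by apply forward_continuous.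
assert (Hsh : forall a b, 0 <= a -> 0 <= b ->
  RInt (fun s => forward s (forward a f)) 0 b = RInt (fun s => forward s f) a (b + a)).
{ intros a b Ha Hb.
  transitivity (RInt (fun s => forward s f) (0 + a) (b + a)); [|now rewrite Rplus_0_l].
  rewrite <- (RInt_C0_shift (fun s => forward s f)) by exact Hc.
  apply (RInt_ext (V := C0_CompleteNormedModule)); intros s Hs.
  rewrite Rmin_left in Hs by lra; symmetry; apply forward_plus; lra. }
assert (E1 : forward k (RInt (fun s => forward s f) 0 h) = RInt (fun s => forward s f) k (h + k)).
{ rewrite <- RInt_C0_linear, <- Hsh;
    [| lra | lra | apply forward_linear | apply ex_RInt_C0, Hc].
  apply (RInt_ext (V := C0_CompleteNormedModule)); intros s Hs.
  rewrite Rmin_left in Hs by lra; apply forward_comm; lra. }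
assert (E2 : RInt (fun s => forward s (scal (/ h) (minus (forward h f) f))) 0 k =
  scal (/ h) (minus (RInt (fun s => forward s f) h (k + h)) (RInt (fun s => forward s f) 0 k))).
{ rewrite <- Hsh, <- RInt_C0_minus by (lra || (intros; apply forward_continuous)).
  rewrite <- (RInt_scal (V := C0_CompleteNormedModule)).
  - apply (RInt_ext (V := C0_CompleteNormedModule)); intros s _.
    rewrite (linear_scal _ (forward_linear s)), linear_C0_minus by apply forward_linear.
    reflexivity.
  - apply ex_RInt_C0; intros t.
    apply continuous_C0_minus; apply forward_continuous. }
rewrite (linear_scal _ (forward_linear k)), E1, E2.
assert (Ch : forall a b c, plus (RInt (fun s : R => forward s f) a b)
  (RInt (fun s : R => forward s f) b c) = RInt (fun s : R => forward s f) a c).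
{ intros a b c; apply (RInt_Chasles (V := C0_CompleteNormedModule)); apply ex_RInt_C0, Hc. }
rewrite (Rplus_comm k h).
pose proof (eq_trans (Ch 0 h (h + k)) (eq_sym (Ch 0 k (h + k)))) as C2.
clear E1 E2 Ch; revert C2.
generalize (RInt (fun s => forward s f) 0 k) as I1, (RInt (fun s => forward s f) k (h + k)) as I2,
  (RInt (fun s => forward s f) 0 h) as I3, (RInt (fun s => forward s f) h (h + k)) as I4.
intros I1 I2 I3 I4 C2.
assert (minus I2 I3 = minus I4 I1) as EI.
{ apply C0_ext; intros x.
  pose proof (f_equal (fun v : C0 => v x) C2) as Ex; simpl in Ex |- *; lra. }
transitivity (scal (/ k) (scal (/ h) (minus I2 I3))); [C0_ring | now rewrite EI].
Qed.

End Semigroup.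

(** * Mild solutions *)

Section Mild.

Context (T : R -> C0 -> C0) (HT : is_C0_semigroup (V := C0_NormedModule) T).

(** The forcing is an arbitrary curve, so that differences of solutions of the nonlinear equation
    are again mild. Continuity is asked on the whole line; the solutions obtained by Picard
    iteration are constant before [t0]. *)
Definition mild (g : R -> C0) (t0 : R) (u : R -> C0) : Prop :=
  (forall t, continuous u t) /\ (forall t, continuous g t) /\
  forall t, t0 <= t ->
    u t = plus (forward T (t - t0) (u t0)) (RInt (fun s => forward T (t - s) (g s)) t0 t).

Lemma mild_restart g t0 t1 u : mild g t0 u -> t0 <= t1 -> mild g t1 u.
Proof.
intros [Hu [Hg H]] H01; split; [exact Hu|]; split; [exact Hg|]; intros t Ht.
assert (Hc : forall t s, continuous (fun s => forward T (t - s) (g s)) s).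
{ intros; now apply duhamel_continuous. }
rewrite (H t), (H t1) by lra.
rewrite (linear_plus _ (forward_linear T HT (t - t1))), <- forward_plus by (exact HT || lra).
rewrite <- (RInt_C0_linear (forward T (t - t1)));
  [|apply (forward_linear T HT) | now apply ex_RInt_C0].
rewrite (RInt_ext (V := C0_CompleteNormedModule)
  (fun s => forward T (t - t1) (forward T (t1 - s) (g s))) (fun s => forward T (t - s) (g s))).
- rewrite <- (RInt_Chasles (V := C0_CompleteNormedModule) _ t0 t1 t) by (apply ex_RInt_C0, Hc).
  replace (t - t1 + (t1 - t0)) with (t - t0) by ring; C0_ring.
- intros s Hs; rewrite Rmin_left, Rmax_right in Hs by lra.
  rewrite <- forward_plus by (exact HT || lra); f_equal; ring.
Qed.

Lemma mild_shift g t0 u c :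
  mild g t0 u -> mild (fun s => g (s + c)) (t0 - c) (fun s => u (s + c)).
Proof.
intros [Hu [Hg H]].
assert (Hsh : forall (f : R -> C0), (forall t, continuous f t) -> forall t, continuous (fun s => f (s + c)) t).
{ intros f Hf t; apply (continuous_comp (fun s => s + c) f); [|apply Hf].
  apply (continuous_plus (fun s : R => s) (fun _ => c)); [apply continuous_id | apply continuous_const]. }
split; [now apply Hsh|]; split; [now apply Hsh|]; intros t Ht.
rewrite (H (t + c)) by lra.
replace (t0 - c + c) with t0 by ring.
replace (t + c - t0) with (t - (t0 - c)) by ring.
f_equal.
rewrite (RInt_ext (V := C0_CompleteNormedModule) (fun s => forward T (t - s) (g (s + c)))
  (fun s => (fun r => forward T (t + c - r) (g r)) (s + c))).
- rewrite (RInt_C0_shift (fun r => forward T (t + c - r) (g r))).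
  + f_equal; ring.
  + intros s; now apply duhamel_continuous.
- intros s _; f_equal; ring.
Qed.

Lemma mild_minus g t0 u g' u' : mild g t0 u -> mild g' t0 u' ->
  mild (fun s => minus (g s) (g' s)) t0 (fun s => minus (u s) (u' s)).
Proof.
intros [Hu [Hg H]] [Hu' [Hg' H']]; split; [|split].
- intros t; now apply continuous_C0_minus.
- intros t; now apply continuous_C0_minus.
- intros t Ht.
  rewrite (RInt_ext (V := C0_CompleteNormedModule) _
    (fun s => minus (forward T (t - s) (g s)) (forward T (t - s) (g' s)))).
  + rewrite RInt_C0_minus by (intros; now apply duhamel_continuous).
    rewrite (linear_C0_minus (forward T (t - t0))) by now apply forward_linear.
    rewrite (H t Ht), (H' t Ht); C0_ring.
  + intros s _; apply linear_C0_minus; now apply forward_linear.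
Qed.

Lemma mild_zero t0 : mild (fun _ => zero) t0 (fun _ => zero).
Proof.
split; [|split]; try (intros; apply continuous_const).
intros t Ht.
rewrite (RInt_ext (V := C0_CompleteNormedModule) _ (fun _ => zero)).
- rewrite (RInt_const (V := C0_CompleteNormedModule)).
  rewrite (linear_zero _ (forward_linear T HT _)); C0_ring.
- intros s _; apply (linear_zero _ (forward_linear T HT _)).
Qed.

Lemma mild_forward f : mild (fun _ => zero) 0 (fun t => forward T t f).
Proof.
split; [|split].
- intros; now apply forward_continuous.
- intros; apply continuous_const.
- intros t Ht.
  pose proof (proj2 (proj2 (mild_zero 0)) t Ht) as H0.
  rewrite (linear_zero _ (forward_linear T HT _)) in H0.
  rewrite forward_0, Rminus_0_r by exact HT.
  assert (RInt (fun s => forward T (t - s) zero) 0 t = zero) as ->.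
  { apply C0_ext; intros x.
    pose proof (f_equal (fun v : C0 => v x) H0) as Ex; simpl in Ex |- *; lra. }
  C0_ring.
Qed.

Lemma average_continuous_comp h (u : R -> C0) t : 0 < h ->
  continuous u t -> continuous (fun s => average T h (u s)) t.
Proof.
intros Hh Hu; apply continuous_C0P; intros eps He.
destruct (average_bounded T HT h Hh) as [M [HM H]].
destruct (proj1 (continuous_C0P u t) Hu (eps / M)) as [d [Hd Hd']].
{ apply Rdiv_lt_0_compat; lra. }
exists d; split; [exact Hd|]; intros s Hs; specialize (Hd' s Hs).
rewrite <- average_minus by exact HT.
eapply Rle_lt_trans; [apply H|].
apply Rmult_lt_compat_l with (r := M) in Hd'; [|exact HM].
replace (M * (eps / M)) with eps in Hd' by (field; lra); exact Hd'.
Qed.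

Lemma average_near_uniform (u : R -> C0) a b eps :
  (forall t, continuous u t) -> 0 < eps -> exists d, 0 < d /\
  forall h t, 0 < h <= d -> a <= t <= b -> norm (minus (average T h (u t)) (u t)) <= eps.
Proof.
intros Hu He.
destruct (forward_at_0_uniform T HT u a b eps Hu He) as [d [Hd H]].
exists d; split; [exact Hd|]; intros h t Hh Ht.
apply average_near; [exact HT | lra |]; intros s Hs; left; apply H; lra.
Qed.

(** Only backward quotients are treated, since the maximum in the comparison argument may lie at the
    final time. The limit is the generator applied to the average, in the form given by
    [average_increment], plus the averaged forcing. *)
Lemma average_left_derivative g t0 u h t eps :
  mild g t0 u -> 0 < h -> t0 < t -> 0 < eps -> exists d, 0 < d /\ forall k, 0 < k < d ->
  norm (minus (scal (/ k) (minus (average T h (u t)) (average T h (u (t - k)))))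
    (plus (scal (/ h) (minus (forward T h (u t)) (u t))) (average T h (g t)))) <= eps.
Proof.
intros [Hu [Hg Hm]] Hh Ht He.
pose (z := fun r => scal (/ h) (minus (forward T h (u r)) (u r))).
assert (Hz : forall r, continuous z r).
{ intros r; unfold z.
  apply (continuous_scal_r (V := C0_NormedModule)), continuous_C0_minus; [|apply Hu].
  apply forward_continuous_comp; [exact HT | apply continuous_const | apply Hu]. }
destruct (average_bounded T HT h Hh) as [M [HM HMb]].
pose (e2 := eps / 2 / M).
assert (0 < e2) as He2 by (unfold e2; repeat apply Rdiv_lt_0_compat; lra).
(* [z] will be evaluated at [t - k], which moves with [k]; continuity at time 0 has to be uniform
   along the curve. *)
destruct (forward_at_0_uniform T HT z (t - 1) t (eps / 4) Hz) as [d1 [Hd1 H1]]; [lra|].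
destruct (proj1 (continuous_C0P z t) (Hz t) (eps / 4)) as [d2 [Hd2 H2]]; [lra|].
destruct (proj1 (continuous_C0P _ t) (duhamel_continuous T HT g t t Hg) e2 He2) as [d3 [Hd3 H3]].
pose (d := Rmin (Rmin 1 (t - t0)) (Rmin d1 (Rmin d2 d3))).
assert (0 < d) as Hd by (unfold d; repeat apply Rmin_glb_lt; lra).
assert (d <= 1 /\ d <= t - t0 /\ d <= d1 /\ d <= d2 /\ d <= d3) as Hdle.
{ unfold d; pose proof (Rmin_l (Rmin 1 (t - t0)) (Rmin d1 (Rmin d2 d3))).
  pose proof (Rmin_r (Rmin 1 (t - t0)) (Rmin d1 (Rmin d2 d3))).
  pose proof (Rmin_l 1 (t - t0)); pose proof (Rmin_r 1 (t - t0)).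
  pose proof (Rmin_l d1 (Rmin d2 d3)); pose proof (Rmin_r d1 (Rmin d2 d3)).
  pose proof (Rmin_l d2 d3); pose proof (Rmin_r d2 d3); repeat split; lra. }
clearbody d.
exists d; split; [exact Hd|]; intros k Hk.
(* By Duhamel's formula on [[t - k, t]], [J] is what the forcing adds to the propagated [u (t - k)];
   its mean [J / k] is close to [g t]. *)
pose (J := RInt (fun s => forward T (t - s) (g s)) (t - k) t).
assert (EJ : u t = plus (forward T k (u (t - k))) J).
{ destruct (mild_restart g t0 (t - k) u) as [_ [_ H]]; [now split | lra |].
  rewrite (H t) by lra; replace (t - (t - k)) with k by ring; reflexivity. }
assert (E : scal (/ k) (minus (average T h (u t)) (average T h (u (t - k)))) =
  plus (average T k (z (t - k))) (scal (/ k) (average T h J))).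
{ unfold z; rewrite <- average_increment by (exact HT || lra).
  replace J with (minus (u t) (forward T k (u (t - k)))) by (rewrite EJ; C0_ring).
  rewrite average_minus, forward_average by (exact HT || lra); C0_ring. }
rewrite E.
assert (Hsum : forall a b c e : C0,
  norm (minus (plus a b) (plus c e)) <= norm (minus a c) + norm (minus b e)).
{ intros a b c e.
  replace (minus (plus a b) (plus c e)) with (plus (minus a c) (minus b e)) by C0_ring.
  apply (norm_triangle (V := C0_NormedModule)). }
change (scal (/ h) (minus (forward T h (u t)) (u t))) with (z t).
eapply Rle_trans; [apply Hsum|].
replace eps with (eps / 2 + eps / 2) by field; apply Rplus_le_compat.
- apply average_near; [exact HT | lra |]; intros s Hs.
  eapply Rle_trans; [apply (norm_minus_triangle _ (z (t - k)))|].
  specialize (H1 s (t - k) ltac:(lra) ltac:(lra)).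
  specialize (H2 (t - k) ltac:(rewrite Rabs_left; lra)); lra.
- assert (EJk : scal (/ k) (average T h J) = average T h (scal (/ k) J)).
  { unfold average.
    rewrite (RInt_ext (V := C0_CompleteNormedModule) (fun s => forward T s (scal (/ k) J))
      (fun s => scal (/ k) (forward T s J))).
    - rewrite (RInt_scal (V := C0_CompleteNormedModule)); [C0_ring|].
      apply ex_RInt_C0; intros; now apply forward_continuous.
    - intros s _; now apply (linear_scal _ (forward_linear T HT s)). }
  rewrite EJk, <- average_minus by exact HT.
  eapply Rle_trans; [apply HMb|].
  replace (eps / 2) with (M * e2) by (unfold e2; field; lra).
  apply Rmult_le_compat_l; [lra|].
  unfold J; replace (/ k) with (/ (t - (t - k))) by (f_equal; ring).
  apply RInt_C0_mean_near; [lra | intros; now apply duhamel_continuous|].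
  intros s Hs; specialize (H3 s ltac:(rewrite Rabs_left1; lra)); simpl in H3.
  replace (t - t) with 0 in H3 by ring; rewrite forward_0 in H3 by exact HT.
  left; exact H3.
Qed.

End Mild.

Lemma average_in_domain (A : C0 -> C0 -> Prop) T h f :
  generates (V := C0_NormedModule) A T -> 0 < h ->
  A (average T h f) (scal (/ h) (minus (forward T h f) f)).
Proof.
intros [HT HA] Hh; apply HA, at_right_C0P; intros eps He.
destruct (forward_at_0 T HT (scal (/ h) (minus (forward T h f) f)) (eps / 2)) as [d [Hd H]]; [lra|].
exists d; split; [exact Hd|]; intros k Hk.
rewrite <- (forward_eq T k) by lra.
rewrite average_increment by (exact HT || lra).
apply Rle_lt_trans with (eps / 2); [|lra].
apply average_near; [exact HT | lra |]; intros s Hs; left; apply H; lra.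
Qed.

(** * Comparison of mild solutions with classical barriers *)

Lemma continuous_RR_P (f : R * R -> R) p :
  continuous f p <->
  forall eps, 0 < eps -> exists d, 0 < d /\ forall s y,
    Rabs (s - fst p) < d -> Rabs (y - snd p) < d -> Rabs (f (s, y) - f p) < eps.
Proof.
split.
- intros H eps He.
  destruct (proj1 (filterlim_locally (F := locally p) f (f p)) H (mkposreal _ He)) as [d Hd].
  exists d; split; [apply cond_pos|]; intros s y Hs Hy; apply (Hd (s, y)); now split.
- intros H; apply (filterlim_locally (F := locally p) f (f p)); intros eps.
  destruct (H eps (cond_pos eps)) as [d [Hd H']].
  exists (mkposreal d Hd); intros [s y] [Hs Hy]; now apply H'.
Qed.

Lemma continuous_rectangle_bounded (f : R * R -> R) a b c d :
  (forall p, continuous f p) ->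
  exists M, forall t x, a <= t <= b -> c <= x <= d -> f (t, x) <= M.
Proof.
intros Hf.
(* With radii below [/ (1 + Rabs f)], the positive lower bound on the radii provided by compactness
   turns into an upper bound on [f]. *)
assert (Hloc : forall t x, exists e : posreal, e <= / (1 + Rabs (f (t, x))) /\
  forall s y, Rabs (s - t) < e -> Rabs (y - x) < e -> Rabs (f (s, y) - f (t, x)) < 1).
{ intros t x.
  destruct (proj1 (continuous_RR_P f (t, x)) (Hf (t, x)) 1 Rlt_0_1) as [e [He H]].
  assert (0 < Rmin e (/ (1 + Rabs (f (t, x))))) as Hm.
  { apply Rmin_glb_lt; [exact He|]; apply Rinv_0_lt_compat.
    pose proof (Rabs_pos (f (t, x))); lra. }
  exists (mkposreal _ Hm); simpl; split; [apply Rmin_r|].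
  intros s y Hs Hy; apply H; (eapply Rlt_le_trans; [eassumption | apply Rmin_l]). }
assert (Hch : exists delta : R -> R -> posreal, forall t x,
  delta t x <= / (1 + Rabs (f (t, x))) /\
  forall s y, Rabs (s - t) < delta t x -> Rabs (y - x) < delta t x ->
    Rabs (f (s, y) - f (t, x)) < 1).
{ assert (H1 : forall t, exists dt : R -> posreal, forall x,
    dt x <= / (1 + Rabs (f (t, x))) /\ forall s y, Rabs (s - t) < dt x ->
      Rabs (y - x) < dt x -> Rabs (f (s, y) - f (t, x)) < 1).
  { intros t; apply (choice (fun x (e : posreal) => e <= / (1 + Rabs (f (t, x))) /\
      forall s y, Rabs (s - t) < e -> Rabs (y - x) < e -> Rabs (f (s, y) - f (t, x)) < 1)), Hloc. }
  now apply choice in H1. }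
destruct Hch as [delta Hdelta].
destruct (compactness_value_2d a b c d delta) as [e He].
exists (/ e + 1); intros t x Ht Hx; apply NNPP; intros Hn.
apply (He t x Ht Hx); intros [s [y [Hs [Hy [Hts [Hxy Hle]]]]]]; apply Hn.
destruct (Hdelta s y) as [H1 H2]; specialize (H2 t x Hts Hxy).
pose proof (cond_pos e) as Hpos; pose proof (Rabs_pos (f (s, y))).
assert (1 + Rabs (f (s, y)) <= / e).
{ rewrite <- (Rinv_inv (1 + Rabs (f (s, y)))); apply Rinv_le_contravar; lra. }
pose proof (Rle_abs (f (s, y))); apply Rabs_def2 in H2; lra.
Qed.

Lemma continuous_rectangle_max (f : R * R -> R) a b c d :
  a <= b -> c <= d -> (forall p, continuous f p) ->
  exists t x, a <= t <= b /\ c <= x <= d /\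
    forall s y, a <= s <= b -> c <= y <= d -> f (s, y) <= f (t, x).
Proof.
intros Hab Hcd Hf.
pose (E := fun z => exists t x, a <= t <= b /\ c <= x <= d /\ z = f (t, x)).
destruct (completeness E) as [M [HM1 HM2]].
- destruct (continuous_rectangle_bounded f a b c d Hf) as [M HM].
  exists M; intros z [t [x [Ht [Hx ->]]]]; now apply HM.
- exists (f (a, c)), a, c; repeat split; lra.
- apply NNPP; intros Hn.
  assert (Hlt : forall t x, a <= t <= b -> c <= x <= d -> f (t, x) < M).
  { intros t x Ht Hx; assert (f (t, x) <= M) as Hle by (apply HM1; now exists t, x).
    destruct Hle as [Hle|Hle]; [exact Hle|]; exfalso; apply Hn; exists t, x.
    split; [exact Ht|]; split; [exact Hx|]; intros s y Hs Hy; rewrite Hle.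
    apply HM1; now exists s, y. }
  (* If [M] is not attained, [1 / (M - f)] would be bounded on the rectangle; the
     clamp makes it continuous everywhere. *)
  pose (clamp := fun l r z : R => Rmin r (Rmax l z)).
  assert (Hcl : forall l r z, l <= r -> l <= clamp l r z <= r).
  { intros l r z Hlr; unfold clamp, Rmin, Rmax; repeat destruct Rle_dec; lra. }
  assert (Hid : forall l r z, l <= z <= r -> clamp l r z = z).
  { intros l r z Hz; unfold clamp, Rmin, Rmax; repeat destruct Rle_dec; lra. }
  assert (Hlip : forall l r z z', Rabs (clamp l r z - clamp l r z') <= Rabs (z - z')).
  { intros l r z z'; unfold clamp, Rmin, Rmax; repeat destruct Rle_dec;
      unfold Rabs; repeat destruct Rcase_abs; lra. }
  pose (g := fun p => / (M - f (clamp a b (fst p), clamp c d (snd p)))).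
  destruct (continuous_rectangle_bounded g a b c d) as [B HB].
  { intros [t x]; unfold g.
    pose proof (Hlt _ _ (Hcl a b t Hab) (Hcl c d x Hcd)) as Hpos.
    apply (continuous_comp (fun p => M - f (clamp a b (fst p), clamp c d (snd p))) Rinv).
    - apply continuous_RR_P; intros eps He; simpl.
      destruct (proj1 (continuous_RR_P f _) (Hf (clamp a b t, clamp c d x)) eps He) as [e [He' H]].
      exists e; split; [exact He'|]; intros s y Hs Hy.
      rewrite Rabs_minus_sym.
      replace (M - f (clamp a b t, clamp c d x) - (M - f (clamp a b s, clamp c d y)))
        with (f (clamp a b s, clamp c d y) - f (clamp a b t, clamp c d x)) by ring.
      apply H; simpl; (eapply Rle_lt_trans; [apply Hlip | assumption]).
    - apply continuous_Rinv; simpl; lra. }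
  assert (0 < B) as HBpos.
  { eapply Rlt_le_trans; [|apply (HB a c); lra]; unfold g; simpl.
    rewrite !Hid by lra; apply Rinv_0_lt_compat; specialize (Hlt a c); lra. }
  assert (M <= M - / B); [|pose proof (Rinv_0_lt_compat B HBpos); lra].
  apply HM2; intros z [t [x [Ht [Hx ->]]]].
  specialize (HB t x Ht Hx); unfold g in HB; simpl in HB; rewrite !Hid in HB by lra.
  specialize (Hlt t x Ht Hx).
  assert (/ B <= M - f (t, x)); [|lra].
  rewrite <- (Rinv_inv (M - f (t, x))); apply Rinv_le_contravar; [|exact HB].
  apply Rinv_0_lt_compat; lra.
Qed.

(** If [l > 0], then [f'], which vanishes at the maximum, is positive just to the right of [x], and
    the mean value theorem makes [f] exceed its maximum there. *)
Lemma second_derivative_at_max (f f' : R -> R) x l d :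
  0 < d -> (forall y, Rabs (y - x) < d -> is_derive f y (f' y)) -> is_derive f' x l ->
  (forall y, Rabs (y - x) < d -> f y <= f x) -> l <= 0.
Proof.
intros Hd Hf Hl Hmax; apply Rnot_lt_le; intros Hpos.
assert (H0 : f' x = 0).
{ assert (Hdx : derivable_pt_lim f x (f' x)).
  { apply is_derive_Reals, Hf; rewrite Rminus_diag, Rabs_R0; lra. }
  pose (pr := exist (derivable_pt_abs f x) (f' x) Hdx : derivable_pt f x).
  pose proof (deriv_maximum f (x - d) (x + d) x pr) as H.
  rewrite (derive_pt_eq_0 _ _ _ pr Hdx) in H.
  apply H; [lra | lra |]; intros y H1 H2; apply Hmax, Rabs_def1; lra. }
apply is_derive_Reals in Hl.
destruct (Hl (l / 2)) as [e He]; [lra|].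
pose (r := Rmin d e / 2).
assert (0 < r /\ r < d /\ r < e) as [Hr [Hrd Hre]].
{ unfold r; pose proof (cond_pos e); pose proof (Rmin_l d e); pose proof (Rmin_r d e).
  assert (0 < Rmin d e) by (apply Rmin_glb_lt; lra); lra. }
destruct (MVT_cor2 f f' x (x + r)) as [c [Hc1 Hc2]]; [lra | |].
{ intros c Hc; apply is_derive_Reals, Hf, Rabs_def1; lra. }
specialize (He (c - x)); rewrite H0 in He.
replace (x + (c - x)) with c in He by ring.
specialize (He ltac:(lra) ltac:(apply Rabs_def1; lra)).
rewrite Rminus_0_r in He; apply Rabs_def2 in He.
assert (0 < f' c / (c - x)) as Hq by lra.
assert (0 < f' c).
{ replace (f' c) with (f' c / (c - x) * (c - x)) by (field; lra); apply Rmult_lt_0_compat; lra. }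
specialize (Hmax (x + r) ltac:(apply Rabs_def1; lra)).
assert (0 < f' c * (x + r - x)) by (apply Rmult_lt_0_compat; lra); lra.
Qed.

Lemma curve_eval_continuous (v : R -> C0) p :
  (forall t, continuous v t) -> continuous (fun p : R * R => v (fst p) (snd p)) p.
Proof.
intros Hv; destruct p as [t x]; apply continuous_RR_P; intros eps He; simpl.
destruct (proj1 (continuous_C0P v t) (Hv t) (eps / 2)) as [d1 [Hd1 H1]]; [lra|].
destruct (proj1 (filterlim_locally (F := locally x) (v t) (v t x)) (C0_cont (v t) x)
  (pos_div_2 (mkposreal _ He))) as [d2 Hd2].
exists (Rmin d1 d2); split; [apply Rmin_glb_lt; [lra | apply cond_pos]|].
intros s y Hs Hy.
specialize (H1 s ltac:(eapply Rlt_le_trans; [exact Hs | apply Rmin_l])).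
assert (Rabs (v t y - v t x) < eps / 2) as H2.
{ apply (Hd2 y); eapply Rlt_le_trans; [exact Hy | apply Rmin_r]. }
pose proof (C0_eval_le (v s) (v t) y) as H3.
replace (v s y - v t x) with ((v s y - v t y) + (v t y - v t x)) by ring.
eapply Rle_lt_trans; [apply Rabs_triang | lra].
Qed.

Lemma exp_le_compat x y : x <= y -> exp x <= exp y.
Proof. intros [H | ->]; [left; now apply exp_increasing | apply Rle_refl]. Qed.

Lemma one_minus_exp_ge z : 0 <= z -> z / (1 + z) <= 1 - exp (- z).
Proof.
intros Hz.
assert (exp (- z) <= / (1 + z)).
{ rewrite exp_Ropp; apply Rinv_le_contravar; [lra|]; destruct (Req_dec z 0) as [->|Hn].
  - rewrite exp_0; lra.
  - left; now apply exp_ineq1. }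
replace (z / (1 + z)) with (1 - / (1 + z)) by (field; lra); lra.
Qed.

(* A mild solution need not be differentiable, but its averages [average T h u]
   take values in the domain of [L] and satisfy the equation pointwise with the
   averaged forcing.  The parabolic maximum principle is applied to them, at a
   maximum of [exp (- K (t - t0)) * (average T h u - Psi)], for small [h]. *)
Lemma mild_comparison (lam : R) T (g : R -> C0) t0 (u : R -> C0)
    (Psi Psit Psix Psixx : R -> R -> R) (C : R) :
  generates (V := C0_NormedModule) (L_graph lam) T -> 0 <= lam -> 0 <= C ->
  mild T g t0 u ->
  (forall p : R * R, continuous (fun p => Psi (fst p) (snd p)) p) ->
  (forall t x, t0 < t -> 0 < x < PI ->
     is_derive (fun s => Psi s x) t (Psit t x) /\
     is_derive (Psi t) x (Psix t x) /\ is_derive (Psix t) x (Psixx t x)) ->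
  (forall t, t0 <= t -> 0 <= Psi t 0 /\ 0 <= Psi t PI) ->
  (forall x, 0 <= x <= PI -> u t0 x <= Psi t0 x) ->
  (forall t x, t0 < t -> 0 < x < PI ->
     g t x <= Psit t x - Psixx t x - lam * Psi t x + C * Rabs (u t x - Psi t x)) ->
  forall t x, t0 <= t -> 0 <= x <= PI -> u t x <= Psi t x.
Proof.
intros Hgen Hlam HC Hmild HPc HPd HPb Hinit Hsup t1 x1 Ht1 Hx1.
destruct Hgen as [HT HA] eqn:EG; clear EG.
apply Rnot_lt_le; intros Hlt.
set (d0 := u t1 x1 - Psi t1 x1).
assert (0 < d0) as Hd0 by (unfold d0; lra).
(* At the maximum the estimates will give [(K - 1) * D <= lam * D + C * (D + eta) + 3 * eta]. For
   this [K] it means [D <= (C + 3) * eta = eps / 2], against [D >= eps]. *)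
pose (K := lam + C + 2).
assert (2 <= K) as HK by (unfold K; lra).
(* A lower bound for the maximum of the damped difference: regularization changes the value [d0] at
   [(t1, x1)] by at most [eta], which is less than [d0 / 2]. *)
pose (eps := exp (- (K * (t1 - t0))) * (d0 / 2)).
assert (Hexp : 0 < exp (- (K * (t1 - t0))) <= 1).
{ split; [apply exp_pos|]; rewrite <- exp_0; apply exp_le_compat.
  assert (0 <= K * (t1 - t0)) by (apply Rmult_le_pos; lra); lra. }
assert (Heps : 0 < eps <= d0 / 2).
{ unfold eps; split; [apply Rmult_lt_0_compat; lra|].
  rewrite <- (Rmult_1_l (d0 / 2)) at 2; apply Rmult_le_compat_r; lra. }
pose (eta := eps / 2 / (C + 3)).
assert (0 < eta) as Heta by (unfold eta; repeat apply Rdiv_lt_0_compat; lra).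
assert ((C + 3) * eta = eps / 2) as Eeta by (unfold eta; field; lra).
assert (eta <= eps / 2) by nra.
destruct Hmild as [Hu [Hg Hm]].
destruct (average_near_uniform T HT u t0 t1 eta Hu Heta) as [h1 [Hh1 Hnu]].
destruct (average_near_uniform T HT g t0 t1 eta Hg Heta) as [h2 [Hh2 Hng]].
pose (h := Rmin h1 h2).
assert (0 < h) as Hh by (unfold h; apply Rmin_glb_lt; lra).
assert (forall t, t0 <= t <= t1 -> norm (minus (average T h (u t)) (u t)) <= eta) as Hnu'.
{ intros t Ht; apply Hnu; [split; [exact Hh | apply Rmin_l] | exact Ht]. }
assert (forall t, t0 <= t <= t1 -> norm (minus (average T h (g t)) (g t)) <= eta) as Hng'.
{ intros t Ht; apply Hng; [split; [exact Hh | apply Rmin_r] | exact Ht]. }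
clear Hnu Hng.
pose (v := fun t => average T h (u t)).
assert (Hv : forall t, continuous v t).
{ intros t; exact (average_continuous_comp T HT h u t Hh (Hu t)). }
assert (Huv : forall t x, t0 <= t <= t1 -> Rabs (v t x - u t x) <= eta).
{ intros t x Ht; eapply Rle_trans; [apply C0_eval_le | now apply Hnu']. }
pose (E := fun p : R * R => exp (- (K * (fst p - t0))) * (v (fst p) (snd p) - Psi (fst p) (snd p))).
assert (HE : forall p, continuous E p).
{ intros p; unfold E.
  apply (continuous_mult (fun p : R * R => exp (- (K * (fst p - t0))))
    (fun p : R * R => v (fst p) (snd p) - Psi (fst p) (snd p))).
  - apply (continuous_comp (fun p : R * R => fst p) (fun t => exp (- (K * (t - t0))))).
    + apply continuous_fst.
    + apply (ex_derive_continuous (fun t => exp (- (K * (t - t0))))); auto_derive; exact I.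
  - apply (continuous_minus (fun p : R * R => v (fst p) (snd p)) (fun p => Psi (fst p) (snd p))).
    + apply curve_eval_continuous; exact Hv.
    + apply HPc. }
assert (EE : forall t x, E (t, x) = exp (- (K * (t - t0))) * (v t x - Psi t x)) by reflexivity.
clearbody E.
pose proof PI_RGT_0 as HPI.
destruct (continuous_rectangle_max E t0 t1 0 PI) as [t [x [Ht [Hx Hmax]]]]; [lra | lra | exact HE |].
assert (HEmax : eps <= E (t, x)).
{ eapply Rle_trans; [|apply (Hmax t1 x1); lra].
  rewrite EE; unfold eps; apply Rmult_le_compat_l; [lra|].
  specialize (Huv t1 x1 ltac:(lra)); apply Rabs_le_between in Huv; unfold d0 in *; clearbody eta; clear - Huv Heps Hlt H.
  unfold Rdiv in *; lra. }
pose (D := v t x - Psi t x).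
assert (Hexpt : 0 < exp (- (K * (t - t0))) <= 1).
{ split; [apply exp_pos|]; rewrite <- exp_0; apply exp_le_compat.
  assert (0 <= K * (t - t0)) by (apply Rmult_le_pos; lra); lra. }
assert (HD : eps <= D).
{ rewrite EE in HEmax; fold D in HEmax.
  destruct (Rle_lt_dec D 0) as [Hneg|Hpos]; [|nra].
  assert (exp (- (K * (t - t0))) * D <= 0) by nra; lra. }
pose proof (Huv t x Ht) as Huvt; apply Rabs_le_between in Huvt.
assert (Hx' : 0 < x < PI).
{ destruct (HPb t ltac:(lra)) as [HP0 HP1].
  split; apply Rnot_le_lt; intros Hn; unfold D in HD;
    rewrite (C0_supp (v t)) in HD by lra.
  - replace x with 0 in HD by lra; lra.
  - replace x with PI in HD by lra; lra. }
assert (Ht' : t0 < t).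
{ destruct (proj1 Ht) as [Hlt'|Heq]; [exact Hlt'|]; exfalso.
  specialize (Hinit x Hx); rewrite Heq in Hinit; unfold D in HD; lra. }
destruct (HPd t x Ht' Hx') as [HPt [_ HPxx]].
pose proof (average_in_domain (L_graph lam) T h (u t) (conj HT HA) Hh x Hx') as [_ [Hvxx HL]].
fold (v t) in Hvxx, HL.
pose (vxx := Derive_n (v t) 2 x).
assert (Hxx : vxx <= Psixx t x).
{ pose (r := Rmin x (PI - x)).
  assert (0 < r) by (unfold r; apply Rmin_glb_lt; lra).
  assert (r <= x /\ r <= PI - x) by (split; [apply Rmin_l | apply Rmin_r]).
  enough (vxx - Psixx t x <= 0) by lra.
  apply (second_derivative_at_max (fun y => v t y - Psi t y)
    (fun y => Derive (v t) y - Psix t y) x (vxx - Psixx t x) r).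
  - assumption.
  - intros y Hy; apply Rabs_def2 in Hy; assert (0 < y < PI) as Hy' by lra.
    apply (is_derive_minus (v t) (Psi t)).
    + apply Derive_correct.
      apply (average_in_domain (L_graph lam) T h (u t) (conj HT HA) Hh y Hy').
    + apply (HPd t y Ht' Hy').
  - apply (is_derive_minus (Derive (v t)) (Psix t)); [|exact HPxx].
    apply (Derive_correct (Derive (v t)) x Hvxx).
  - intros y Hy; apply Rabs_def2 in Hy.
    specialize (Hmax t y Ht ltac:(lra)); rewrite !EE in Hmax.
    apply Rmult_le_reg_l in Hmax; [exact Hmax | lra]. }
pose (G := scal (/ h) (minus (forward T h (u t)) (u t)) : C0).
assert (HGx : G x = vxx + lam * v t x) by exact HL.
destruct (average_left_derivative T HT g t0 u h t eta) as [k1 [Hk1 Hleft]];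
  [exact (conj Hu (conj Hg Hm)) | exact Hh | exact Ht' | exact Heta |].
apply is_derive_Reals in HPt; destruct (HPt eta Heta) as [k2 HPt'].
(* The condition [k * (K * K) <= 1] yields [(K - 1) * k <= K * k / (1 + K * k) <= 1 - exp (- (K *
   k))]: a finite-difference substitute for differentiating the damping factor. *)
assert (exists k, 0 < k /\ k < k1 /\ k < k2 /\ k < t - t0 /\ k * (K * K) <= 1) as
  [k [Hk [Hkk1 [Hkk2 [Hkt HkK]]]]].
{ assert (0 < K * K) by nra.
  pose proof (Rmin_l (Rmin k1 k2) (Rmin (t - t0) (/ (K * K)))) as R1.
  pose proof (Rmin_r (Rmin k1 k2) (Rmin (t - t0) (/ (K * K)))) as R2.
  pose proof (Rmin_l k1 k2); pose proof (Rmin_r k1 k2).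
  pose proof (Rmin_l (t - t0) (/ (K * K))); pose proof (Rmin_r (t - t0) (/ (K * K))).
  assert (0 < Rmin (Rmin k1 k2) (Rmin (t - t0) (/ (K * K)))) as R0.
  { repeat apply Rmin_glb_lt; [lra | apply cond_pos | lra | now apply Rinv_0_lt_compat]. }
  set (k := Rmin (Rmin k1 k2) (Rmin (t - t0) (/ (K * K)))) in R0, R1, R2; clearbody k.
  exists (k / 2); repeat split; try lra.
  assert (k * (K * K) <= / (K * K) * (K * K)) as Hm' by (apply Rmult_le_compat_r; lra).
  rewrite Rinv_l in Hm' by lra; lra. }
assert (Hdv : (v t x - v (t - k) x) / k <= G x + average T h (g t) x + eta).
{ specialize (Hleft k ltac:(lra)).
  pose proof (Rle_trans _ _ _ (C0_norm_ge _ x) Hleft) as Hev.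
  simpl in Hev; unfold G; simpl.
  apply Rabs_le_between in Hev; unfold v, Rdiv; simpl in Hev |- *.
  rewrite (Rmult_comm _ (/ k)); lra. }
assert (HdP : Psit t x - eta <= (Psi t x - Psi (t - k) x) / k).
{ specialize (HPt' (- k) ltac:(lra) ltac:(rewrite Rabs_Ropp, Rabs_pos_eq; lra)).
  apply Rabs_def2 in HPt'.
  replace ((Psi (t + - k) x - Psi t x) / - k) with ((Psi t x - Psi (t - k) x) / k) in HPt'.
  - lra.
  - unfold Rminus; field; lra. }
assert (HdD : (K - 1) * D <= (v t x - v (t - k) x) / k - (Psi t x - Psi (t - k) x) / k).
{ pose (D' := v (t - k) x - Psi (t - k) x).
  assert (D' <= exp (- (K * k)) * D) as HD'.
  { specialize (Hmax (t - k) x ltac:(lra) Hx); rewrite !EE in Hmax.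
    fold D D' in Hmax.
    replace (- (K * (t - t0))) with (- (K * (t - k - t0)) + - (K * k)) in Hmax by ring.
    rewrite exp_plus, Rmult_assoc in Hmax.
    apply Rmult_le_reg_l in Hmax; [exact Hmax | apply exp_pos]. }
  assert (0 <= K * k) by nra.
  pose proof (one_minus_exp_ge (K * k) ltac:(assumption)) as Hone.
  assert ((K - 1) * k <= K * k / (1 + K * k)) as Hfrac.
  { apply Rmult_le_reg_r with (1 + K * k); [lra|].
    replace (K * k / (1 + K * k) * (1 + K * k)) with (K * k) by (field; lra).
    assert (k * (K * K) * k <= 1 * k) by (apply Rmult_le_compat_r; lra).
    assert (0 <= K * k * k) by nra; nra. }
  assert ((K - 1) * k * D <= D - D') as Hfin.
  { assert ((K - 1) * k * D <= (1 - exp (- (K * k))) * D) by (apply Rmult_le_compat_r; lra).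
    lra. }
  replace ((v t x - v (t - k) x) / k - (Psi t x - Psi (t - k) x) / k) with ((D - D') / k)
    by (unfold D, D'; field; lra).
  apply Rmult_le_reg_r with k; [exact Hk|].
  replace ((D - D') / k * k) with (D - D') by (field; lra); lra. }
pose proof (Hsup t x Ht' Hx') as Hs.
assert (average T h (g t) x <= g t x + eta) as Hgx.
{ pose proof (Rle_trans _ _ _ (C0_eval_le (average T h (g t)) (g t) x) (Hng' t Ht)) as Hev.
  apply Rabs_le_between in Hev; lra. }
assert (Rabs (u t x - Psi t x) <= D + eta) as Habs.
{ unfold D in *; apply Rabs_le_between; lra. }
assert (C * Rabs (u t x - Psi t x) <= C * (D + eta)) as HCabs by (apply Rmult_le_compat_l; lra).
assert (lam * v t x = lam * Psi t x + lam * D) as Elam by (unfold D; ring).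
assert ((K - 1) * D <= lam * D + C * (D + eta) + 3 * eta) as Hfinal by lra.
unfold K in Hfinal; nra.
Qed.

(** * Existence for globally Lipschitz nonlinearities *)

Lemma le_0_of_geometric q x c : 0 <= q < 1 -> (forall n, x <= c * q ^ n) -> x <= 0.
Proof.
intros Hq H; apply Rnot_lt_le; intros Hx.
assert (0 < c) by (specialize (H O); simpl in H; lra).
destruct (pow_lt_1_zero q) with (y := x / c) as [N HN].
- rewrite Rabs_pos_eq; lra.
- now apply Rdiv_lt_0_compat.
- specialize (HN N (le_n N)); specialize (H N).
  rewrite Rabs_pos_eq in HN by (apply pow_le; lra).
  apply Rmult_lt_compat_l with (r := c) in HN; [|lra].
  replace (c * (x / c)) with x in HN by (field; lra); lra.
Qed.

Lemma norm_RInt_C0_le_Rabs (f : R -> C0) c a b :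
  (forall t, continuous f t) -> (forall s, Rmin a b <= s <= Rmax a b -> norm (f s) <= c) ->
  norm (RInt f a b) <= Rabs (b - a) * c.
Proof.
intros Hf Hc; destruct (Rle_lt_dec a b) as [H|H].
- rewrite Rmin_left, Rmax_right in Hc by lra; rewrite Rabs_pos_eq by lra.
  now apply norm_RInt_C0_le_const.
- rewrite Rmin_right, Rmax_left in Hc by lra; rewrite Rabs_left by lra.
  rewrite <- (opp_RInt_swap (V := C0_CompleteNormedModule)) by now apply ex_RInt_C0.
  rewrite (norm_opp (V := C0_NormedModule)).
  replace (- (b - a)) with (a - b) by ring; apply norm_RInt_C0_le_const; [lra | exact Hf | exact Hc].
Qed.

Section Evolution.

Context (lam : R) (Hlam : 0 <= lam) (T : R -> C0 -> C0)
  (Hgen : generates (V := C0_NormedModule) (L_graph lam) T).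

Let HT : is_C0_semigroup (V := C0_NormedModule) T := proj1 Hgen.

(** [exp (lam * t) * norm f], constant in [x], is a supersolution for the data [f] and [- f]. The
    growth rate [lam] fixes the weight of the Picard iteration. *)
Lemma forward_norm_le t f : 0 <= t -> norm (forward T t f) <= exp (lam * t) * norm f.
Proof.
intros Ht.
assert (Hup : forall (f : C0) x, 0 <= x <= PI -> forward T t f x <= exp (lam * t) * norm f).
{ clear f; intros f x Hx.
  pose proof (norm_ge_0 (V := C0_NormedModule) f) as Hf.
  apply (mild_comparison lam T (fun _ => zero) 0 (fun t => forward T t f)
    (fun t _ => exp (lam * t) * norm f) (fun t _ => lam * exp (lam * t) * norm f)
    (fun _ _ => 0) (fun _ _ => 0) 0 Hgen Hlam (Rle_refl 0)); try assumption.
  - now apply mild_forward.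
  - intros p; apply (continuous_mult (fun p : R * R => exp (lam * fst p)) (fun _ => norm f));
      [|apply continuous_const].
    apply (continuous_comp (fun p : R * R => fst p) (fun t => exp (lam * t))).
    + apply continuous_fst.
    + apply (ex_derive_continuous (fun t => exp (lam * t))); auto_derive; exact I.
  - intros s y _ _; split; [|split]; [auto_derive; [exact I | ring] | |];
      apply (is_derive_const (K := R_AbsRing) (V := R_NormedModule)).
  - intros s _; split; apply Rmult_le_pos; try apply Hf; left; apply exp_pos.
  - intros y _; rewrite forward_0, Rmult_0_r, exp_0, Rmult_1_l by exact HT.
    eapply Rle_trans; [apply Rle_abs | apply (C0_norm_ge f y)].
  - intros s y _ _; simpl; lra. }
apply C0_norm_le; intros x.
destruct (classic (0 <= x <= PI)) as [Hx|Hx].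
- apply Rabs_le_between; split; [|now apply Hup].
  pose proof (Hup (scal (-1) f) x Hx) as H; rewrite norm_C0_scal in H.
  rewrite (linear_scal _ (forward_linear T HT t)) in H; simpl in H.
  replace (Rabs (-1)) with 1 in H by (rewrite Rabs_left; lra); rewrite Rmult_1_l in H.
  change (norm f) with (C0_norm f) in H |- *; lra.
- rewrite C0_supp, Rabs_R0 by lra; apply Rmult_le_pos; [left; apply exp_pos|].
  apply (norm_ge_0 (V := C0_NormedModule)).
Qed.

Lemma duhamel_integral_continuous (g : R -> C0) t0 t :
  (forall s, continuous g s) ->
  continuous (fun t => RInt (fun s => forward T (t - s) (g s)) t0 t) t.
Proof.
intros Hg; apply continuous_C0P; intros eps He.
destruct (forward_diff_le T HT (t + 1 - Rmin t0 t)) as [M [HM Hdiff]].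
destruct (forward_bounded T HT 1) as [M1 [HM1 Hbd]].
pose (L := Rabs (t - t0) + 1).
assert (1 <= L) as HL by (unfold L; pose proof (Rabs_pos (t - t0)); lra).
pose (e1 := eps / 4 / (M * L)).
assert (0 < M * L) by nra.
assert (0 < e1) as He1 by (unfold e1; repeat apply Rdiv_lt_0_compat; lra).
destruct (forward_at_0_uniform T HT g (Rmin t0 t) (Rmax t0 t) e1 Hg He1) as [d1 [Hd1 H1]].
destruct (proj1 (continuous_C0P g t) (Hg t) 1 Rlt_0_1) as [d2 [Hd2 H2]].
pose (B := M1 * (norm (g t) + 1)).
assert (0 < B) as HB.
{ unfold B; pose proof (norm_ge_0 (V := C0_NormedModule) (g t)); apply Rmult_lt_0_compat; lra. }
pose (d := Rmin (Rmin d1 d2) (Rmin 1 (eps / 4 / B))).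
assert (0 < d /\ d <= d1 /\ d <= d2 /\ d <= 1 /\ d <= eps / 4 / B) as [Hd [Hdd1 [Hdd2 [Hd1' HdB]]]].
{ unfold d; pose proof (Rmin_l (Rmin d1 d2) (Rmin 1 (eps / 4 / B))).
  pose proof (Rmin_r (Rmin d1 d2) (Rmin 1 (eps / 4 / B))).
  pose proof (Rmin_l d1 d2); pose proof (Rmin_r d1 d2).
  pose proof (Rmin_l 1 (eps / 4 / B)); pose proof (Rmin_r 1 (eps / 4 / B)).
  repeat split; try lra; repeat apply Rmin_glb_lt; try lra; repeat apply Rdiv_lt_0_compat; lra. }
clearbody d.
exists d; split; [exact Hd|]; intros t' Ht'.
assert (Hc : forall r s, continuous (fun s => forward T (r - s) (g s)) s).
{ intros r s; now apply duhamel_continuous. }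
(* [I1] is the effect of the changed propagation time on the old interval, [I2] the contribution of
   the short interval between [t] and [t']. *)
pose (I1 := RInt (fun s => minus (forward T (t' - s) (g s)) (forward T (t - s) (g s))) t0 t).
pose (I2 := RInt (fun s => forward T (t' - s) (g s)) t t').
assert (EI : minus (RInt (fun s => forward T (t' - s) (g s)) t0 t')
  (RInt (fun s => forward T (t - s) (g s)) t0 t) = plus I1 I2).
{ unfold I1, I2; rewrite RInt_C0_minus by apply Hc.
  rewrite <- (RInt_Chasles (V := C0_CompleteNormedModule) (fun s => forward T (t' - s) (g s)) t0 t t')
    by (apply ex_RInt_C0, Hc).
  C0_ring. }
change (norm (minus (RInt (fun s => forward T (t' - s) (g s)) t0 t')
  (RInt (fun s => forward T (t - s) (g s)) t0 t) : C0) < eps).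
rewrite EI.
eapply Rle_lt_trans; [apply (norm_triangle (V := C0_NormedModule))|].
assert (norm I1 <= eps / 4) as HI1.
{ apply Rle_trans with (Rabs (t - t0) * (M * e1)).
  - apply norm_RInt_C0_le_Rabs.
    + intros s; apply continuous_C0_minus; apply Hc.
    + intros s Hs; apply Rabs_def2 in Ht'.
      destruct (Hdiff (t' - s) (t - s) (g s)) as [r [Hr Hr']]; [lra | lra |].
      eapply Rle_trans; [exact Hr'|]; apply Rmult_le_compat_l; [lra|]; left; apply H1; [|exact Hs].
      replace (t' - s - (t - s)) with (t' - t) in Hr by ring.
      assert (Rabs (t' - t) < d) by (apply Rabs_def1; lra); lra.
  - replace (eps / 4) with (L * (M * e1)) by (unfold e1; field; lra).
    apply Rmult_le_compat_r; [apply Rmult_le_pos; lra | unfold L; lra]. }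
assert (norm I2 <= eps / 4) as HI2.
{ apply Rle_trans with (Rabs (t' - t) * B).
  - apply norm_RInt_C0_le_Rabs; [apply Hc|]; intros s Hs.
    assert (Rabs (s - t) < d) as Hst.
    { apply Rabs_def2 in Ht'; apply Rabs_def1; unfold Rmin, Rmax in Hs; destruct Rle_dec; lra. }
    apply Rle_trans with (M1 * norm (g s)).
    + apply Hbd; apply Rabs_def2 in Ht'; unfold Rmin, Rmax in Hs; destruct Rle_dec; lra.
    + apply Rmult_le_compat_l; [lra|].
      eapply Rle_trans; [apply (norm_le_minus _ (g t))|]; apply Rplus_le_compat_l; left.
      apply H2; lra.
  - replace (eps / 4) with (eps / 4 / B * B) by (field; lra).
    apply Rmult_le_compat_r; lra. }
apply Rle_lt_trans with (eps / 4 + eps / 4); [now apply Rplus_le_compat | lra].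
Qed.

Lemma Rmax_l_continuous a t : continuous (fun t => Rmax a t) t.
Proof.
apply (filterlim_locally (F := locally t) (fun t => Rmax a t)); intros eps.
exists eps; intros s Hs; change (Rabs (s - t) < eps) in Hs.
change (Rabs (Rmax a s - Rmax a t) < eps).
eapply Rle_lt_trans; [|exact Hs].
unfold Rmax; repeat destruct Rle_dec; unfold Rabs; repeat destruct Rcase_abs; lra.
Qed.

(** Picard iteration measured against the weight [exp (K * (t - t0))] contracts on the whole half
    line at once, so no continuation of local solutions is needed. Freezing the time at [t0] through
    [Rmax] keeps the iterates continuous on the line. *)
Lemma semilinear_exists (N : R -> C0 -> C0) (Lip : R) t0 u0 :
  0 < Lip -> (forall s, N s zero = zero) ->
  (forall s v w, norm (minus (N s v) (N s w)) <= Lip * norm (minus v w)) ->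
  (forall w : R -> C0, (forall s, continuous w s) -> forall s, continuous (fun s => N s (w s)) s) ->
  exists u, mild T (fun s => N s (u s)) t0 u /\ forall t, t <= t0 -> u t = u0.
Proof.
intros HLip HN0 HNL HNc.
(* Since [K - lam = 2 * Lip], integrating [Lip * exp (lam * (tau - s)) * exp (K * (s - t0))] up to
   [tau] gives at most half of [exp (K * (tau - t0))]: the contraction factor is 1/2. *)
pose (K := lam + 2 * Lip).
pose (Phi := fun (w : R -> C0) t => plus (forward T (Rmax t0 t - t0) u0)
  (RInt (fun s => forward T (Rmax t0 t - s) (N s (w s))) t0 (Rmax t0 t))).
assert (HPhi_c : forall w : R -> C0, (forall s, continuous w s) -> forall t, continuous (Phi w) t).
{ intros w Hw t; apply (continuous_plus (V := C0_NormedModule)).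
  - apply forward_continuous_comp; [exact HT | | apply continuous_const].
    apply (continuous_minus (fun s => Rmax t0 s) (fun _ => t0));
      [apply Rmax_l_continuous | apply continuous_const].
  - apply (continuous_comp (fun t => Rmax t0 t)
      (fun r => RInt (fun s => forward T (r - s) (N s (w s))) t0 r)); [apply Rmax_l_continuous|].
    apply duhamel_integral_continuous; now apply HNc. }
assert (HPhi_L : forall (w w' : R -> C0) c, (forall s, continuous w s) -> (forall s, continuous w' s) ->
  (forall s, t0 <= s -> norm (minus (w s) (w' s)) <= c * exp (K * (s - t0))) ->
  forall t, norm (minus (Phi w t) (Phi w' t)) <= c / 2 * exp (K * (Rmax t0 t - t0))).
{ intros w w' c Hw Hw' Hd t.
  assert (0 <= c) as Hc.
  { specialize (Hd t0 (Rle_refl t0)); rewrite Rminus_diag, Rmult_0_r, exp_0, Rmult_1_r in Hd.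
    pose proof (norm_ge_0 (V := C0_NormedModule) (minus (w t0) (w' t0))); lra. }
  pose proof (Rmax_l t0 t) as Htau; unfold Phi; set (tau := Rmax t0 t) in *; clearbody tau.
  assert (Hcc : forall v : R -> C0, (forall s, continuous v s) ->
    forall s, continuous (fun s => forward T (tau - s) (N s (v s))) s).
  { intros v Hv s; apply duhamel_continuous; [exact HT | now apply HNc]. }
  replace (minus (plus (forward T (tau - t0) u0) (RInt (fun s => forward T (tau - s) (N s (w s))) t0 tau))
    (plus (forward T (tau - t0) u0) (RInt (fun s => forward T (tau - s) (N s (w' s))) t0 tau)))
    with (minus (RInt (fun s => forward T (tau - s) (N s (w s))) t0 tau)
    (RInt (fun s => forward T (tau - s) (N s (w' s))) t0 tau)) by C0_ring.
  rewrite <- RInt_C0_minus by now apply Hcc.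
  pose (G := fun s => c / 2 * exp (lam * (tau - s) + K * (s - t0))).
  pose (G' := fun s => exp (lam * (tau - s)) * (Lip * (c * exp (K * (s - t0))))).
  assert (HG : is_RInt G' t0 tau (minus (G tau) (G t0))).
  { apply (is_RInt_derive (V := R_CompleteNormedModule)); intros s _.
    - unfold G, G'; auto_derive; [exact I|].
      rewrite exp_plus; unfold K, Rminus; field.
    - unfold G'; apply (ex_derive_continuous (V := R_NormedModule)); auto_derive; exact I. }
  apply Rle_trans with (minus (G tau) (G t0)).
  - rewrite <- (is_RInt_unique (V := R_CompleteNormedModule) _ _ _ _ HG).
    apply norm_RInt_C0_le; [exact Htau | | |].
    + intros s; apply continuous_C0_minus; now apply Hcc.
    + intros s Hs; rewrite <- linear_C0_minus by (apply (forward_linear T HT)).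
      eapply Rle_trans; [apply forward_norm_le; lra|]; unfold G'.
      apply Rmult_le_compat_l; [left; apply exp_pos|].
      eapply Rle_trans; [apply HNL|]; apply Rmult_le_compat_l; [lra|]; apply Hd; lra.
    + eexists; exact HG.
  - unfold G, minus, plus, opp; simpl; rewrite !Rminus_diag, !Rmult_0_r, Rplus_0_l.
    assert (0 <= c / 2 * exp (lam * (tau - t0) + 0)).
    { apply Rmult_le_pos; [lra | left; apply exp_pos]. }
    lra. }
pose (w := fix w n := match n with O => (fun _ => zero) | S m => Phi (w m) end : R -> C0).
assert (Hw : forall n t, continuous (w n) t).
{ intros n; induction n as [|n IH]; [intros; apply continuous_const|]; now apply HPhi_c. }
assert (HPhi_t0 : forall v t, t <= t0 -> Phi v t = u0).
{ intros v t Ht; unfold Phi; rewrite Rmax_left, Rminus_diag, forward_0 by (exact HT || lra).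
  rewrite (RInt_point (V := C0_CompleteNormedModule)); C0_ring. }
pose (c := norm u0).
assert (Hstep : forall n t, norm (minus (w (S n) t) (w n t)) <= c * exp (K * (Rmax t0 t - t0)) * (/ 2) ^ n).
{ intros n; induction n as [|n IH]; intros t.
  - simpl; rewrite Rmult_1_r.
    assert (RInt (fun s => forward T (Rmax t0 t - s) (N s zero)) t0 (Rmax t0 t) = zero) as EI.
    { rewrite (RInt_ext (V := C0_CompleteNormedModule) _ (fun _ => zero)).
      - rewrite (RInt_const (V := C0_CompleteNormedModule)); C0_ring.
      - intros s _; rewrite HN0; apply (linear_zero _ (forward_linear T HT _)). }
    apply Rle_trans with (norm (forward T (Rmax t0 t - t0) u0)).
    { right; f_equal; unfold Phi; rewrite EI; C0_ring. }
    pose proof (Rmax_l t0 t).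
    eapply Rle_trans; [apply forward_norm_le; lra|].
    rewrite Rmult_comm; apply Rmult_le_compat_l; [apply (norm_ge_0 (V := C0_NormedModule))|].
    apply exp_le_compat, Rmult_le_compat_r; unfold K; lra.
  - replace (c * exp (K * (Rmax t0 t - t0)) * (/ 2) ^ S n)
      with (c * (/ 2) ^ n / 2 * exp (K * (Rmax t0 t - t0))) by (simpl; field).
    apply (HPhi_L (w (S n)) (w n) (c * (/ 2) ^ n)); [apply Hw | apply Hw |].
    intros s Hs; specialize (IH s); rewrite Rmax_right in IH by exact Hs; lra. }
assert (Hlim : forall t, exists l, forall n,
  norm (minus l (w n t)) <= 2 * c * exp (K * (Rmax t0 t - t0)) * (/ 2) ^ n).
{ intros t; destruct (C0_geometric_limit (fun n => w n t) (c * exp (K * (Rmax t0 t - t0))) (/ 2))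
    as [l Hl]; [lra | intros n; apply Hstep |].
  exists l; intros n; eapply Rle_trans; [apply Hl|]; right; field. }
apply choice in Hlim; destruct Hlim as [u Hu].
assert (0 <= c) as Hc by apply (norm_ge_0 (V := C0_NormedModule)).
assert (Huc : forall t, continuous u t).
{ intros t; apply continuous_C0P; intros eps He.
  pose (B := 2 * c * exp (K * (Rmax t0 t + 1 - t0))).
  assert (0 <= B) as HB.
  { unfold B; apply Rmult_le_pos; [lra | left; apply exp_pos]. }
  assert (HBs : forall s n, s <= t + 1 -> norm (minus (u s) (w n s)) <= B * (/ 2) ^ n).
  { intros s n Hs; eapply Rle_trans; [apply Hu|].
    apply Rmult_le_compat_r; [apply pow_le; lra|]; unfold B.
    apply Rmult_le_compat_l; [lra|]; apply exp_le_compat, Rmult_le_compat_l; [unfold K; lra|].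
    unfold Rmax; repeat destruct Rle_dec; lra. }
  destruct (pow_lt_1_zero (/ 2)) with (y := eps / 3 / (B + 1)) as [n Hn].
  { rewrite Rabs_pos_eq; lra. }
  { repeat apply Rdiv_lt_0_compat; lra. }
  specialize (Hn n (le_n n)); rewrite Rabs_pos_eq in Hn by (apply pow_le; lra).
  assert (B * (/ 2) ^ n <= eps / 3) as HBn.
  { replace (eps / 3) with ((B + 1) * (eps / 3 / (B + 1))) by (field; lra).
    apply Rmult_le_compat; [lra | apply pow_le; lra | lra | lra]. }
  destruct (proj1 (continuous_C0P (w n) t) (Hw n t) (eps / 3)) as [d [Hd Hd']]; [lra|].
  exists (Rmin 1 d); split; [apply Rmin_glb_lt; lra|]; intros s Hs.
  pose proof (Rmin_l 1 d); pose proof (Rmin_r 1 d).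
  specialize (Hd' s ltac:(lra)); apply Rabs_def2 in Hs.
  pose proof (HBs s n ltac:(lra)); pose proof (HBs t n ltac:(lra)) as Hbt.
  rewrite norm_minus_sym in Hbt.
  pose proof (norm_minus_triangle (u s) (w n s) (u t)).
  pose proof (norm_minus_triangle (w n s) (w n t) (u t)); lra. }
assert (Hfix : forall t, u t = Phi u t).
{ intros t; apply norm_minus_eq0.
  apply (le_0_of_geometric (/ 2) _ (2 * c * exp (K * (Rmax t0 t - t0)))); [lra|]; intros n.
  pose proof (norm_minus_triangle (u t) (w (S n) t) (Phi u t)) as H1.
  pose proof (Hu t (S n)) as H2; simpl pow in H2.
  pose proof (HPhi_L (w n) u (2 * c * (/ 2) ^ n) (Hw n) Huc) as H3.
  specialize (H3 ltac:(intros s Hs; rewrite norm_minus_sym; specialize (Hu s n);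
    rewrite Rmax_right in Hu by exact Hs; lra) t).
  change (w (S n) t) with (Phi (w n) t) in *; lra. }
exists u; split; [|intros t Ht; rewrite Hfix; now apply HPhi_t0].
split; [exact Huc|]; split; [now apply HNc|]; intros t Ht.
rewrite (Hfix t), (Hfix t0), (HPhi_t0 u t0) by lra; unfold Phi.
rewrite Rmax_right by exact Ht; reflexivity.
Qed.

End Evolution.

(** * Explicit barriers *)

(** The factor [exp (- p * ln W)] is the real power [W^(-p)]; [p = 1 / 2] serves the barriers,
    [p = 3 / 2] the supersolution of the linearization. *)
Definition barrier (p : R) (A B : R -> R) (t x : R) : R :=
  sin x * exp (- p * ln (A t + B t * (sin x * sin x))).

Definition barrier_x (p : R) (A B : R -> R) (t x : R) : R :=
  exp (- p * ln (A t + B t * (sin x * sin x))) *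
  (cos x - 2 * p * B t * (sin x * sin x) * cos x / (A t + B t * (sin x * sin x))).

Definition barrier_xx (p : R) (A B : R -> R) (t x : R) : R :=
  let W := A t + B t * (sin x * sin x) in
  barrier p A B t x *
  (- p / W * (6 * B t * (cos x * cos x) - 2 * B t * (sin x * sin x)) +
   p * (p + 1) * (4 * B t ^ 2 * (sin x * sin x) * (cos x * cos x)) / (W * W) - 1).

Definition barrier_t (p : R) (A B dA dB : R -> R) (t x : R) : R :=
  barrier p A B t x *
  (- p / (A t + B t * (sin x * sin x)) * (dA t + dB t * (sin x * sin x))).

(* [defect] is [(psi_t - psi_xx - lam psi) / psi] for [psi = barrier p A B],
   as a function of [y = sin x ^ 2]. *)
Definition defect (lam p : R) (A B dA dB : R -> R) (t y : R) : R :=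
  let W := A t + B t * y in
  - p / W * (dA t + dB t * y - 6 * B t + 8 * B t * y) -
  p * (p + 1) * (4 * B t ^ 2 * y * (1 - y)) / (W * W) - (lam - 1).

Lemma cos_mul_self x : cos x * cos x = 1 - sin x * sin x.
Proof. pose proof (sin2_cos2 x) as H; unfold Rsqr in H; lra. Qed.

Lemma sin_mul_self_bounds x : 0 <= sin x * sin x <= 1.
Proof. pose proof (cos_mul_self x); pose proof (Rle_0_sqr (sin x)); pose proof (Rle_0_sqr (cos x)); unfold Rsqr in *; lra. Qed.

Lemma barrier_defect lam p A B dA dB t x : 0 < A t + B t * (sin x * sin x) ->
  barrier_t p A B dA dB t x - barrier_xx p A B t x - lam * barrier p A B t x =
  defect lam p A B dA dB t (sin x * sin x) * barrier p A B t x.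
Proof.
intros HW; unfold barrier_t, barrier_xx, defect; rewrite cos_mul_self; field; lra.
Qed.

Section Barrier.

Context (p : R) (A B dA dB : R -> R)
  (HdA : forall t, is_derive A t (dA t)) (HdB : forall t, is_derive B t (dB t))
  (HW : forall t y, 0 <= y <= 1 -> 0 < A t + B t * y).

Lemma barrier_derive_t t x : is_derive (fun s => barrier p A B s x) t (barrier_t p A B dA dB t x).
Proof.
pose proof (HW t _ (sin_mul_self_bounds x)) as HWx.
unfold barrier; auto_derive.
- repeat split; [now exists (dA t) | now exists (dB t) | exact HWx].
- assert (Derive (fun x : R => A x) t = dA t) as -> by apply is_derive_unique, HdA.
  assert (Derive (fun x : R => B x) t = dB t) as -> by apply is_derive_unique, HdB.
  unfold barrier_t, barrier; field; lra.
Qed.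

Lemma barrier_derive_x t x : is_derive (barrier p A B t) x (barrier_x p A B t x).
Proof.
pose proof (HW t _ (sin_mul_self_bounds x)) as HWx.
unfold barrier; auto_derive; [repeat split; exact HWx|].
unfold barrier_x; field; lra.
Qed.

Lemma barrier_derive_xx t x : is_derive (barrier_x p A B t) x (barrier_xx p A B t x).
Proof.
pose proof (HW t _ (sin_mul_self_bounds x)) as HWx.
unfold barrier_x; auto_derive; [repeat split; lra|].
unfold barrier_xx, barrier; field; lra.
Qed.

Lemma barrier_continuous q : continuous (fun q : R * R => barrier p A B (fst q) (snd q)) q.
Proof.
pose proof (HW (fst q) _ (sin_mul_self_bounds (snd q))) as HWx.
assert (Hs : continuous (fun q : R * R => sin (snd q)) q).
{ apply (continuous_comp (fun q : R * R => snd q) sin); [apply continuous_snd | apply continuous_sin]. }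
assert (Hs2 : continuous (fun q : R * R => sin (snd q) * sin (snd q)) q).
{ now apply (continuous_mult (fun q : R * R => sin (snd q)) (fun q => sin (snd q))). }
assert (Hcomp : forall f df : R -> R, (forall t, is_derive f t (df t)) ->
  continuous (fun q : R * R => f (fst q)) q).
{ intros f df Hf; apply (continuous_comp (fun q : R * R => fst q) f); [apply continuous_fst|].
  apply (ex_derive_continuous f); now exists (df (fst q)). }
unfold barrier.
apply (continuous_mult (fun q : R * R => sin (snd q))
  (fun q => exp (- p * ln (A (fst q) + B (fst q) * (sin (snd q) * sin (snd q)))))); [exact Hs|].
apply (continuous_comp (fun q : R * R => A (fst q) + B (fst q) * (sin (snd q) * sin (snd q)))
  (fun w => exp (- p * ln w))).
- apply (continuous_plus (fun q : R * R => A (fst q)) (fun q => B (fst q) * (sin (snd q) * sin (snd q)))).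
  + exact (Hcomp A dA HdA).
  + apply (continuous_mult (fun q : R * R => B (fst q)) (fun q => sin (snd q) * sin (snd q)));
      [exact (Hcomp B dB HdB) | exact Hs2].
- apply (ex_derive_continuous (fun w => exp (- p * ln w))); auto_derive; exact HWx.
Qed.

Lemma barrier_nonneg t x : 0 <= x <= PI -> 0 <= barrier p A B t x.
Proof.
intros Hx; apply Rmult_le_pos; [apply sin_ge_0; lra | left; apply exp_pos].
Qed.

Lemma barrier_boundary t : barrier p A B t 0 = 0 /\ barrier p A B t PI = 0.
Proof. unfold barrier; rewrite sin_0, sin_PI; split; ring. Qed.

End Barrier.

Lemma exp_ln_antimono p w w' : 0 <= p -> 0 < w <= w' -> exp (- p * ln w') <= exp (- p * ln w).
Proof.
intros Hp Hw; apply exp_le_compat.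
assert (ln w <= ln w') by (apply ln_le; lra).
assert (p * ln w <= p * ln w') by (apply Rmult_le_compat_l; lra); lra.
Qed.

Lemma barrier_half_sqr A B t x : 0 < A t + B t * (sin x * sin x) ->
  barrier (1 / 2) A B t x * barrier (1 / 2) A B t x =
  (sin x * sin x) / (A t + B t * (sin x * sin x)).
Proof.
intros HW; unfold barrier; set (w := A t + _) in *.
replace (sin x * exp (- (1 / 2) * ln w) * (sin x * exp (- (1 / 2) * ln w))) with
  (sin x * sin x * (exp (- (1 / 2) * ln w) * exp (- (1 / 2) * ln w))) by ring.
rewrite <- exp_plus.
replace (- (1 / 2) * ln w + - (1 / 2) * ln w) with (- ln w) by field.
rewrite exp_Ropp, exp_ln by exact HW; reflexivity.
Qed.

Lemma sin_sqr_le_parabola x : 0 <= x <= PI -> sin x * sin x <= x * (PI - x).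
Proof.
intros Hx.
assert (forall z, 0 <= z -> sin z <= z) as H.
{ intros z [Hz | <-]; [left; now apply sin_lt_x | rewrite sin_0; lra]. }
pose proof (H x ltac:(lra)); pose proof (H (PI - x) ltac:(lra)) as H'.
rewrite sin_PI_x in H'; pose proof (sin_ge_0 x ltac:(lra) ltac:(lra)).
apply Rmult_le_compat; lra.
Qed.

(** On [[0, 1]] the cubic Taylor bound gives [sin z >= 5/6 z], while the parabola is at most
    [4/5 z]. On [[1, pi/2]] the parabola is at most [pi^2 / 20 <= 4/5], below [sin 1 >= 5/6]. The
    other half follows by reflection. *)
Lemma sin_ge_parabola x : 0 <= x <= PI -> x * (PI - x) / 5 <= sin x.
Proof.
intros Hx; pose proof PI_4 as HP4; pose proof PI2_3_2 as HP3.
assert (Hlow : forall z, 0 <= z <= 1 -> 5 / 6 * z <= sin z).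
{ intros z Hz; destruct (sin_bound z 0) as [H _]; [lra | lra |].
  unfold sin_approx, sin_term in H; simpl in H; nra. }
assert (Hhalf : forall z, 0 <= z <= PI / 2 -> z * (PI - z) / 5 <= sin z).
{ intros z Hz; destruct (Rle_lt_dec z 1) as [H1|H1].
  - pose proof (Hlow z ltac:(lra)); nra.
  - pose proof (Hlow 1 ltac:(lra)) as H2.
    assert (sin 1 <= sin z) by (apply sin_incr_1; lra).
    pose proof (Rle_0_sqr (z - PI / 2)) as Hsq; unfold Rsqr in Hsq; nra. }
destruct (Rle_lt_dec x (PI / 2)) as [H|H]; [now apply Hhalf; lra|].
rewrite <- sin_PI_x; replace (x * (PI - x)) with ((PI - x) * (PI - (PI - x))) by ring.
apply Hhalf; lra.
Qed.

Lemma clamp_continuous (f : R -> R) (a b : R) x :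
  (forall x, continuous f x) -> continuous (fun x => f (Rmin b (Rmax a x))) x.
Proof.
intros Hf; apply (continuous_comp (fun x => Rmin b (Rmax a x)) f); [|apply Hf].
apply (filterlim_locally (F := locally x) (fun x => Rmin b (Rmax a x))); intros eps.
exists eps; intros s Hs; change (Rabs (s - x) < eps) in Hs.
change (Rabs (Rmin b (Rmax a s) - Rmin b (Rmax a x)) < eps).
eapply Rle_lt_trans; [|exact Hs].
unfold Rmin, Rmax; repeat destruct Rle_dec; unfold Rabs; repeat destruct Rcase_abs; lra.
Qed.

Lemma C0_of_continuous (f : R -> R) : (forall x, continuous f x) -> f 0 = 0 -> f PI = 0 ->
  exists F : C0, forall x, 0 <= x <= PI -> F x = f x.
Proof.
intros Hf H0 HPI; pose proof PI_RGT_0.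
unshelve eexists (mkC0 (fun x => f (Rmin PI (Rmax 0 x))) _ _).
- intros x; now apply clamp_continuous.
- intros x Hx; simpl; destruct (Rle_lt_dec x 0).
  + rewrite Rmax_left, Rmin_right by lra; exact H0.
  + rewrite Rmax_right, Rmin_left by lra; exact HPI.
- intros x Hx; simpl; rewrite Rmax_right, Rmin_right by lra; reflexivity.
Qed.

(** * The truncated equation *)

Definition classical (P Pt Px Pxx : R -> R -> R) : Prop :=
  (forall q : R * R, continuous (fun q => P (fst q) (snd q)) q) /\
  forall t x, is_derive (fun s => P s x) t (Pt t x) /\
    is_derive (P t) x (Px t x) /\ is_derive (Px t) x (Pxx t x).

Lemma classical_barrier p A B dA dB :
  (forall t, is_derive A t (dA t)) -> (forall t, is_derive B t (dB t)) ->
  (forall t y, 0 <= y <= 1 -> 0 < A t + B t * y) ->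
  classical (barrier p A B) (barrier_t p A B dA dB) (barrier_x p A B) (barrier_xx p A B).
Proof.
intros HdA HdB HW; split.
- intros q; now apply (barrier_continuous p A B dA dB).
- intros t x; split; [|split].
  + now apply barrier_derive_t.
  + now apply barrier_derive_x.
  + now apply barrier_derive_xx.
Qed.

Lemma classical_opp P Pt Px Pxx : classical P Pt Px Pxx ->
  classical (fun t x => - P t x) (fun t x => - Pt t x) (fun t x => - Px t x) (fun t x => - Pxx t x).
Proof.
intros [Hc Hd]; split.
- intros q; apply (continuous_opp (fun q : R * R => P (fst q) (snd q))), Hc.
- intros t x; destruct (Hd t x) as [H1 [H2 H3]]; split; [|split].
  + now apply (is_derive_opp (fun s => P s x)).
  + now apply (is_derive_opp (P t)).
  + now apply (is_derive_opp (Px t)).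
Qed.

Lemma classical_decay P Pt Px Pxx a k t0 : classical P Pt Px Pxx ->
  classical (fun t x => a * exp (- k * (t - t0)) * P t x)
    (fun t x => a * exp (- k * (t - t0)) * (Pt t x - k * P t x))
    (fun t x => a * exp (- k * (t - t0)) * Px t x)
    (fun t x => a * exp (- k * (t - t0)) * Pxx t x).
Proof.
intros [Hc Hd]; split.
- intros q; apply (continuous_mult (fun q : R * R => a * exp (- k * (fst q - t0)))
    (fun q => P (fst q) (snd q))); [|apply Hc].
  apply (continuous_comp (fun q : R * R => fst q) (fun t => a * exp (- k * (t - t0)))).
  + apply continuous_fst.
  + apply (ex_derive_continuous (fun t => a * exp (- k * (t - t0)))); auto_derive; exact I.
- intros t x; destruct (Hd t x) as [H1 [H2 H3]]; split; [|split].
  + replace (a * exp (- k * (t - t0)) * (Pt t x - k * P t x)) with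
      (- k * a * exp (- k * (t - t0)) * P t x + a * exp (- k * (t - t0)) * Pt t x) by ring.
    apply (is_derive_mult (fun s => a * exp (- k * (s - t0))) (fun s => P s x));
      [|exact H1 | intros; apply Rmult_comm].
    auto_derive; [exact I|]; unfold Rminus; ring.
  + now apply (is_derive_scal (P t)).
  + now apply (is_derive_scal (Px t)).
Qed.

Lemma classical_add_parabola P Pt Px Pxx eta lam : classical P Pt Px Pxx ->
  classical (fun t x => P t x + eta * (1 + lam * (x * (PI - x)))) Pt
    (fun t x => Px t x + eta * (lam * (PI - 2 * x))) (fun t x => Pxx t x - eta * (2 * lam)).
Proof.
intros [Hc Hd]; split.
- intros q; apply (continuous_plus (fun q : R * R => P (fst q) (snd q))
    (fun q => eta * (1 + lam * (snd q * (PI - snd q))))); [apply Hc|].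
  apply (continuous_comp (fun q : R * R => snd q) (fun x => eta * (1 + lam * (x * (PI - x))))).
  + apply continuous_snd.
  + apply (ex_derive_continuous (fun x => eta * (1 + lam * (x * (PI - x))))); auto_derive; exact I.
- intros t x; destruct (Hd t x) as [H1 [H2 H3]]; split; [|split].
  + rewrite <- (Rplus_0_r (Pt t x)).
    apply (is_derive_plus (fun s => P s x) (fun _ => eta * (1 + lam * (x * (PI - x))))); [exact H1|].
    apply (is_derive_const (K := R_AbsRing) (V := R_NormedModule)).
  + apply (is_derive_plus (P t) (fun x => eta * (1 + lam * (x * (PI - x))))); [exact H2|].
    auto_derive; [exact I | ring].
  + apply (is_derive_plus (Px t) (fun x => eta * (lam * (PI - 2 * x)))); [exact H3|].
    auto_derive; [exact I | ring].
Qed.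

Definition cutoff (M z : R) : R := Rmax (- M) (Rmin M z).

Lemma cutoff_bound M z : 0 <= M -> Rabs (cutoff M z) <= M.
Proof.
intros HM; apply Rabs_le_between; unfold cutoff, Rmin, Rmax; repeat destruct Rle_dec; lra.
Qed.

Lemma cutoff_id M z : Rabs z <= M -> cutoff M z = z.
Proof.
intros Hz; apply Rabs_le_between in Hz; unfold cutoff, Rmin, Rmax; repeat destruct Rle_dec; lra.
Qed.

Lemma cutoff_lipschitz M z z' : Rabs (cutoff M z - cutoff M z') <= Rabs (z - z').
Proof.
unfold cutoff, Rmin, Rmax; repeat destruct Rle_dec; unfold Rabs; repeat destruct Rcase_abs; lra.
Qed.

Lemma cutoff_cube_lipschitz M z z' : 0 <= M ->
  Rabs (cutoff M z ^ 3 - cutoff M z' ^ 3) <= 3 * M ^ 2 * Rabs (z - z').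
Proof.
intros HM.
pose proof (cutoff_bound M z HM) as H1; pose proof (cutoff_bound M z' HM) as H2.
pose proof (cutoff_lipschitz M z z') as H3.
set (c := cutoff M z) in *; set (c' := cutoff M z') in *.
replace (c ^ 3 - c' ^ 3) with ((c * c + c * c' + c' * c') * (c - c')) by ring.
rewrite Rabs_mult; apply Rmult_le_compat; try apply Rabs_pos; [|exact H3].
apply Rabs_le_between in H1; apply Rabs_le_between in H2; apply Rabs_le_between.
split; nra.
Qed.

Definition C0_cutoff_cube (M : R) (HM : 0 <= M) (f : C0) : C0.
Proof.
refine (mkC0 (fun x => cutoff M (f x) ^ 3) _ _).
- intros x.
  apply (filterlim_locally (F := locally x) (fun x => cutoff M (f x) ^ 3)); intros eps.
  assert (0 < eps / (3 * M ^ 2 + 1)) as He.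
  { apply Rdiv_lt_0_compat; [apply cond_pos | pose proof (pow2_ge_0 M); lra]. }
  destruct (proj1 (filterlim_locally (F := locally x) f (f x)) (C0_cont f x) (mkposreal _ He))
    as [d Hd].
  exists d; intros y Hy; specialize (Hd y Hy).
  change (Rabs (f y - f x) < eps / (3 * M ^ 2 + 1)) in Hd.
  change (Rabs (cutoff M (f y) ^ 3 - cutoff M (f x) ^ 3) < eps).
  eapply Rle_lt_trans; [now apply cutoff_cube_lipschitz|].
  pose proof (pow2_ge_0 M); pose proof (Rabs_pos (f y - f x)).
  apply Rle_lt_trans with ((3 * M ^ 2 + 1) * Rabs (f y - f x)); [nra|].
  apply Rmult_lt_compat_l with (r := 3 * M ^ 2 + 1) in Hd; [|lra].
  replace ((3 * M ^ 2 + 1) * (eps / (3 * M ^ 2 + 1))) with (eps : R) in Hd by (field; lra).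
  exact Hd.
- intros x Hx; rewrite (C0_supp f x Hx), cutoff_id by (rewrite Rabs_R0; exact HM); ring.
Defined.

Lemma C0_cutoff_cube_lipschitz M HM f g :
  norm (minus (C0_cutoff_cube M HM f) (C0_cutoff_cube M HM g)) <= 3 * M ^ 2 * norm (minus f g).
Proof.
apply C0_norm_le; intros x; simpl.
eapply Rle_trans; [now apply cutoff_cube_lipschitz|].
apply Rmult_le_compat_l; [pose proof (pow2_ge_0 M); simpl in *; lra | apply (C0_eval_le f g x)].
Qed.

Section Equation.

Context (lam : R) (Hlam : 0 <= lam) (T : R -> C0 -> C0)
  (Hgen : generates (V := C0_NormedModule) (L_graph lam) T)
  (b : R -> R) (beta : R) (Hb : forall t, Rabs (b t) <= beta) (Hbeta : 0 < beta)
  (Hbc : forall t, continuous b t) (M : R) (HM : 1 <= M).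

Let HT : is_C0_semigroup (V := C0_NormedModule) T := proj1 Hgen.
Let HM0 : 0 <= M := Rle_trans 0 1 M Rle_0_1 HM.

(** The sign is absorbed here because [mild] adds the Duhamel integral, whereas [is_solution]
    subtracts it. *)
Definition forcing (s : R) (v : C0) : C0 := scal (- b s) (C0_cutoff_cube M HM0 v).

Definition solves (t0 : R) (u : R -> C0) : Prop := mild T (fun s => forcing s (u s)) t0 u.

Let Lip := beta * (3 * M ^ 2).

Lemma Lip_pos : 0 < Lip.
Proof. unfold Lip; apply Rmult_lt_0_compat; [exact Hbeta | nra]. Qed.

Lemma forcing_eval_lipschitz s z z' :
  Rabs (- b s * cutoff M z ^ 3 - - b s * cutoff M z' ^ 3) <= Lip * Rabs (z - z').
Proof.
replace (- b s * cutoff M z ^ 3 - - b s * cutoff M z' ^ 3) with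
  (- b s * (cutoff M z ^ 3 - cutoff M z' ^ 3)) by ring.
rewrite Rabs_mult, Rabs_Ropp; unfold Lip; rewrite Rmult_assoc.
apply Rmult_le_compat; try apply Rabs_pos; [apply Hb | now apply cutoff_cube_lipschitz].
Qed.

Lemma forcing_lipschitz s v w : norm (minus (forcing s v) (forcing s w)) <= Lip * norm (minus v w).
Proof.
apply C0_norm_le; intros x.
eapply Rle_trans; [apply (forcing_eval_lipschitz s (v x) (w x))|].
apply Rmult_le_compat_l; [left; apply Lip_pos | apply C0_eval_le].
Qed.

Lemma forcing_continuous (w : R -> C0) s :
  (forall t, continuous w t) -> continuous (fun s => forcing s (w s)) s.
Proof.
intros Hw; unfold forcing.
apply (continuous_scal (K := R_AbsRing) (V := C0_NormedModule) (fun s => - b s)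
  (fun s => C0_cutoff_cube M HM0 (w s))).
- apply (continuous_opp b), Hbc.
- apply continuous_C0P; intros eps He.
  assert (0 < 3 * M ^ 2) by nra.
  destruct (proj1 (continuous_C0P w s) (Hw s) (eps / (3 * M ^ 2))) as [d [Hd H']].
  { apply Rdiv_lt_0_compat; lra. }
  exists d; split; [exact Hd|]; intros r Hr; specialize (H' r Hr).
  eapply Rle_lt_trans; [apply C0_cutoff_cube_lipschitz|].
  apply Rmult_lt_compat_l with (r := 3 * M ^ 2) in H'; [|lra].
  replace (3 * M ^ 2 * (eps / (3 * M ^ 2))) with eps in H' by (field; lra); exact H'.
Qed.

Lemma solves_exists t0 u0 : exists u, solves t0 u /\ forall t, t <= t0 -> u t = u0.
Proof.
apply (semilinear_exists lam Hlam T Hgen forcing Lip).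
- apply Lip_pos.
- intros s; apply C0_ext; intros x; simpl.
  rewrite cutoff_id by (rewrite Rabs_R0; exact HM0); ring.
- apply forcing_lipschitz.
- intros w Hw s; now apply forcing_continuous.
Qed.

Lemma solves_restart t0 t1 u : solves t0 u -> t0 <= t1 -> solves t1 u.
Proof. intros H H01; now apply (mild_restart T HT _ t0). Qed.

Lemma solves_shift t0 u c : (forall t, b (t + c) = b t) ->
  solves t0 u -> solves (t0 - c) (fun s => u (s + c)).
Proof.
intros Hp H; apply (mild_shift T HT) with (c := c) in H; unfold solves.
replace (fun s => forcing s (u (s + c))) with (fun s => forcing (s + c) (u (s + c))); [exact H|].
apply functional_extensionality; intros s; unfold forcing; now rewrite Hp.
Qed.

(** On values bounded by [M] the truncation is the identity, and the clamped propagators agree with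
    [T] on the interval of integration. *)
Lemma solves_is_solution t0 u : solves t0 u ->
  (forall t x, t0 <= t -> Rabs (u t x) <= M) -> is_solution T b t0 (u t0) u.
Proof.
intros [Hu [Hg H]] Hbd; split; [reflexivity|]; split.
{ now apply continuous_on_forall. }
intros t Ht integrand.
pose (f := fun s => opp (forward T (t - s) (forcing s (u s))) : C0).
assert (Hf : ex_RInt (fun s => forward T (t - s) (forcing s (u s))) t0 t).
{ apply ex_RInt_C0; intros s; apply duhamel_continuous; [exact HT | exact Hg]. }
assert (Hext : forall s, Rmin t0 t < s < Rmax t0 t -> f s = integrand s).
{ intros s Hs; rewrite Rmin_left, Rmax_right in Hs by exact Ht.
  unfold f, integrand; rewrite forward_eq by lra.
  replace (forcing s (u s)) with (scal (-1) (scal (b s) (C0_cube (u s)))).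
  - rewrite (linear_scal _ (semigroup_linear T HT (t - s) ltac:(lra))); C0_ring.
  - apply C0_ext; intros x; simpl; rewrite cutoff_id by (apply Hbd; lra).
    change (-1 * (b s * (u s x * (u s x * (u s x * 1)))) = - b s * (u s x * (u s x * (u s x * 1)))); ring. }
assert (Hopp : is_RInt f t0 t (opp (RInt (fun s => forward T (t - s) (forcing s (u s))) t0 t))).
{ apply (is_RInt_opp (V := C0_NormedModule)), (RInt_correct (V := C0_CompleteNormedModule)), Hf. }
assert (Hi : is_RInt integrand t0 t (opp (RInt (fun s => forward T (t - s) (forcing s (u s))) t0 t))).
{ apply (is_RInt_ext (V := C0_NormedModule) f); [exact Hext | exact Hopp]. }
split; [eexists; exact Hi|].
rewrite (is_RInt_unique (V := C0_CompleteNormedModule) _ _ _ _ Hi), (H t Ht), forward_eq by lra.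
C0_ring.
Qed.

(* For a difference [d] of two solutions, [F] is the difference of the
   nonlinearities as a function of [d]. *)
Lemma solves_comparison (F : R -> R -> R -> R) t0 g d P Pt Px Pxx :
  mild T g t0 d -> classical P Pt Px Pxx ->
  (forall t, t0 <= t -> 0 <= P t 0 /\ 0 <= P t PI) ->
  (forall x, 0 <= x <= PI -> d t0 x <= P t0 x) ->
  (forall t x, t0 < t -> 0 < x < PI -> g t x = F t x (d t x)) ->
  (forall t x z z', t0 < t -> 0 < x < PI -> Rabs (F t x z - F t x z') <= Lip * Rabs (z - z')) ->
  (forall t x, t0 < t -> 0 < x < PI -> F t x (P t x) <= Pt t x - Pxx t x - lam * P t x) ->
  forall t x, t0 <= t -> 0 <= x <= PI -> d t x <= P t x.
Proof.
intros Hd [HPc HPd] HPb H0 HF HL Hsup.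
apply (mild_comparison lam T g t0 d P Pt Px Pxx Lip); auto.
- left; apply Lip_pos.
- intros t x Ht Hx; rewrite HF by assumption.
  specialize (HL t x (d t x) (P t x) Ht Hx); specialize (Hsup t x Ht Hx).
  apply Rabs_le_between in HL; lra.
Qed.

End Equation.

(** * Trapped solutions and the periodic orbit *)

Definition has_stable_periodic_orbit (T : R -> C0 -> C0) (b : R -> R) : Prop :=
  exists ustar : R -> C0,
    is_periodic_orbit T b ustar /\
    exists delta D k : R,
      0 < delta /\ 0 < D /\ 0 < k /\
      forall (t0 : R) (u0 : C0),
        norm (minus (ustar t0) u0) <= delta ->
        exists u : R -> C0,
          is_solution T b t0 u0 u /\
          forall t, t0 <= t ->
            norm (minus (ustar t) (u t)) <=
              D * exp (- k * (t - t0)) * norm (minus (ustar t0) (u t0)).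

Section Orbit.

(** The barrier inequalities are stated after division by the barrier, as functions of
    [y = sin^2 x]: [Hlo] and [Hhi] make the two profiles a sub- and a supersolution, and [Hkey]
    gives [psi] the decay rate [kappa] for every linearization whose squared coefficient [v] lies
    between the squared barriers. *)
Context (lam : R) (Hlam : 0 < lam) (T : R -> C0 -> C0)
  (Hgen : generates (V := C0_NormedModule) (L_graph lam) T)
  (b : R -> R) (beta : R) (Hb : forall t, Rabs (b t) <= beta) (Hbeta : 0 < beta)
  (Hbc : forall t, continuous b t) (Hbp : forall t, b (t + 1) = b t)
  (A1 B1 A2 B2 dA1 dB1 dA2 dB2 : R -> R)
  (HdA1 : forall t, is_derive A1 t (dA1 t)) (HdB1 : forall t, is_derive B1 t (dB1 t))
  (HdA2 : forall t, is_derive A2 t (dA2 t)) (HdB2 : forall t, is_derive B2 t (dB2 t))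
  (HpA1 : forall t, A1 (t + 1) = A1 t) (HpB1 : forall t, B1 (t + 1) = B1 t)
  (HpA2 : forall t, A2 (t + 1) = A2 t) (HpB2 : forall t, B2 (t + 1) = B2 t)
  (m M0 kappa : R) (Hm : 0 < m) (Hkappa : 0 < kappa)
  (HW2 : forall t y, 0 <= y <= 1 -> m <= A2 t + B2 t * y)
  (HW12 : forall t y, 0 <= y <= 1 -> A2 t + B2 t * y <= A1 t + B1 t * y)
  (HW1 : forall t y, 0 <= y <= 1 -> A1 t + B1 t * y <= M0)
  (Hlo : forall t y, 0 <= y <= 1 ->
    defect lam (1 / 2) A1 B1 dA1 dB1 t y + b t * (y / (A1 t + B1 t * y)) <= 0)
  (Hhi : forall t y, 0 <= y <= 1 ->
    0 <= defect lam (1 / 2) A2 B2 dA2 dB2 t y + b t * (y / (A2 t + B2 t * y)))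
  (Hkey : forall t y v, 0 <= y <= 1 -> y / (A1 t + B1 t * y) <= v <= y / (A2 t + B2 t * y) ->
    kappa <= defect lam (3 / 2) A1 B1 dA1 dB1 t y + 3 * b t * v).

Let HT : is_C0_semigroup (V := C0_NormedModule) T := proj1 Hgen.
Let Hlam0 : 0 <= lam := Rlt_le _ _ Hlam.

Let lo := barrier (1 / 2) A1 B1.
Let hi := barrier (1 / 2) A2 B2.
Let psi := barrier (3 / 2) A1 B1.
Let psimax := exp (- (3 / 2) * ln m).
(** The first term bounds the upper barrier; the added 1 leaves room for perturbed solutions, so
    that the truncation is inactive along them as well. *)
Let M := exp (- (1 / 2) * ln m) + 1.

Lemma M_ge_1 : 1 <= M.
Proof. unfold M; pose proof (exp_pos (- (1 / 2) * ln m)); lra. Qed.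

Let HM := M_ge_1.
Let sol := solves T b M HM.
Let Lip := beta * (3 * M ^ 2).

Lemma W1_ge t y : 0 <= y <= 1 -> m <= A1 t + B1 t * y.
Proof. intros Hy; pose proof (HW2 t y Hy); pose proof (HW12 t y Hy); lra. Qed.

Lemma W1_pos t y : 0 <= y <= 1 -> 0 < A1 t + B1 t * y.
Proof. intros Hy; pose proof (W1_ge t y Hy); lra. Qed.

Lemma W2_pos t y : 0 <= y <= 1 -> 0 < A2 t + B2 t * y.
Proof. intros Hy; pose proof (HW2 t y Hy); lra. Qed.

Lemma lo_le_hi t x : 0 <= x <= PI -> 0 <= lo t x <= hi t x.
Proof.
intros Hx; split; [now apply barrier_nonneg|].
apply Rmult_le_compat_l; [apply sin_ge_0; lra|].
pose proof (sin_mul_self_bounds x) as Hy.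
apply exp_ln_antimono; [lra|]; split; [now apply W2_pos | now apply HW12].
Qed.

Lemma hi_le t x : 0 <= x <= PI -> hi t x <= (M - 1) * sin x.
Proof.
intros Hx; unfold hi, barrier; rewrite Rmult_comm.
apply Rmult_le_compat_r; [apply sin_ge_0; lra|].
pose proof (sin_mul_self_bounds x) as Hy.
unfold M; replace (exp (- (1 / 2) * ln m) + 1 - 1) with (exp (- (1 / 2) * ln m)) by ring.
apply exp_ln_antimono; [lra|]; split; [exact Hm | now apply HW2].
Qed.

(** Together with [hi_le], the lower bound by a multiple of [sin x] lets a multiple of [psi]
    dominate the difference of any two trapped functions up to the boundary. *)
Lemma psi_bounds t x : 0 <= x <= PI ->
  exp (- (3 / 2) * ln M0) * sin x <= psi t x <= psimax.
Proof.
intros Hx; pose proof (sin_mul_self_bounds x) as Hy.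
pose proof (sin_ge_0 x ltac:(lra) ltac:(lra)) as Hs.
pose proof (W1_pos t _ Hy) as HWp; pose proof (W1_ge t _ Hy) as HWm; pose proof (HW1 t _ Hy).
unfold psi, barrier; split.
- rewrite Rmult_comm; apply Rmult_le_compat_l; [exact Hs|].
  apply exp_ln_antimono; lra.
- rewrite <- (Rmult_1_l psimax); apply Rmult_le_compat.
  + exact Hs.
  + left; apply exp_pos.
  + apply SIN_bound.
  + unfold psimax; apply exp_ln_antimono; lra.
Qed.

Definition trapped (t : R) (u : C0) : Prop := forall x, 0 <= x <= PI -> lo t x <= u x <= hi t x.

Lemma trapped_abs t u x : trapped t u -> Rabs (u x) <= M - 1.
Proof.
intros H; destruct (classic (0 <= x <= PI)) as [Hx|Hx].
- specialize (H x Hx); pose proof (lo_le_hi t x Hx); pose proof (hi_le t x Hx).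
  pose proof (SIN_bound x) as Hs; pose proof M_ge_1.
  apply Rabs_le_between; split; [lra|]; nra.
- rewrite C0_supp, Rabs_R0 by lra; pose proof M_ge_1; lra.
Qed.

Lemma trapped_norm t u : trapped t u -> norm u <= M.
Proof.
intros H; apply C0_norm_le; intros x; pose proof (trapped_abs t u x H); lra.
Qed.

Lemma trapped_solves t0 u : sol t0 u -> trapped t0 (u t0) -> forall t, t0 <= t -> trapped t (u t).
Proof.
intros Hs H0 t Ht x Hx.
pose proof (classical_barrier (1 / 2) A1 B1 dA1 dB1 HdA1 HdB1 W1_pos) as Hcl1.
pose proof (classical_barrier (1 / 2) A2 B2 dA2 dB2 HdA2 HdB2 W2_pos) as Hcl2.
pose proof M_ge_1.
split.
(* Comparison is one-sided; the lower bound is an upper bound for the zero solution minus [u], with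
   the negated barrier. *)
- assert (minus zero (u t) x <= - lo t x) as Hle; [|simpl in Hle; lra].
  refine (solves_comparison lam Hlam0 T Hgen beta Hbeta M HM
    (fun t x z => - (- b t * cutoff M (- z) ^ 3)) t0 _ _ _ _ _ _
    (mild_minus T HT _ _ _ _ _ (mild_zero T HT t0) Hs) (classical_opp _ _ _ _ Hcl1) _ _ _ _ _ t x Ht Hx).
  + intros s _; destruct (barrier_boundary (1 / 2) A1 B1 s) as [-> ->]; lra.
  + intros y Hy; specialize (H0 y Hy); unfold lo in H0; simpl; lra.
  + intros s y _ _; simpl.
    replace (- (0 + - u s y)) with (u s y) by ring; ring.
  + intros s y z z' _ _.
    replace (- (- b s * cutoff M (- z) ^ 3) - - (- b s * cutoff M (- z') ^ 3)) with
      (- (- b s * cutoff M (- z) ^ 3 - - b s * cutoff M (- z') ^ 3)) by ring.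
    rewrite Rabs_Ropp.
    replace (Rabs (z - z')) with (Rabs (- z - - z')).
    * now apply forcing_eval_lipschitz.
    * rewrite <- Rabs_Ropp; f_equal; ring.
  + intros s y Hs' Hy.
    pose proof (sin_mul_self_bounds y) as Hyy.
    pose proof (lo_le_hi s y ltac:(lra)) as Hlh; pose proof (hi_le s y ltac:(lra)).
    pose proof (SIN_bound y).
    pose proof (barrier_defect lam (1 / 2) A1 B1 dA1 dB1 s y (W1_pos s _ Hyy)) as Hdef.
    pose proof (barrier_half_sqr A1 B1 s y (W1_pos s _ Hyy)) as Hsq.
    specialize (Hlo s _ Hyy).
    change (barrier (1 / 2) A1 B1 s y) with (lo s y) in *.
    rewrite Ropp_involutive, cutoff_id by (apply Rabs_le_between; nra).
    rewrite <- Hsq in Hlo.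
    pose proof (Rmult_le_compat_l (lo s y) _ _ (proj1 Hlh) Hlo) as Hp.
    unfold pow; nra.
- refine (solves_comparison lam Hlam0 T Hgen beta Hbeta M HM
    (fun t x z => - b t * cutoff M z ^ 3) t0 _ _ _ _ _ _ Hs Hcl2 _ _ _ _ _ t x Ht Hx).
  + intros s _; destruct (barrier_boundary (1 / 2) A2 B2 s) as [-> ->]; lra.
  + intros y Hy; apply (H0 y Hy).
  + intros s y _ _; reflexivity.
  + intros s y z z' _ _; now apply forcing_eval_lipschitz.
  + intros s y Hs' Hy.
    pose proof (sin_mul_self_bounds y) as Hyy.
    pose proof (lo_le_hi s y ltac:(lra)) as Hlh; pose proof (hi_le s y ltac:(lra)).
    pose proof (SIN_bound y).
    pose proof (barrier_defect lam (1 / 2) A2 B2 dA2 dB2 s y (W2_pos s _ Hyy)) as Hdef.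
    pose proof (barrier_half_sqr A2 B2 s y (W2_pos s _ Hyy)) as Hsq.
    specialize (Hhi s _ Hyy).
    change (barrier (1 / 2) A2 B2 s y) with (hi s y) in *.
    rewrite cutoff_id by (apply Rabs_le_between; nra).
    rewrite <- Hsq in Hhi.
    pose proof (Rmult_le_compat_l (hi s y) _ _ ltac:(lra) Hhi) as Hp.
    unfold pow; nra.
Qed.

Lemma psi_supersolution t x v : 0 <= x <= PI ->
  lo t x * lo t x <= v <= hi t x * hi t x ->
  kappa * psi t x <= barrier_t (3 / 2) A1 B1 dA1 dB1 t x - barrier_xx (3 / 2) A1 B1 t x
    - lam * psi t x + 3 * b t * v * psi t x.
Proof.
intros Hx Hv; pose proof (sin_mul_self_bounds x) as Hy.
unfold lo, hi in Hv; rewrite !barrier_half_sqr in Hv by (now apply W1_pos || now apply W2_pos).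
specialize (Hkey t _ v Hy Hv).
pose proof (barrier_defect lam (3 / 2) A1 B1 dA1 dB1 t x (W1_pos t _ Hy)) as Hdef.
change (barrier (3 / 2) A1 B1 t x) with (psi t x) in Hdef.
assert (0 <= psi t x) as Hpsi by now apply barrier_nonneg.
pose proof (Rmult_le_compat_r (psi t x) _ _ Hpsi Hkey); lra.
Qed.

Lemma trapped_difference_le t0 u v a : sol t0 u -> sol t0 v ->
  trapped t0 (u t0) -> trapped t0 (v t0) -> 0 <= a ->
  (forall x, 0 <= x <= PI -> u t0 x - v t0 x <= a * psi t0 x) ->
  forall t x, t0 <= t -> 0 <= x <= PI ->
    u t x - v t x <= a * exp (- kappa * (t - t0)) * psi t x.
Proof.
intros Hu Hv Hu0 Hv0 Ha H0 t x Ht Hx.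
pose proof (classical_barrier (3 / 2) A1 B1 dA1 dB1 HdA1 HdB1 W1_pos) as Hcl.
pose proof M_ge_1.
refine (solves_comparison lam Hlam0 T Hgen beta Hbeta M HM
  (fun t x z => - b t * (u t x * u t x + u t x * v t x + v t x * v t x) * z) t0 _ _ _ _ _ _
  (mild_minus T HT _ _ _ _ _ Hu Hv) (classical_decay _ _ _ _ a kappa t0 Hcl) _ _ _ _ _ t x Ht Hx).
- intros s _; destruct (barrier_boundary (3 / 2) A1 B1 s) as [-> ->]; lra.
- intros y Hy; rewrite Rminus_diag, Rmult_0_r, exp_0, Rmult_1_r; exact (H0 y Hy).
- intros s y Hs Hy.
  pose proof (trapped_abs s (u s) y (trapped_solves t0 u Hu Hu0 s ltac:(lra))).
  pose proof (trapped_abs s (v s) y (trapped_solves t0 v Hv Hv0 s ltac:(lra))).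
  simpl; rewrite !cutoff_id by lra; ring.
- intros s y z z' Hs Hy.
  pose proof (trapped_abs s (u s) y (trapped_solves t0 u Hu Hu0 s ltac:(lra))) as Hua.
  pose proof (trapped_abs s (v s) y (trapped_solves t0 v Hv Hv0 s ltac:(lra))) as Hva.
  apply Rabs_le_between in Hua; apply Rabs_le_between in Hva.
  set (p := u s y) in *; set (q := v s y) in *.
  replace (- b s * (p * p + p * q + q * q) * z - - b s * (p * p + p * q + q * q) * z')
    with (- b s * (p * p + p * q + q * q) * (z - z')) by ring.
  rewrite !Rabs_mult, Rabs_Ropp; apply Rmult_le_compat_r; [apply Rabs_pos|].
  apply Rmult_le_compat; try apply Rabs_pos; [apply Hb|].
  apply Rabs_le_between; split; nra.
- intros s y Hs Hy; assert (0 <= y <= PI) as Hy' by lra.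
  pose proof (trapped_solves t0 u Hu Hu0 s ltac:(lra) y Hy') as Hu1.
  pose proof (trapped_solves t0 v Hv Hv0 s ltac:(lra) y Hy') as Hv1.
  pose proof (lo_le_hi s y Hy') as Hlh.
  set (p := u s y) in *; set (q := v s y) in *.
  (* The difference of cubes is [(p^2 + p q + q^2) (p - q)]: the secant coefficient replaces the
     derivative [3 w^2], and a third of it still lies between the squared barriers. *)
  pose proof (psi_supersolution s y ((p * p + p * q + q * q) / 3) Hy' ltac:(split; nra)) as Hk.
  change (barrier (3 / 2) A1 B1 s y) with (psi s y) in *.
  assert (0 <= a * exp (- kappa * (s - t0))) as Hae.
  { apply Rmult_le_pos; [exact Ha | left; apply exp_pos]. }
  set (E := a * exp (- kappa * (s - t0))) in *.
  pose proof (Rmult_le_compat_l E _ _ Hae Hk); lra.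
Qed.

(** * Construction of the periodic orbit *)

Lemma barrier_periodic p A B t x n :
  (forall t, A (t + 1) = A t) -> (forall t, B (t + 1) = B t) ->
  barrier p A B (t + INR n) x = barrier p A B t x.
Proof.
intros HA HB; revert t; induction n as [|n IH]; intros t.
- simpl; now rewrite Rplus_0_r.
- rewrite S_INR; replace (t + (INR n + 1)) with ((t + INR n) + 1) by ring.
  rewrite <- (IH t); unfold barrier; now rewrite HA, HB.
Qed.

Lemma trapped_periodic t n u : trapped (t + INR n) u <-> trapped t u.
Proof.
unfold trapped, lo, hi.
split; intros H x Hx; specialize (H x Hx).
- now rewrite !barrier_periodic in H.
- now rewrite !barrier_periodic.
Qed.

Lemma b_periodic t n : b (t + INR n) = b t.
Proof.
induction n as [|n IH]; [simpl; now rewrite Rplus_0_r|].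
rewrite S_INR; replace (t + (INR n + 1)) with ((t + INR n) + 1) by ring; now rewrite Hbp.
Qed.

(** The lower barrier at time 0 serves as initial datum. *)
Lemma trapped_solution_exists :
  exists U, sol 0 U /\ trapped 0 (U 0) /\ forall t, t <= 0 -> U t = U 0.
Proof.
destruct (barrier_boundary (1 / 2) A1 B1 0) as [H0 HPI].
destruct (C0_of_continuous (lo 0)) as [F HF]; [| exact H0 | exact HPI |].
{ intros x; apply (ex_derive_continuous (lo 0)); eexists.
  apply (barrier_derive_x _ _ _ W1_pos). }
destruct (solves_exists lam Hlam0 T Hgen b beta Hb Hbeta Hbc M HM 0 F) as [U [HU HU0]].
exists U; split; [exact HU|]; split.
- intros x Hx; rewrite HU0, HF by lra.
  pose proof (lo_le_hi 0 x Hx); lra.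
- intros t Ht; rewrite !HU0 by lra; reflexivity.
Qed.

(** By periodicity of [b] and of the barriers, the translate of [U] by one period is a second
    trapped solution, and the two contract towards each other. *)
Lemma trapped_solution_step U : sol 0 U -> trapped 0 (U 0) -> (forall t, t <= 0 -> U t = U 0) ->
  exists D, forall t, norm (minus (U (t + 1)) (U t)) <= D * exp (- kappa * t).
Proof.
intros HU HU0 Hneg.
assert (Htr : forall t, 0 <= t -> trapped t (U t)) by now apply trapped_solves.
pose (V := fun s => U (s + 1)).
assert (HV : sol 0 V).
{ apply (solves_restart lam T Hgen b M HM (0 - 1)); [|lra].
  now apply (solves_shift lam T Hgen b M HM 0 U 1). }
assert (HV0 : trapped 0 (V 0)).
{ apply (trapped_periodic 0 1); simpl INR; unfold V; apply Htr; lra. }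
pose (a := (M - 1) / exp (- (3 / 2) * ln M0)).
pose proof M_ge_1 as HM1; pose proof (exp_pos (- (3 / 2) * ln M0)) as Hc0.
assert (0 <= a) as Ha by (unfold a; apply Rdiv_le_0_compat; lra).
assert (Hdiff : forall u v x, trapped 0 u -> trapped 0 v -> 0 <= x <= PI -> u x - v x <= a * psi 0 x).
{ intros u v x Hu Hv Hx; specialize (Hu x Hx); specialize (Hv x Hx).
  pose proof (lo_le_hi 0 x Hx); pose proof (hi_le 0 x Hx).
  destruct (psi_bounds 0 x Hx) as [Hp _].
  pose proof (Rmult_le_compat_l a _ _ Ha Hp) as Hap.
  replace (a * (exp (- (3 / 2) * ln M0) * sin x)) with ((M - 1) * sin x) in Hap
    by (unfold a; field; lra).
  lra. }
assert (0 <= psimax) as Hpm by (left; apply exp_pos).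
(* The term [2 * M] covers [t < 0], where contraction says nothing but [exp (- kappa * t) >= 1]. *)
exists (a * psimax + 2 * M); intros t.
destruct (Rle_lt_dec 0 t) as [Ht|Ht].
- apply Rle_trans with (a * psimax * exp (- kappa * t)).
  + apply C0_norm_le; intros x.
    pose proof (exp_pos (- kappa * t)) as He.
    destruct (classic (0 <= x <= PI)) as [Hx|Hx].
    * pose proof (trapped_difference_le 0 V U a HV HU HV0 HU0 Ha
        (fun x => Hdiff (V 0) (U 0) x HV0 HU0) t x Ht Hx) as H1.
      pose proof (trapped_difference_le 0 U V a HU HV HU0 HV0 Ha
        (fun x => Hdiff (U 0) (V 0) x HU0 HV0) t x Ht Hx) as H2.
      rewrite Rminus_0_r in H1, H2.
      destruct (psi_bounds t x Hx) as [_ Hp].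
      pose proof (Rmult_le_compat_l (a * exp (- kappa * t)) _ _ ltac:(nra) Hp) as Hap.
      unfold V in H1, H2; apply Rabs_le_between; simpl; split; lra.
    * rewrite C0_supp, Rabs_R0 by lra; apply Rmult_le_pos; [now apply Rmult_le_pos | lra].
  + apply Rmult_le_compat_r; [left; apply exp_pos | lra].
- assert (1 <= exp (- kappa * t)) as He.
  { rewrite <- exp_0; apply exp_le_compat; nra. }
  assert (Hn : forall s, norm (U s) <= M).
  { intros s; destruct (Rle_lt_dec 0 s) as [Hs|Hs].
    - apply (trapped_norm s), Htr, Hs.
    - rewrite Hneg by lra; now apply (trapped_norm 0). }
  pose proof (Hn (t + 1)) as H1; pose proof (Hn t) as H2.
  apply Rle_trans with (M + M).
  + eapply Rle_trans; [apply (norm_triangle (V := C0_NormedModule))|].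
    rewrite (norm_opp (V := C0_NormedModule)); now apply Rplus_le_compat.
  + assert (0 <= a * psimax) by now apply Rmult_le_pos.
    apply Rle_trans with ((a * psimax + 2 * M) * 1); [lra|].
    apply Rmult_le_compat_l; lra.
Qed.

Lemma exp_pow_INR x n : exp x ^ n = exp (x * INR n).
Proof.
induction n as [|n IH]; [simpl; now rewrite Rmult_0_r, exp_0|].
rewrite S_INR; simpl; rewrite IH, <- exp_plus; f_equal; ring.
Qed.

(** The translates [U (t + n)] make sense for every real [t] and converge by a factor
    [exp (- kappa)] per period. Continuity, Duhamel's formula and trapping pass to the limit because
    all errors are multiples of [q ^ n]. *)
Lemma periodic_solution_exists : exists ustar,
  (forall t, ustar (t + 1) = ustar t) /\ (forall t0, sol t0 ustar) /\
  forall t, trapped t (ustar t).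
Proof.
destruct trapped_solution_exists as [U [HU [HU0 Hneg]]].
destruct (trapped_solution_step U HU HU0 Hneg) as [D HD].
assert (Htr : forall t, 0 <= t -> trapped t (U t)) by now apply trapped_solves.
pose (q := exp (- kappa)).
assert (Hq : 0 <= q < 1).
{ unfold q; split; [left; apply exp_pos|]; rewrite <- exp_0; apply exp_increasing; lra. }
assert (Hlim : forall t, exists l : C0, forall n,
  norm (minus l (U (t + INR n))) <= D * exp (- kappa * t) / (1 - q) * q ^ n).
{ intros t; apply (C0_geometric_limit (fun n => U (t + INR n)) (D * exp (- kappa * t)) q Hq).
  intros n; rewrite S_INR; replace (t + (INR n + 1)) with ((t + INR n) + 1) by ring.
  eapply Rle_trans; [apply HD|]; right.
  unfold q; rewrite exp_pow_INR, Rmult_assoc, <- exp_plus; do 2 f_equal; ring. }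
apply choice in Hlim; destruct Hlim as [ustar Hstar].
assert (HD0 : 0 <= D).
{ specialize (HD 0); rewrite Rmult_0_r, exp_0, Rmult_1_r in HD.
  eapply Rle_trans; [apply (norm_ge_0 (V := C0_NormedModule)) | exact HD]. }
pose (C := fun t => D * exp (- kappa * t) / (1 - q)).
assert (HC : forall s t, s <= t -> 0 <= C t <= C s).
{ intros s t Hst; unfold C; split.
  - apply Rdiv_le_0_compat; [|lra]; apply Rmult_le_pos; [exact HD0 | left; apply exp_pos].
  - unfold Rdiv; apply Rmult_le_compat_r; [left; apply Rinv_0_lt_compat; lra|].
    apply Rmult_le_compat_l; [exact HD0|]; apply exp_le_compat; nra. }
assert (HUn : forall n t, norm (minus (ustar t) (U (t + INR n))) <= C t * q ^ n).
{ intros n t; apply Hstar. }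
clearbody C; clear Hstar HD.
assert (Hqn : forall n, 0 <= q ^ n) by (intros; apply pow_le; lra).
assert (Huc : forall t, continuous ustar t).
{ intros t; apply continuous_C0P; intros eps He.
  destruct (HC (t - 1) t ltac:(lra)) as [HC1 HC2].
  destruct (pow_lt_1_zero q) with (y := eps / 3 / (C (t - 1) + 1)) as [n Hn].
  { rewrite Rabs_pos_eq; lra. }
  { repeat apply Rdiv_lt_0_compat; lra. }
  specialize (Hn n (le_n n)); rewrite Rabs_pos_eq in Hn by apply Hqn.
  assert (C (t - 1) * q ^ n <= eps / 3) as HBn.
  { replace (eps / 3) with ((C (t - 1) + 1) * (eps / 3 / (C (t - 1) + 1))) by (field; lra).
    apply Rmult_le_compat; [lra | apply Hqn | lra | lra]. }
  pose proof (mild_shift T HT _ 0 U (INR n) HU) as [Hsh _].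
  destruct (proj1 (continuous_C0P _ t) (Hsh t) (eps / 3)) as [d [Hd Hd']]; [lra|].
  exists (Rmin 1 d); split; [apply Rmin_glb_lt; lra|]; intros s Hs.
  pose proof (Rmin_l 1 d); pose proof (Rmin_r 1 d).
  specialize (Hd' s ltac:(lra)); apply Rabs_def2 in Hs.
  pose proof (HUn n s) as H1; pose proof (HUn n t) as H2; rewrite norm_minus_sym in H2.
  destruct (HC (t - 1) s ltac:(lra)) as [HC3 HC4].
  pose proof (Rmult_le_compat_r (q ^ n) _ _ (Hqn n) HC4).
  pose proof (Rmult_le_compat_r (q ^ n) _ _ (Hqn n) HC2).
  pose proof (norm_minus_triangle (ustar s) (U (s + INR n)) (ustar t)).
  pose proof (norm_minus_triangle (U (s + INR n)) (U (t + INR n)) (ustar t)).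
  simpl in Hd'; lra. }
assert (Hlarge : forall t, exists N, 0 <= t + INR N).
{ intros t; destruct (INR_unbounded (- t)) as [N HN]; exists N; lra. }
exists ustar; split; [|split].
- intros t; apply norm_minus_eq0.
  apply (le_0_of_geometric q _ (C (t + 1) + C t) Hq); intros n.
  pose proof (HUn n (t + 1)) as H1; pose proof (HUn (S n) t) as H2.
  rewrite S_INR in H2; replace (t + (INR n + 1)) with (t + 1 + INR n) in H2 by ring.
  rewrite norm_minus_sym in H2; simpl pow in H2.
  destruct (HC t t ltac:(lra)) as [HCt _].
  assert (C t * (q * q ^ n) <= C t * (1 * q ^ n)).
  { apply Rmult_le_compat_l; [exact HCt|]; apply Rmult_le_compat_r; [apply Hqn | lra]. }
  pose proof (norm_minus_triangle (ustar (t + 1)) (U (t + 1 + INR n)) (ustar t)); lra.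
- intros t0; split; [exact Huc|]; split; [intros s; now apply forcing_continuous|].
  intros t Ht; apply norm_minus_eq0.
  (* [U] is a solution only from time 0 on; after [N] periods its translate is one from [t0] on. *)
  destruct (Hlarge t0) as [N HN].
  pose (E := exp (lam * (t - t0))).
  assert (0 < E) as HE by apply exp_pos.
  assert (HF : forall s f, t0 <= s <= t -> norm (forward T (t - s) f) <= E * norm f).
  { intros s f Hs; eapply Rle_trans; [apply (forward_norm_le lam Hlam0 T Hgen); lra|].
    apply Rmult_le_compat_r; [apply (norm_ge_0 (V := C0_NormedModule))|].
    apply exp_le_compat; nra. }
  pose proof (Lip_pos beta Hbeta M HM) as HLip; fold Lip in HLip.
  apply (le_0_of_geometric q _ (C t0 * (1 + E + (t - t0) * (E * Lip))) Hq); intros n.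
  set (k := (n + N)%nat).
  assert (Hqk : q ^ k <= q ^ n).
  { unfold k; rewrite Nat.add_comm, pow_add.
    assert (q ^ N <= 1) by (rewrite <- (pow1 N); apply pow_incr; lra).
    rewrite <- (Rmult_1_l (q ^ n)) at 2; apply Rmult_le_compat_r; [apply Hqn | assumption]. }
  assert (HUk : forall s, t0 <= s -> norm (minus (ustar s) (U (s + INR k))) <= C t0 * q ^ n).
  { intros s Hs; eapply Rle_trans; [apply HUn|]; destruct (HC t0 s Hs) as [H1 H2].
    apply Rmult_le_compat; [exact H1 | apply Hqn | exact H2 | exact Hqk]. }
  assert (Hk : sol t0 (fun s => U (s + INR k))).
  { apply (solves_restart lam T Hgen b M HM (0 - INR k)).
    - apply (solves_shift lam T Hgen b M HM 0 U (INR k)); [|exact HU].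
      intros s; apply b_periodic.
    - unfold k; rewrite plus_INR; pose proof (pos_INR n); lra. }
  assert (Hw : norm (RInt (fun s => forward T (t - s)
    (minus (forcing b M HM s (ustar s)) (forcing b M HM s (U (s + INR k))))) t0 t)
    <= (t - t0) * (E * (Lip * (C t0 * q ^ n)))).
  { apply norm_RInt_C0_le_const; [exact Ht | |].
    - intros s; apply duhamel_continuous; [exact HT|]; intros r.
      apply continuous_C0_minus; apply forcing_continuous; try exact Hbc; [exact Huc|].
      apply Hk.
    - intros s Hs; eapply Rle_trans; [now apply HF|]; apply Rmult_le_compat_l; [lra|].
      eapply Rle_trans; [apply (forcing_lipschitz b beta Hb Hbeta M HM)|].
      apply Rmult_le_compat_l; [left; exact HLip | apply HUk; lra]. }
  assert (Hc2 : forall (v : R -> C0), (forall s, continuous v s) -> forall s,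
    continuous (fun s => forward T (t - s) (forcing b M HM s (v s))) s).
  { intros v Hv s; apply duhamel_continuous; [exact HT|]; intros r; now apply forcing_continuous. }
  rewrite (RInt_ext (V := C0_CompleteNormedModule) _ (fun s => minus
    (forward T (t - s) (forcing b M HM s (ustar s)))
    (forward T (t - s) (forcing b M HM s (U (s + INR k)))))) in Hw
    by (intros s _; apply linear_C0_minus; apply (forward_linear T HT)).
  rewrite RInt_C0_minus in Hw by (apply Hc2; [exact Huc || apply Hk]).
  pose proof (proj2 (proj2 Hk) t Ht) as Ek; cbv beta in Ek.
  pose proof (HUk t Ht) as H1.
  pose proof (HF t0 (minus (ustar t0) (U (t0 + INR k))) ltac:(lra)) as H2.
  rewrite linear_C0_minus in H2 by apply (forward_linear T HT).
  pose proof (HUk t0 (Rle_refl t0)) as H3.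
  assert (E * norm (minus (ustar t0) (U (t0 + INR k))) <= E * (C t0 * q ^ n)) as H4
    by (apply Rmult_le_compat_l; lra).
  revert Hw H1 H2; rewrite Ek.
  generalize (RInt (fun s => forward T (t - s) (forcing b M HM s (ustar s))) t0 t) as J1,
    (RInt (fun s => forward T (t - s) (forcing b M HM s (U (s + INR k)))) t0 t) as J2.
  intros J1 J2 Hw H1 H2.
  change (C0_CompleteNormedModule : Type) with C0 in J1, J2.
  pose proof (norm_minus_triangle (ustar t) (plus (forward T (t - t0) (U (t0 + INR k))) J2)
    (plus (forward T (t - t0) (ustar t0)) J1)) as H5.
  assert (norm (minus (plus (forward T (t - t0) (U (t0 + INR k))) J2)
    (plus (forward T (t - t0) (ustar t0)) J1)) <=
    norm (minus (forward T (t - t0) (ustar t0)) (forward T (t - t0) (U (t0 + INR k)))) +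
    norm (minus J1 J2)) as H6.
  { rewrite norm_minus_sym.
    replace (minus (plus (forward T (t - t0) (ustar t0)) J1)
      (plus (forward T (t - t0) (U (t0 + INR k))) J2)) with
      (plus (minus (forward T (t - t0) (ustar t0)) (forward T (t - t0) (U (t0 + INR k))))
        (minus J1 J2)) by C0_ring.
    apply (norm_triangle (V := C0_NormedModule)). }
  eapply Rle_trans; [exact H5|].
  apply Rle_trans with (C t0 * q ^ n + (E * (C t0 * q ^ n) + (t - t0) * (E * (Lip * (C t0 * q ^ n))))).
  + apply Rplus_le_compat; [exact H1|]; eapply Rle_trans; [exact H6|].
    apply Rplus_le_compat; [eapply Rle_trans; [exact H2 | exact H4] | exact Hw].
  + right; ring.
- intros t x Hx; destruct (Hlarge t) as [N HN].
  assert (Hn : forall n, lo t x <= U (t + INR (n + N)) x <= hi t x).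
  { intros n; apply (trapped_periodic t (n + N)); [|exact Hx]; apply Htr.
    rewrite plus_INR; pose proof (pos_INR n); lra. }
  assert (He : forall n, Rabs (ustar t x - U (t + INR (n + N)) x) <= C t * q ^ n).
  { intros n; eapply Rle_trans; [apply C0_eval_le|]; eapply Rle_trans; [apply HUn|].
    apply Rmult_le_compat_l; [apply (HC t t); lra|].
    rewrite pow_add; rewrite <- (Rmult_1_r (q ^ n)) at 2.
    apply Rmult_le_compat_l; [apply Hqn|]; rewrite <- (pow1 N); apply pow_incr; lra. }
  split.
  + enough (lo t x - ustar t x <= 0) by lra.
    apply (le_0_of_geometric q _ (C t) Hq); intros n.
    specialize (Hn n); specialize (He n); apply Rabs_le_between in He; lra.
  + enough (ustar t x - hi t x <= 0) by lra.
    apply (le_0_of_geometric q _ (C t) Hq); intros n.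
    specialize (Hn n); specialize (He n); apply Rabs_le_between in He; lra.
Qed.

(** * Stability under small perturbations in the sup norm *)

Definition perturbation (eta t x : R) : R := psi t x + eta * (1 + lam * (x * (PI - x))).

(* Near the boundary, where [psi] degenerates, the concave parabola absorbs the
   term [lam] of the equation; away from it, [kappa * psi] dominates. *)
Lemma perturbation_constants : exists eta mu, 0 < eta /\ 0 < mu /\
  forall t x w, 0 < x < PI -> lo t x <= w <= hi t x ->
    mu * perturbation eta t x - 3 * b t * w ^ 2 * perturbation eta t x <=
    barrier_t (3 / 2) A1 B1 dA1 dB1 t x -
    (barrier_xx (3 / 2) A1 B1 t x - eta * (2 * lam)) - lam * perturbation eta t x.
Proof.
pose (c0 := exp (- (3 / 2) * ln M0)).
assert (0 < c0) as Hc0 by apply exp_pos.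
(* With [e = x (pi - x)], the linear operator applied to the parabola leaves
   [eta * lam - eta * lam^2 * e], and the term in [b] costs at most the second summand times
   [eta * e] because [w^2 <= e / m]. [C4] collects the unfavourable coefficients. *)
pose (C4 := lam ^ 2 + 3 * beta * (1 + 4 * lam) / m).
assert (0 < 3 * beta * (1 + 4 * lam) / m) as HC.
{ apply Rdiv_lt_0_compat; [|exact Hm]; nra. }
assert (0 < C4) as HC4 by (unfold C4; pose proof (pow2_ge_0 lam); lra).
(* [eta * C4 * e] must stay below half of [kappa * psi], and [psi >= c0 * sin x >= c0 * e / 5];
   hence the 10. *)
pose (eta := kappa * c0 / (10 * C4)).
assert (0 < eta) as Heta by (unfold eta; apply Rdiv_lt_0_compat; nra).
assert (eta * C4 = kappa * c0 / 10) as Eeta by (unfold eta; field; lra).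
(* The other half of [kappa * psi] pays for [mu * psi], and [eta * lam] pays for
   [mu * eta * (1 + lam * e)], since [e <= 4]. *)
pose (mu := Rmin (kappa / 2) (lam / (1 + 4 * lam))).
assert (0 < lam / (1 + 4 * lam)) as Hq by (apply Rdiv_lt_0_compat; lra).
assert (0 < mu) as Hmu by (unfold mu; apply Rmin_glb_lt; lra).
exists eta, mu; split; [exact Heta|]; split; [exact Hmu|].
intros t x w Hx Hw; assert (0 <= x <= PI) as Hx' by lra.
pose proof (lo_le_hi t x Hx') as Hlh.
assert (lo t x * lo t x <= w ^ 2 <= hi t x * hi t x) as Hw2 by (split; nra).
pose proof (psi_supersolution t x (w ^ 2) Hx' Hw2) as Hsup.
destruct (psi_bounds t x Hx') as [Hpsi _]; fold c0 in Hpsi.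
pose proof (sin_ge_parabola x Hx') as Hsin.
pose proof (sin_sqr_le_parabola x Hx') as Hsin2.
pose proof (sin_mul_self_bounds x) as Hy.
assert (0 <= x * (PI - x) <= 4) as He.
{ pose proof PI_4; split; [apply Rmult_le_pos; lra|].
  pose proof (Rle_0_sqr (x - PI / 2)) as Hsq; unfold Rsqr in Hsq; nra. }
unfold perturbation; set (e := x * (PI - x)) in *; set (ps := psi t x) in *.
assert (w ^ 2 <= e / m) as Hwe.
{ eapply Rle_trans; [apply Hw2|].
  unfold hi; rewrite barrier_half_sqr by now apply W2_pos.
  pose proof (HW2 t _ Hy) as HWm.
  unfold Rdiv; apply Rmult_le_compat; [lra | left; apply Rinv_0_lt_compat; lra | exact Hsin2 |].
  now apply Rinv_le_contravar. }
assert (0 <= e / m) as Hem by (apply Rdiv_le_0_compat; lra).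
assert (- (3 * b t * w ^ 2 * (1 + lam * e)) <= 3 * beta * (1 + 4 * lam) / m * e) as Hbad.
{ pose proof (Hb t) as Hbt; apply Rabs_le_between in Hbt.
  pose proof (pow2_ge_0 w) as Hw0.
  assert (1 <= 1 + lam * e <= 1 + 4 * lam) as Hle by (split; nra).
  apply Rle_trans with (3 * beta * w ^ 2 * (1 + lam * e)).
  - assert (0 <= w ^ 2 * (1 + lam * e)) by (apply Rmult_le_pos; lra); nra.
  - replace (3 * beta * (1 + 4 * lam) / m * e) with (3 * beta * (e / m) * (1 + 4 * lam))
      by (field; lra).
    apply Rmult_le_compat; [| lra | | lra].
    + apply Rmult_le_pos; lra.
    + apply Rmult_le_compat_l; lra. }
assert (kappa * c0 * e / 10 <= kappa / 2 * ps) as Hk1.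
{ assert (c0 * (e / 5) <= c0 * sin x) by (apply Rmult_le_compat_l; lra).
  assert (kappa * (c0 * (e / 5)) <= kappa * ps) by (apply Rmult_le_compat_l; lra); lra. }
assert (mu <= kappa / 2 /\ mu * (1 + 4 * lam) <= lam) as [Hmu1 Hmu2].
{ split; [apply Rmin_l|].
  replace lam with (lam / (1 + 4 * lam) * (1 + 4 * lam)) at 2 by (field; lra).
  apply Rmult_le_compat_r; [lra | apply Rmin_r]. }
assert (0 <= ps) as Hps by now apply barrier_nonneg.
assert (mu * (ps + eta * (1 + lam * e)) <= kappa / 2 * ps + eta * lam) as HPhi.
{ assert (mu * ps <= kappa / 2 * ps) by (apply Rmult_le_compat_r; lra).
  assert (mu * (1 + lam * e) <= lam).
  { eapply Rle_trans; [|exact Hmu2]; apply Rmult_le_compat_l; [lra|]; nra. }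
  assert (eta * (mu * (1 + lam * e)) <= eta * lam) by (apply Rmult_le_compat_l; lra); lra. }
pose proof (Rmult_le_compat_l eta _ _ (Rlt_le _ _ Heta) Hbad) as Hbad'.
assert (eta * (3 * beta * (1 + 4 * lam) / m * e) = kappa * c0 * e / 10 - eta * lam ^ 2 * e) as HE.
{ replace (kappa * c0 * e / 10) with (eta * C4 * e) by (rewrite Eeta; field).
  unfold C4; ring. }
rewrite HE in Hbad'; nra.
Qed.

(** [perturbation] lies between [eta] and [Pmax], so its decaying multiples are equivalent to the
    sup norm; this produces [D = Pmax / eta]. Half of the rate [mu] is spent on the quadratic and
    cubic terms of the difference. *)
Lemma perturbation_exists ustar :
  (forall t0, sol t0 ustar) -> (forall t, trapped t (ustar t)) ->
  exists delta D k, 0 < delta /\ 0 < D /\ 0 < k /\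
  forall t0 u0, norm (minus (ustar t0) u0) <= delta ->
  exists u, sol t0 u /\ u t0 = u0 /\ (forall t x, t0 <= t -> Rabs (u t x) <= M) /\
  forall t, t0 <= t ->
    norm (minus (ustar t) (u t)) <= D * exp (- k * (t - t0)) * norm (minus (ustar t0) u0).
Proof.
intros Hsol Htr.
destruct perturbation_constants as [eta [mu [Heta [Hmu Hsup]]]].
pose proof M_ge_1 as HM1.
assert (0 < beta * (3 * M + 1)) as HbM by (apply Rmult_lt_0_compat; lra).
(* For [P <= rho <= 1] the remainder [3 w r P + P^3] is at most [(3 * M + 1) * rho * P] in modulus,
   which costs at most the rate [mu / 2]. The bound 1 also keeps [ustar] plus or minus [P] within
   the truncation. *)
pose (rho := Rmin 1 (mu / 2 / (beta * (3 * M + 1)))).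
assert (0 < rho) as Hrho.
{ unfold rho; apply Rmin_glb_lt; [lra|]; repeat apply Rdiv_lt_0_compat; lra. }
assert (rho <= 1) as Hrho1 by apply Rmin_l.
assert (beta * (3 * M + 1) * rho <= mu / 2) as Hrho2.
{ replace (mu / 2) with (beta * (3 * M + 1) * (mu / 2 / (beta * (3 * M + 1)))) by (field; lra).
  apply Rmult_le_compat_l; [lra | apply Rmin_r]. }
clearbody rho.
pose (Pmax := psimax + eta * (1 + 4 * lam)).
assert (0 < psimax) as Hpsimax by apply exp_pos.
assert (0 < Pmax) as HPmax by (unfold Pmax; nra).
assert (HPhi : forall t x, 0 <= x <= PI -> eta <= perturbation eta t x <= Pmax).
{ intros t x Hx; destruct (psi_bounds t x Hx) as [_ Hp].
  assert (0 <= psi t x) by now apply barrier_nonneg.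
  assert (0 <= x * (PI - x) <= 4) as He.
  { pose proof PI_4; split; [apply Rmult_le_pos; lra|].
    pose proof (Rle_0_sqr (x - PI / 2)) as Hsq; unfold Rsqr in Hsq; nra. }
  unfold perturbation, Pmax.
  assert (1 <= 1 + lam * (x * (PI - x)) <= 1 + 4 * lam) by (split; nra).
  split; nra. }
exists (eta * rho / Pmax), (Pmax / eta), (mu / 2).
split; [apply Rdiv_lt_0_compat; nra|]; split; [apply Rdiv_lt_0_compat; lra|]; split; [lra|].
intros t0 u0 Hd.
destruct (solves_exists lam Hlam0 T Hgen b beta Hb Hbeta Hbc M HM t0 u0) as [u [Hu Hu0]].
specialize (Hu0 t0 (Rle_refl t0)).
set (nd := norm (minus (ustar t0) u0)) in *.
assert (0 <= nd) as Hnd by apply (norm_ge_0 (V := C0_NormedModule)).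
pose (a := nd / eta).
assert (0 <= a) as Ha by (unfold a; apply Rdiv_le_0_compat; lra).
assert (a * eta = nd) as Ea by (unfold a; field; lra).
assert (a * Pmax <= rho) as HaP.
{ apply Rmult_le_compat_r with (r := Pmax / eta) in Hd; [|apply Rdiv_le_0_compat; lra].
  replace (eta * rho / Pmax * (Pmax / eta)) with rho in Hd by (field; lra).
  unfold a; replace (nd / eta * Pmax) with (nd * (Pmax / eta)) by (field; lra); exact Hd. }
pose (Psi := fun t x => a * exp (- (mu / 2) * (t - t0)) * perturbation eta t x).
assert (Hexp : forall t, t0 <= t -> 0 < exp (- (mu / 2) * (t - t0)) <= 1).
{ intros t Ht; split; [apply exp_pos|]; rewrite <- exp_0; apply exp_le_compat; nra. }
assert (HPsi : forall t x, t0 <= t -> 0 <= x <= PI -> 0 <= Psi t x <= rho).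
{ intros t x Ht Hx; specialize (Hexp t Ht); specialize (HPhi t x Hx); unfold Psi; split.
  - apply Rmult_le_pos; [apply Rmult_le_pos; lra | lra].
  - apply Rle_trans with (a * 1 * Pmax); [|lra].
    apply Rmult_le_compat; try lra.
    + apply Rmult_le_pos; lra.
    + apply Rmult_le_compat_l; lra. }
pose proof (classical_barrier (3 / 2) A1 B1 dA1 dB1 HdA1 HdB1 W1_pos) as Hcl.
pose proof (classical_decay _ _ _ _ a (mu / 2) t0
  (classical_add_parabola _ _ _ _ eta lam Hcl)) as HclPsi.
(* With [w = ustar] and [P = Psi], the case [r = P] expands [(w + P)^3 - w^3], the case [r = - P]
   expands [w^3 - (w - P)^3]. *)
assert (Hineq : forall t x r, t0 < t -> 0 < x < PI -> r = Psi t x \/ r = - Psi t x ->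
  - b t * (3 * ustar t x ^ 2 * Psi t x + 3 * ustar t x * r * Psi t x + Psi t x ^ 3) <=
  a * exp (- (mu / 2) * (t - t0)) *
    (barrier_t (3 / 2) A1 B1 dA1 dB1 t x - mu / 2 * perturbation eta t x) -
  a * exp (- (mu / 2) * (t - t0)) * (barrier_xx (3 / 2) A1 B1 t x - eta * (2 * lam)) -
  lam * Psi t x).
{ intros t x r Ht Hx Hr; assert (0 <= x <= PI) as Hx' by lra.
  specialize (Hsup t x (ustar t x) Hx (Htr t x Hx')).
  pose proof (HPsi t x (Rlt_le _ _ Ht) Hx') as HP.
  pose proof (trapped_abs t (ustar t) x (Htr t)) as Hw.
  assert (0 <= a * exp (- (mu / 2) * (t - t0))) as HE.
  { apply Rmult_le_pos; [exact Ha | specialize (Hexp t); lra]. }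
  pose proof (Rmult_le_compat_l _ _ _ HE Hsup) as Hs.
  unfold Psi in *; set (E := a * exp (- (mu / 2) * (t - t0))) in *.
  set (Ph := perturbation eta t x) in *; set (w := ustar t x) in *.
  assert (- b t * (3 * w * r * (E * Ph) + (E * Ph) ^ 3) <= mu / 2 * (E * Ph)) as Hrest.
  { set (P := E * Ph) in *.
    replace (- b t * (3 * w * r * P + P ^ 3)) with (- (b t * (3 * w * r + P * P)) * P) by ring.
    apply Rmult_le_compat_r; [lra|].
    eapply Rle_trans; [apply Rle_abs|].
    rewrite Rabs_Ropp, Rabs_mult.
    apply Rle_trans with (beta * ((3 * M + 1) * rho)); [|lra].
    apply Rmult_le_compat; try apply Rabs_pos; [apply Hb|].
    apply Rabs_le_between in Hw; apply Rabs_le_between.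
    assert (P * P <= rho) by nra; assert (0 <= P * P) by nra.
    assert (- (M * rho) <= w * r <= M * rho) by (destruct Hr as [-> | ->]; split; nra).
    split; lra. }
  replace (- b t * (3 * w ^ 2 * (E * Ph) + 3 * w * r * (E * Ph) + (E * Ph) ^ 3)) with
    (- (3 * b t * w ^ 2 * (E * Ph)) + - b t * (3 * w * r * (E * Ph) + (E * Ph) ^ 3)) by ring.
  lra. }
assert (Hcut : forall t x r, t0 < t -> 0 < x < PI -> r = Psi t x \/ r = - Psi t x ->
  cutoff M (ustar t x + r) = ustar t x + r).
{ intros t x r Ht Hx Hr; apply cutoff_id.
  pose proof (HPsi t x (Rlt_le _ _ Ht) ltac:(lra)) as HP.
  pose proof (trapped_abs t (ustar t) x (Htr t)) as Hw; apply Rabs_le_between in Hw.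
  apply Rabs_le_between; destruct Hr as [-> | ->]; lra. }
assert (Hcut0 : forall t x, cutoff M (ustar t x) = ustar t x).
{ intros t x; apply cutoff_id; pose proof (trapped_abs t (ustar t) x (Htr t)); lra. }
assert (Hinit : forall x, Rabs (ustar t0 x - u0 x) <= nd) by (intros x; apply C0_eval_le).
assert (HPsi0 : forall x, 0 <= x <= PI -> nd <= Psi t0 x).
{ intros x Hx; unfold Psi; rewrite Rminus_diag, Rmult_0_r, exp_0, Rmult_1_r, <- Ea.
  apply Rmult_le_compat_l; [exact Ha | apply HPhi, Hx]. }
assert (Hbdry : forall t, t0 <= t -> 0 <= Psi t 0 /\ 0 <= Psi t PI).
{ intros t Ht; pose proof PI_RGT_0; split; apply HPsi; lra. }
assert (Hup : forall t x, t0 <= t -> 0 <= x <= PI -> u t x - ustar t x <= Psi t x).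
{ intros t x Ht Hx.
  refine (solves_comparison lam Hlam0 T Hgen beta Hbeta M HM
    (fun t x z => - b t * cutoff M (ustar t x + z) ^ 3 - - b t * cutoff M (ustar t x) ^ 3)
    t0 _ _ _ _ _ _ (mild_minus T HT _ _ _ _ _ Hu (Hsol t0)) HclPsi Hbdry _ _ _ _ t x Ht Hx).
  - intros y Hy; specialize (Hinit y); apply Rabs_le_between in Hinit.
    specialize (HPsi0 y Hy); change (u t0 y - ustar t0 y <= Psi t0 y); rewrite Hu0; lra.
  - intros s y _ _; simpl.
    replace (ustar s y + (u s y + - ustar s y)) with (u s y) by ring; ring.
  - intros s y z z' _ _.
    replace (- b s * cutoff M (ustar s y + z) ^ 3 - - b s * cutoff M (ustar s y) ^ 3 -
      (- b s * cutoff M (ustar s y + z') ^ 3 - - b s * cutoff M (ustar s y) ^ 3)) with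
      (- b s * cutoff M (ustar s y + z) ^ 3 - - b s * cutoff M (ustar s y + z') ^ 3) by ring.
    replace (z - z') with (ustar s y + z - (ustar s y + z')) by ring.
    now apply forcing_eval_lipschitz.
  - intros s y Hs Hy.
    pose proof (Hineq s y _ Hs Hy (or_introl eq_refl)) as Hi.
    pose proof (Hcut s y _ Hs Hy (or_introl eq_refl)) as Hc.
    refine (Rle_trans (- b s * cutoff M (ustar s y + Psi s y) ^ 3 - - b s * cutoff M (ustar s y) ^ 3) _ _ _ Hi).
    rewrite Hc, Hcut0; right; ring. }
assert (Hdown : forall t x, t0 <= t -> 0 <= x <= PI -> ustar t x - u t x <= Psi t x).
{ intros t x Ht Hx.
  refine (solves_comparison lam Hlam0 T Hgen beta Hbeta M HM
    (fun t x z => - b t * cutoff M (ustar t x) ^ 3 - - b t * cutoff M (ustar t x + - z) ^ 3)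
    t0 _ _ _ _ _ _ (mild_minus T HT _ _ _ _ _ (Hsol t0) Hu) HclPsi Hbdry _ _ _ _ t x Ht Hx).
  - intros y Hy; specialize (Hinit y); apply Rabs_le_between in Hinit.
    specialize (HPsi0 y Hy); change (ustar t0 y - u t0 y <= Psi t0 y); rewrite Hu0; lra.
  - intros s y _ _; simpl.
    replace (ustar s y + - (ustar s y + - u s y)) with (u s y) by ring; ring.
  - intros s y z z' _ _.
    replace (- b s * cutoff M (ustar s y) ^ 3 - - b s * cutoff M (ustar s y + - z) ^ 3 -
      (- b s * cutoff M (ustar s y) ^ 3 - - b s * cutoff M (ustar s y + - z') ^ 3)) with
      (- b s * cutoff M (ustar s y + - z') ^ 3 - - b s * cutoff M (ustar s y + - z) ^ 3) by ring.
    replace (z - z') with (ustar s y + - z' - (ustar s y + - z)) by ring.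
    now apply forcing_eval_lipschitz.
  - intros s y Hs Hy.
    pose proof (Hineq s y _ Hs Hy (or_intror eq_refl)) as Hi.
    pose proof (Hcut s y _ Hs Hy (or_intror eq_refl)) as Hc.
    refine (Rle_trans (- b s * cutoff M (ustar s y) ^ 3 - - b s * cutoff M (ustar s y + - Psi s y) ^ 3) _ _ _ Hi).
    rewrite Hc, Hcut0; right; ring. }
assert (Hdiff : forall t x, t0 <= t -> Rabs (ustar t x - u t x) <= a * exp (- (mu / 2) * (t - t0)) * Pmax).
{ intros t x Ht; pose proof (Hexp t Ht).
  assert (0 <= a * exp (- (mu / 2) * (t - t0))) as HE by (apply Rmult_le_pos; lra).
  destruct (classic (0 <= x <= PI)) as [Hx|Hx].
  - specialize (Hup t x Ht Hx); specialize (Hdown t x Ht Hx).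
    assert (Psi t x <= a * exp (- (mu / 2) * (t - t0)) * Pmax).
    { unfold Psi; apply Rmult_le_compat_l; [exact HE | apply HPhi, Hx]. }
    apply Rabs_le_between; lra.
  - rewrite !C0_supp, Rminus_diag, Rabs_R0 by lra; apply Rmult_le_pos; lra. }
exists u; split; [exact Hu|]; split; [exact Hu0|]; split.
- intros t x Ht; specialize (Hdiff t x Ht); pose proof (Hexp t Ht).
  pose proof (trapped_abs t (ustar t) x (Htr t)) as Hw.
  assert (a * exp (- (mu / 2) * (t - t0)) * Pmax <= 1).
  { apply Rle_trans with (a * 1 * Pmax); [|lra].
    apply Rmult_le_compat_r; [lra|]; apply Rmult_le_compat_l; lra. }
  apply Rabs_le_between in Hw; apply Rabs_le_between in Hdiff; apply Rabs_le_between; lra.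
- intros t Ht; apply C0_norm_le; intros x; specialize (Hdiff t x Ht).
  replace (Pmax / eta * exp (- (mu / 2) * (t - t0)) * nd) with
    (a * exp (- (mu / 2) * (t - t0)) * Pmax) by (unfold a; field; lra).
  exact Hdiff.
Qed.

Lemma stable_periodic_orbit_exists : has_stable_periodic_orbit T b.
Proof.
destruct periodic_solution_exists as [ustar [Hper [Hsol Htr]]].
exists ustar; split.
- split; [exact Hper|]; intros t0; apply (solves_is_solution lam T Hgen b M HM); [apply Hsol|].
  intros t x _; pose proof (trapped_abs t (ustar t) x (Htr t)); lra.
- destruct (perturbation_exists ustar Hsol Htr) as [delta [D [k [Hdelta [HD [Hk H]]]]]].
  exists delta, D, k; split; [exact Hdelta|]; split; [exact HD|]; split; [exact Hk|].
  intros t0 u0 Hd; destruct (H t0 u0 Hd) as [u [Hu [Hu0 [Hbd Hdecay]]]].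
  exists u; split.
  + rewrite <- Hu0; now apply (solves_is_solution lam T Hgen b M HM).
  + rewrite Hu0; exact Hdecay.
Qed.

End Orbit.

(** * The three parameter sets *)

(** Taylor bounds of the sine around [pi / 6], where it equals 1/2, are inverted by monotonicity.
    The precision is needed because the residuals of the rounded profiles leave margins of only a
    few thousandths. *)
Lemma PI_bounds : 31415 / 10000 < PI < 3142 / 1000.
Proof.
pose proof PI2_3_2 as H3; pose proof PI_4 as H4.
split.
- destruct (sin_bound (31415 / 60000) 0) as [_ H]; [lra | lra |].
  unfold sin_approx, sin_term in H; simpl in H.
  assert (sin (31415 / 60000) < sin (PI / 6)) as Hs by (rewrite sin_PI6; lra).
  apply sin_increasing_0 in Hs; lra.
- destruct (sin_bound (3142 / 6000) 1) as [H _]; [lra | lra |].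
  unfold sin_approx, sin_term in H; simpl in H.
  assert (sin (PI / 6) < sin (3142 / 6000)) as Hs by (rewrite sin_PI6; lra).
  apply sin_increasing_0 in Hs; lra.
Qed.

(** As [b] has a single harmonic, so have the periodic solutions of the linear system for [A] and
    [B]. *)
Definition trig (a0 a1 a2 t : R) : R := a0 + a1 * sin (2 * PI * t) + a2 * cos (2 * PI * t).

Definition trig' (a1 a2 t : R) : R :=
  2 * PI * (a1 * cos (2 * PI * t) - a2 * sin (2 * PI * t)).

Lemma trig_derive a0 a1 a2 t : is_derive (trig a0 a1 a2) t (trig' a1 a2 t).
Proof. unfold trig, trig'; auto_derive; [exact I | ring]. Qed.

Lemma trig_periodic a0 a1 a2 t : trig a0 a1 a2 (t + 1) = trig a0 a1 a2 t.
Proof.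
unfold trig; replace (2 * PI * (t + 1)) with (2 * PI * t + 2 * PI) by ring.
now rewrite sin_plus, cos_plus, sin_2PI, cos_2PI, !Rmult_0_r, !Rmult_1_r, Rminus_0_r, Rplus_0_r.
Qed.

(** Cauchy-Schwarz through Lagrange's identity. *)
Lemma circle_form_bound s c a1 a2 r : s * s + c * c = 1 -> 0 <= r -> a1 * a1 + a2 * a2 <= r * r ->
  - r <= a1 * s + a2 * c <= r.
Proof.
intros H Hr Ha; apply Rabs_le_between, Rsqr_incr_0; [|apply Rabs_pos | exact Hr].
rewrite <- Rsqr_abs; unfold Rsqr.
pose proof (Rle_0_sqr (a1 * c - a2 * s)) as Hsq; unfold Rsqr in Hsq.
replace ((a1 * s + a2 * c) * (a1 * s + a2 * c)) with
  ((a1 * a1 + a2 * a2) * (s * s + c * c) - (a1 * c - a2 * s) * (a1 * c - a2 * s)) by ring.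
rewrite H; lra.
Qed.

(** Meant for coefficients containing [PI], which are known only up to an interval around 0. *)
Lemma circle_box_bound s c a1 a2 r1 r2 : s * s + c * c = 1 ->
  - r1 <= a1 <= r1 -> - r2 <= a2 <= r2 -> - (r1 + r2) <= a1 * s + a2 * c <= r1 + r2.
Proof.
intros H H1 H2.
assert (-1 <= s <= 1) by (split; nra); assert (-1 <= c <= 1) by (split; nra).
split; nra.
Qed.

Lemma affine_ge A B l y : l <= A -> l <= A + B -> 0 <= y <= 1 -> l <= A + B * y.
Proof. intros; nra. Qed.

(* The residuals of the linear system [A' = 6 B - 2 (lam - 1) A],
   [B' = 2 b - (6 + 2 lam) B], whose solutions make [1 / sqrt (A + B y)] an almost
   exact profile: the remaining error in the equation for [A + B y] is
   [6 B^2 y (1 - y) / (A + B y)]. *)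
Definition resA (lam A B dA : R) : R := dA - 6 * B + 2 * (lam - 1) * A.
Definition resB (lam bt B dB : R) : R := dB + (6 + 2 * lam) * B - 2 * bt.

Lemma defect_half lam A B dA dB bt t y : 0 < A t + B t * y ->
  defect lam (1 / 2) A B dA dB t y + bt * (y / (A t + B t * y)) =
  - (resA lam (A t) (B t) (dA t) + resB lam bt (B t) (dB t) * y +
     6 * B t ^ 2 * y * (1 - y) / (A t + B t * y)) / (2 * (A t + B t * y)).
Proof. intros HW; unfold defect, resA, resB; field; lra. Qed.

(** The quadratic error has the favourable sign for a subsolution and can be discarded. *)
Lemma defect_half_le_0 lam A B dA dB bt t y : 0 <= y <= 1 -> 0 < A t + B t * y ->
  0 <= resA lam (A t) (B t) (dA t) + resB lam bt (B t) (dB t) * y ->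
  defect lam (1 / 2) A B dA dB t y + bt * (y / (A t + B t * y)) <= 0.
Proof.
intros Hy HW H; rewrite defect_half by exact HW.
assert (0 <= 6 * B t ^ 2 * y * (1 - y) / (A t + B t * y)) as Hq.
{ apply Rdiv_le_0_compat; [|exact HW].
  apply Rmult_le_pos; [apply Rmult_le_pos; [|lra] | lra]; pose proof (pow2_ge_0 (B t)); lra. }
unfold Rdiv at 1; rewrite <- Ropp_mult_distr_l; apply Ropp_le_cancel; rewrite Ropp_0, Ropp_involutive.
apply Rmult_le_pos; [lra | left; apply Rinv_0_lt_compat; lra].
Qed.

Lemma defect_half_ge_0 lam A B dA dB bt t y : 0 < A t + B t * y ->
  resA lam (A t) (B t) (dA t) + resB lam bt (B t) (dB t) * y +
    6 * B t ^ 2 * y * (1 - y) / (A t + B t * y) <= 0 ->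
  0 <= defect lam (1 / 2) A B dA dB t y + bt * (y / (A t + B t * y)).
Proof.
intros HW H; rewrite defect_half by exact HW.
apply Rdiv_le_0_compat; lra.
Qed.

(** An exact profile has the rate [2 (lam - 1)]; the term in [e / w] is the loss from the residuals,
    [q] the loss from the quadratic error, and the last term measures how far [v] is from the
    squared lower barrier. The bound by [q] rests on [4 A (A + B) y (1 - y) <= (A + B y)^2], whose
    two sides differ by the square of [A - (2 A + B) y]. *)
Lemma defect_three_halves_ge lam A B dA dB bt t y v e w q :
  0 <= y <= 1 -> 0 < A t -> 0 < A t + B t -> 0 < w -> w <= A t + B t * y ->
  resA lam (A t) (B t) (dA t) + resB lam bt (B t) (dB t) * y <= e -> 0 <= e ->
  15 * B t ^ 2 <= 4 * q * (A t * (A t + B t)) ->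
  2 * (lam - 1) - 3 / 2 * (e / w) - q + 3 * bt * (v - y / (A t + B t * y)) <=
  defect lam (3 / 2) A B dA dB t y + 3 * bt * v.
Proof.
intros Hy HA HAB Hw HwW He He0 Hq.
set (W := A t + B t * y) in *.
assert (defect lam (3 / 2) A B dA dB t y + 3 * bt * v =
  2 * (lam - 1) - 3 / 2 * ((resA lam (A t) (B t) (dA t) + resB lam bt (B t) (dB t) * y) / W) -
  15 * B t ^ 2 * y * (1 - y) / (W * W) + 3 * bt * (v - y / W)) as ->.
{ unfold defect, resA, resB; fold W.
  replace (A t) with (W - B t * y) by (unfold W; ring); field; lra. }
assert ((resA lam (A t) (B t) (dA t) + resB lam bt (B t) (dB t) * y) / W <= e / w) as H1.
{ apply Rle_trans with (e / W).
  - unfold Rdiv; apply Rmult_le_compat_r; [left; apply Rinv_0_lt_compat; lra | exact He].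
  - unfold Rdiv; apply Rmult_le_compat_l; [exact He0 | now apply Rinv_le_contravar]. }
assert (15 * B t ^ 2 * y * (1 - y) / (W * W) <= q) as H2.
{ assert (0 < W * W) by nra.
  apply Rmult_le_reg_r with (W * W); [assumption|].
  replace (15 * B t ^ 2 * y * (1 - y) / (W * W) * (W * W)) with (15 * B t ^ 2 * (y * (1 - y)))
    by (field; lra).
  assert (0 <= y * (1 - y)) as Hyy by (apply Rmult_le_pos; lra).
  assert (0 <= q) as Hq0.
  { pose proof (pow2_ge_0 (B t)); assert (0 < A t * (A t + B t)) by (apply Rmult_lt_0_compat; lra).
    nra. }
  pose proof (Rmult_le_compat_r _ _ _ Hyy Hq) as Hm.
  pose proof (Rle_0_sqr (A t - (2 * A t + B t) * y)) as Hsq; unfold Rsqr in Hsq.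
  pose proof (Rmult_le_compat_l q _ _ Hq0 Hsq) as Hm2.
  unfold W; lra. }
lra.
Qed.

(* A quadratic form in [(1, s, c)] that is positive on the unit circle is a sum of
   squares modulo [s^2 + c^2 = 1]; the squares of [p + s + q c] and [r + c] come
   from a numerical decomposition, the others absorb its rounding. *)
Ltac circle_form s c p q r :=
  pose proof (Rle_0_sqr (p + s + q * c)); pose proof (Rle_0_sqr (r + c));
  pose proof (Rle_0_sqr (s + c)); pose proof (Rle_0_sqr (s - c));
  pose proof (Rle_0_sqr (1 + s)); pose proof (Rle_0_sqr (1 - s));
  pose proof (Rle_0_sqr (1 + c)); pose proof (Rle_0_sqr (1 - c));
  unfold Rsqr in *; lra.

Lemma circle_2PI t : sin (2 * PI * t) * sin (2 * PI * t) + cos (2 * PI * t) * cos (2 * PI * t) = 1.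
Proof. exact (sin2_cos2 (2 * PI * t)). Qed.

(** [62 / 100] is the closeness of the two profiles while [b <= 0], and [19 / 31 = 100 / 62 - 1]. *)
Lemma fraction_gap_le y w1 w2 l : 0 <= y -> 0 < l -> l * y <= w1 -> 0 < w1 ->
  62 / 100 * w1 <= w2 -> y / w2 - y / w1 <= 19 / 31 / l.
Proof.
intros Hy Hl Hlw Hw1 Hw.
assert (y / w2 <= y / (62 / 100 * w1)) as H1.
{ unfold Rdiv; apply Rmult_le_compat_l; [exact Hy|]; apply Rinv_le_contravar; lra. }
assert (y / w1 <= / l) as H2.
{ apply Rmult_le_reg_r with (w1 * l); [nra|].
  replace (y / w1 * (w1 * l)) with (l * y) by (field; lra).
  replace (/ l * (w1 * l)) with w1 by (field; lra); exact Hlw. }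
replace (y / (62 / 100 * w1)) with (50 / 31 * (y / w1)) in H1 by (field; lra).
unfold Rdiv in *; lra.
Qed.

(** * The sign-changing coefficient *)

Section SignChanging.

Let b (t : R) := 3 / 2 * sin (2 * PI * t) + 1.
(** [A1] and [B1] are rounded periodic solutions of [A' = 6 B - 2 A] and [B' = 2 b - 10 B], with the
    means 0.6 and 0.2 slightly raised so that the residuals are nonnegative. *)
Let A1 := trig (605 / 1000) (- 578 / 10000) (- 2238 / 10000).
Let B1 := trig (201 / 1000) (2151 / 10000) (- 1351 / 10000).
(** [A2] follows the equation of [A1] with an additional negative forcing of one harmonic, strong
    enough to outweigh the quadratic error; both profiles share [B1]. *)
Let A2 := trig (3916 / 10000) (- 669 / 10000) (- 1636 / 10000).
Let dA1 := trig' (- 578 / 10000) (- 2238 / 10000).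
Let dB1 := trig' (2151 / 10000) (- 1351 / 10000).
Let dA2 := trig' (- 669 / 10000) (- 1636 / 10000).

Lemma sign_changing_residuals t :
  0 <= resA 2 (A1 t) (B1 t) (dA1 t) <= 5 / 1000 /\ 0 <= resB 2 (b t) (B1 t) (dB1 t) <= 12 / 1000 /\
  resA 2 (A2 t) (B1 t) (dA2 t) <=
    - (4222 / 10000 + 3964 / 10000 * sin (2 * PI * t) - 63 / 1000 * cos (2 * PI * t)).
Proof.
pose proof (circle_2PI t) as H; pose proof PI_bounds as HPI.
unfold resA, resB, A1, B1, A2, dA1, dB1, dA2, b, trig, trig'.
generalize dependent (sin (2 * PI * t)); intros s; generalize (cos (2 * PI * t)); intros c H.
pose proof (circle_box_bound s c (2 * PI * (2238 / 10000) - 14062 / 10000)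
  (- (2 * PI * (578 / 10000)) + 3630 / 10000) (3 / 10000) (3 / 10000) H ltac:(lra) ltac:(lra)).
pose proof (circle_box_bound s c (2 * PI * (1351 / 10000) - 849 / 1000)
  (2 * PI * (2151 / 10000) - 1351 / 1000) (4 / 10000) (8 / 10000) H ltac:(lra) ltac:(lra)).
pose proof (circle_box_bound s c (2 * PI * (1636 / 10000) - 1028 / 1000)
  (4204 / 10000 - 2 * PI * (669 / 10000)) (2 / 10000) (2 / 10000) H ltac:(lra) ltac:(lra)).
split; [split; lra | split; [split; lra | lra]].
Qed.

Lemma sign_changing_bounds t :
  36 / 100 <= A1 t <= 1 /\ 36 / 100 <= A1 t + B1 t <= 2 /\
  2 / 10 <= A2 t /\ 2 / 10 <= A2 t + B1 t /\ A2 t <= A1 t.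
Proof.
pose proof (circle_2PI t) as H; unfold A1, B1, A2, trig.
generalize dependent (sin (2 * PI * t)); intros s; generalize (cos (2 * PI * t)); intros c H.
pose proof (circle_form_bound s c (- 578 / 10000) (- 2238 / 10000) (232 / 1000) H ltac:(lra) ltac:(lra)).
pose proof (circle_form_bound s c (1573 / 10000) (- 3589 / 10000) (393 / 1000) H ltac:(lra) ltac:(lra)).
pose proof (circle_form_bound s c (- 669 / 10000) (- 1636 / 10000) (178 / 1000) H ltac:(lra) ltac:(lra)).
pose proof (circle_form_bound s c (1482 / 10000) (- 2987 / 10000) (334 / 1000) H ltac:(lra) ltac:(lra)).
pose proof (circle_form_bound s c (91 / 10000) (- 602 / 10000) (61 / 1000) H ltac:(lra) ltac:(lra)).
repeat split; lra.
Qed.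

Lemma sign_changing_form1 t : 15 * B1 t ^ 2 <= 4 * (13 / 10) * (A1 t * (A1 t + B1 t)).
Proof.
pose proof (circle_2PI t) as H; unfold A1, B1, trig.
generalize dependent (sin (2 * PI * t)); intros s; generalize (cos (2 * PI * t)); intros c H.
circle_form s c (- 1138 / 1000) (868 / 1000) (- 173 / 1000).
Qed.

(** As [y (1 - y) <= 1/4], the quadratic error is below [r] once [6 B^2 <= 4 r (A + B y)], which is
    affine in [y] and is checked at both ends. The bound on [resA] for [A2] is [- r] lowered by
    [12 / 1000], the reserve for [resB]. *)
Lemma sign_changing_form2 t :
  let r := 4102 / 10000 + 3964 / 10000 * sin (2 * PI * t) - 63 / 1000 * cos (2 * PI * t) in
  6 * B1 t ^ 2 <= 4 * r * A2 t /\ 6 * B1 t ^ 2 <= 4 * r * (A2 t + B1 t).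
Proof.
pose proof (circle_2PI t) as H; unfold A2, B1, trig.
generalize dependent (sin (2 * PI * t)); intros s; generalize (cos (2 * PI * t)); intros c H.
split.
- circle_form s c (- 43503 / 100000) (602219 / 100000) (5464 / 10000).
- circle_form s c (102980 / 100000) (- 25164 / 100000) (- 23603 / 100000).
Qed.

(** [b <= 0] forces the sine below [- 2 / 3]. On this arc [B1] is small compared with [A1], so [q]
    drops from [13 / 10] to [1 / 4] and makes room for the loss caused by negative [b]. *)
Lemma sign_changing_negative t : b t <= 0 ->
  15 * B1 t ^ 2 <= 4 * (25 / 100) * (A1 t * (A1 t + B1 t)) /\
  62 / 100 * A1 t <= A2 t /\ 62 / 100 * (A1 t + B1 t) <= A2 t + B1 t /\
  - b t <= 85 / 100 * (A1 t + B1 t).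
Proof.
pose proof (circle_2PI t) as H; unfold A1, B1, A2, b, trig.
generalize dependent (sin (2 * PI * t)); intros s; generalize (cos (2 * PI * t)); intros c H Hs.
assert (- 1 <= s) by nra.
assert (- 746 / 1000 <= c <= 746 / 1000) by (split; nra).
pose proof (circle_form_bound s c (507 / 10000) (- 762 / 10000) (916 / 10000) H ltac:(lra) ltac:(lra)).
pose proof (circle_form_bound s c (2151 / 10000) (- 1351 / 10000) (2541 / 10000) H ltac:(lra) ltac:(lra)).
pose proof (circle_form_bound s c (1633705 / 1000000) (- 305065 / 1000000) (1663 / 1000) H
  ltac:(lra) ltac:(lra)).
split; [|repeat split; lra].
set (A := 605 / 1000 + - 578 / 10000 * s + - 2238 / 10000 * c).
set (B := 201 / 1000 + 2151 / 10000 * s + - 1351 / 10000 * c).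
(* One pair of constant bounds for the whole arc is too coarse: the smaller [A] occurs for [c >= 0],
   the larger range of [B] for [c < 0]. *)
destruct (Rle_lt_dec 0 c).
- assert (47 / 100 <= A) by (unfold A; lra).
  assert (38 / 100 <= A + B) by (unfold A, B; lra).
  assert (- 6 / 100 <= B <= 6 / 100) by (unfold B; split; lra).
  clearbody A B; nra.
- assert (64 / 100 <= A) by (unfold A; lra).
  assert (64 / 100 <= A + B) by (unfold A, B; lra).
  assert (- 16 / 100 <= B <= 16 / 100) by (unfold B; split; lra).
  clearbody A B; nra.
Qed.

Lemma sign_changing_orbit T (HT : generates (V := C0_NormedModule) (L_graph 2) T) :
  has_stable_periodic_orbit T b.
Proof.
(* The rate is limited by the times with [b < 0], where [2 - 3/2 (2/36) - 1/4 - 3 (85/100) (19/31)]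
   is slightly above 1/10. *)
apply (stable_periodic_orbit_exists 2 ltac:(lra) T HT b 3) with
  (A1 := A1) (B1 := B1) (A2 := A2) (B2 := B1) (dA1 := dA1) (dB1 := dB1) (dA2 := dA2) (dB2 := dB1)
  (m := 2 / 10) (M0 := 2) (kappa := 1 / 20);
  try (intros; apply trig_derive); try (intros; apply trig_periodic); try lra.
- intros t; unfold b; pose proof (SIN_bound (2 * PI * t)); apply Rabs_le_between; split; lra.
- intros t; apply (ex_derive_continuous b); unfold b; auto_derive; exact I.
- intros t; unfold b; replace (2 * PI * (t + 1)) with (2 * PI * t + 2 * PI) by ring.
  rewrite sin_plus, sin_2PI, cos_2PI; ring.
- intros t y Hy; destruct (sign_changing_bounds t) as [_ [_ [H1 [H2 _]]]]; now apply affine_ge.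
- intros t y Hy; destruct (sign_changing_bounds t) as [_ [_ [_ [_ H]]]]; lra.
- intros t y Hy; destruct (sign_changing_bounds t) as [H1 [H2 _]]; nra.
- intros t y Hy; destruct (sign_changing_bounds t) as [H1 [H2 _]].
  destruct (sign_changing_residuals t) as [E1 [E2 _]].
  apply defect_half_le_0; [exact Hy | | nra].
  pose proof (affine_ge (A1 t) (B1 t) (36 / 100) y); lra.
- intros t y Hy; destruct (sign_changing_bounds t) as [_ [_ [H1 [H2 _]]]].
  destruct (sign_changing_residuals t) as [_ [E2 E3]].
  destruct (sign_changing_form2 t) as [F1 F2].
  set (r := 4102 / 10000 + _ - _) in *.
  pose proof (affine_ge (A2 t) (B1 t) (2 / 10) y ltac:(lra) ltac:(lra) Hy) as HW.
  apply defect_half_ge_0; [lra|].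
  assert (6 * B1 t ^ 2 * y * (1 - y) / (A2 t + B1 t * y) <= r) as Hr.
  { apply Rmult_le_reg_r with (A2 t + B1 t * y); [lra|].
    replace (6 * B1 t ^ 2 * y * (1 - y) / (A2 t + B1 t * y) * (A2 t + B1 t * y))
      with (6 * B1 t ^ 2 * (y * (1 - y))) by (field; lra).
    pose proof (affine_ge (4 * r * A2 t) (4 * r * B1 t) (6 * B1 t ^ 2) y F1 ltac:(lra) Hy) as HF.
    assert (y * (1 - y) <= / 4) by (pose proof (Rle_0_sqr (y - / 2)) as Hsq; unfold Rsqr in Hsq; lra).
    assert (6 * B1 t ^ 2 * (y * (1 - y)) <= 6 * B1 t ^ 2 * / 4).
    { apply Rmult_le_compat_l; [pose proof (pow2_ge_0 (B1 t)); lra | assumption]. }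
    lra. }
  assert (resB 2 (b t) (B1 t) (dB1 t) * y <= 12 / 1000) by nra.
  unfold r in *; lra.
- intros t y v Hy Hv; destruct (sign_changing_bounds t) as [H1 [H2 [H3 [H4 _]]]].
  destruct (sign_changing_residuals t) as [E1 [E2 _]].
  pose proof (affine_ge (A1 t) (B1 t) (36 / 100) y ltac:(lra) ltac:(lra) Hy) as HW1.
  assert (resA 2 (A1 t) (B1 t) (dA1 t) + resB 2 (b t) (B1 t) (dB1 t) * y <= 2 / 100) as He by nra.
  destruct (Rle_lt_dec 0 (b t)) as [Hb|Hb].
  + pose proof (defect_three_halves_ge 2 A1 B1 dA1 dB1 (b t) t y v (2 / 100) (36 / 100) (13 / 10)
      Hy ltac:(lra) ltac:(lra) ltac:(lra) HW1 He ltac:(lra) (sign_changing_form1 t)) as Hd.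
    assert (0 <= b t * (v - y / (A1 t + B1 t * y))) by (apply Rmult_le_pos; lra).
    lra.
  + destruct (sign_changing_negative t ltac:(lra)) as [F1 [F2 [F3 F4]]].
    pose proof (defect_three_halves_ge 2 A1 B1 dA1 dB1 (b t) t y v (2 / 100) (36 / 100) (25 / 100)
      Hy ltac:(lra) ltac:(lra) ltac:(lra) HW1 He ltac:(lra) F1) as Hd.
    pose proof (fraction_gap_le y (A1 t + B1 t * y) (A2 t + B1 t * y) (A1 t + B1 t)
      ltac:(lra) ltac:(lra) ltac:(nra) ltac:(lra) ltac:(nra)) as Hgap.
    assert (- b t * (v - y / (A1 t + B1 t * y)) <= 85 / 100 * (19 / 31)).
    { apply Rle_trans with (85 / 100 * (A1 t + B1 t) * (19 / 31 / (A1 t + B1 t))).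
      - apply Rmult_le_compat; lra.
      - right; field; lra. }
    lra.
Qed.

End SignChanging.

(* When [b >= 1/2] the profile [W2] can be taken constant in time. *)
Lemma positive_orbit (lam : R) T (b : R -> R) (A1 B1 dA1 dB1 : R -> R) (w e q : R) :
  1 < lam -> generates (V := C0_NormedModule) (L_graph lam) T ->
  (forall t, continuous b t) -> (forall t, b (t + 1) = b t) -> (forall t, 1 / 2 <= b t <= 3 / 2) ->
  (forall t, is_derive A1 t (dA1 t)) -> (forall t, is_derive B1 t (dB1 t)) ->
  (forall t, A1 (t + 1) = A1 t) -> (forall t, B1 (t + 1) = B1 t) ->
  (forall t, 3 / ((lam - 1) * (4 + 4 * lam)) <= A1 t /\
    (2 + lam) / ((lam - 1) * (4 + 4 * lam)) <= A1 t + B1 t) ->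
  0 < w -> (forall t, w <= A1 t <= 1 /\ w <= A1 t + B1 t <= 1) ->
  (forall t, 0 <= resA lam (A1 t) (B1 t) (dA1 t) <= e /\ 0 <= resB lam (b t) (B1 t) (dB1 t) <= e) ->
  (forall t, 15 * B1 t ^ 2 <= 4 * q * (A1 t * (A1 t + B1 t))) ->
  3 * (e / w) + q < 2 * (lam - 1) ->
  has_stable_periodic_orbit T b.
Proof.
intros Hlam HT Hbc Hbp Hb HdA HdB HpA HpB Hab Hw HW Hres Hform Hkappa.
assert (0 < (lam - 1) * (4 + 4 * lam)) as Hden by nra.
(* The stationary linear system with the smallest value [b = 1/2] would have [(6 + 2 lam) b2 = 1].
   Taking [4 + 4 lam] instead leaves the surplus [2 (lam - 1) b2 y], which dominates the quadratic
   error because [6 b2 = 2 (lam - 1) a2]. *)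
set (a2 := 3 / ((lam - 1) * (4 + 4 * lam))) in *.
set (b2 := / (4 + 4 * lam)).
assert (0 < a2) as Ha2 by (unfold a2; apply Rdiv_lt_0_compat; lra).
assert (0 < b2) as Hb2 by (unfold b2; apply Rinv_0_lt_compat; lra).
assert (Esum : (2 + lam) / ((lam - 1) * (4 + 4 * lam)) = a2 + b2) by (unfold a2, b2; field; lra).
assert (Ea2 : 2 * (lam - 1) * a2 = 6 * b2) by (unfold a2, b2; field; lra).
assert (Eb2 : (4 + 4 * lam) * b2 = 1) by (unfold b2; field; lra).
clearbody a2 b2.
apply (stable_periodic_orbit_exists lam ltac:(lra) T HT b 2) with
  (A1 := A1) (B1 := B1) (A2 := fun _ => a2) (B2 := fun _ => b2)
  (dA1 := dA1) (dB1 := dB1) (dA2 := fun _ => 0) (dB2 := fun _ => 0)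
  (m := a2) (M0 := 1) (kappa := 2 * (lam - 1) - (3 * (e / w) + q)); try assumption; try lra;
  try reflexivity; try (intros; apply (is_derive_const (K := R_AbsRing) (V := R_NormedModule))).
- intros t; specialize (Hb t); apply Rabs_le_between; lra.
- intros t y Hy; nra.
- intros t y Hy; destruct (Hab t) as [H1 H2]; rewrite Esum in H2; nra.
- intros t y Hy; destruct (HW t) as [H1 H2]; nra.
- intros t y Hy; destruct (HW t) as [H1 H2]; destruct (Hres t) as [E1 E2].
  apply defect_half_le_0; [exact Hy | | nra].
  pose proof (affine_ge (A1 t) (B1 t) w y); lra.
- intros t y Hy; specialize (Hb t).
  apply (defect_half_ge_0 lam (fun _ => a2) (fun _ => b2) (fun _ => 0) (fun _ => 0)); [nra|].
  unfold resA, resB.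
  assert (6 * b2 ^ 2 * y * (1 - y) / (a2 + b2 * y) <= 2 * (lam - 1) * b2 * y) as Hq.
  { apply Rmult_le_reg_r with (a2 + b2 * y); [nra|].
    replace (6 * b2 ^ 2 * y * (1 - y) / (a2 + b2 * y) * (a2 + b2 * y))
      with (6 * b2 * (b2 * y * (1 - y))) by (field; nra).
    rewrite <- Ea2.
    replace (2 * (lam - 1) * b2 * y * (a2 + b2 * y)) with
      (2 * (lam - 1) * a2 * (b2 * y * (1 - y)) + 2 * (lam - 1) * (b2 * y) * (a2 * y + b2 * y)) by ring.
    assert (0 <= b2 * y) by nra.
    assert (0 <= 2 * (lam - 1) * (b2 * y) * (a2 * y + b2 * y)).
    { repeat apply Rmult_le_pos; nra. }
    lra. }
  assert (0 <= (b t - 1 / 2) * y) by (apply Rmult_le_pos; lra).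
  assert ((4 + 4 * lam) * b2 * y = y) by (rewrite Eb2; ring).
  lra.
- intros t y v Hy Hv; destruct (HW t) as [H1 H2]; destruct (Hres t) as [E1 E2]; specialize (Hb t).
  pose proof (affine_ge (A1 t) (B1 t) w y ltac:(lra) ltac:(lra) Hy) as HW1.
  pose proof (defect_three_halves_ge lam A1 B1 dA1 dB1 (b t) t y v (2 * e) w q
    Hy ltac:(lra) ltac:(lra) Hw HW1 ltac:(nra) ltac:(lra) (Hform t)) as Hd.
  (* With [b > 0], any excess of [v] over the squared lower barrier only improves the rate. *)
  assert (0 <= b t * (v - y / (A1 t + B1 t * y))) by (apply Rmult_le_pos; lra).
  replace (2 * e / w) with (2 * (e / w)) in Hd by (field; lra).
  lra.
Qed.

Lemma modulated_b_facts (t : R) (b := fun t => 1 / 2 * sin (2 * PI * t) + 1) :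
  continuous b t /\ b (t + 1) = b t /\ 1 / 2 <= b t <= 3 / 2.
Proof.
split; [|split].
- apply (ex_derive_continuous b); unfold b; auto_derive; exact I.
- unfold b; replace (2 * PI * (t + 1)) with (2 * PI * t + 2 * PI) by ring.
  rewrite sin_plus, sin_2PI, cos_2PI; ring.
- unfold b; pose proof (SIN_bound (2 * PI * t)); lra.
Qed.

Theorem theorem1p1 (lam : R) (b : R -> R)
    (Hlamb :
      (lam, b) = (2, fun t => 3 / 2 * sin (2 * PI * t) + 1) \/
      (lam, b) = (2, fun t => 1 / 2 * sin (2 * PI * t) + 1) \/
      (lam, b) = (5, fun t => 1 / 2 * sin (2 * PI * t) + 1))
    (S : R -> C0 -> C0) (HS : generates (L_graph lam) S) :
  exists ustar : R -> C0,
    is_periodic_orbit S b ustar /\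
    exists delta D kappa : R,
      0 < delta /\ 0 < D /\ 0 < kappa /\
      forall (t0 : R) (u0 : C0),
        norm (minus (ustar t0) u0) <= delta ->
        exists u : R -> C0,
          is_solution S b t0 u0 u /\
          forall t, t0 <= t ->
            norm (minus (ustar t) (u t)) <=
              D * exp (- kappa * (t - t0)) * norm (minus (ustar t0) (u t0)).
Proof.
destruct Hlamb as [E | [E | E]]; injection E as El Eb; subst lam b.
- exact (sign_changing_orbit S HS).
(* The linear system has the same means as in the sign-changing case and a third of the oscillation,
   like [b] itself. *)
- apply (positive_orbit 2 S _
    (trig (605 / 1000) (- 193 / 10000) (- 746 / 10000)) (trig (201 / 1000) (717 / 10000) (- 45 / 1000))
    (trig' (- 193 / 10000) (- 746 / 10000)) (trig' (717 / 10000) (- 45 / 1000))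
    (1 / 2) (12 / 1000) (13 / 10)); try exact HS; try lra;
    try apply modulated_b_facts; try (intros; apply trig_derive); try (intros; apply trig_periodic);
    intros t; pose proof (circle_2PI t) as H; unfold trig, trig', resA, resB;
    generalize dependent (sin (2 * PI * t)); intros s; generalize (cos (2 * PI * t)); intros c H.
  + pose proof (circle_form_bound s c (- 193 / 10000) (- 746 / 10000) (78 / 1000) H ltac:(lra) ltac:(lra)).
    pose proof (circle_form_bound s c (524 / 10000) (- 1196 / 10000) (131 / 1000) H ltac:(lra) ltac:(lra)).
    lra.
  + pose proof (circle_form_bound s c (- 193 / 10000) (- 746 / 10000) (78 / 1000) H ltac:(lra) ltac:(lra)).
    pose proof (circle_form_bound s c (524 / 10000) (- 1196 / 10000) (131 / 1000) H ltac:(lra) ltac:(lra)).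
    lra.
  + pose proof PI_bounds as HPI.
    pose proof (circle_box_bound s c (2 * PI * (746 / 10000) - 4688 / 10000)
      (- (2 * PI * (193 / 10000)) + 1208 / 10000) (3 / 10000) (8 / 10000) H ltac:(lra) ltac:(lra)).
    pose proof (circle_box_bound s c (2 * PI * (45 / 1000) - 283 / 1000)
      (2 * PI * (717 / 10000) - 450 / 1000) (6 / 10000) (9 / 10000) H ltac:(lra) ltac:(lra)).
    split; lra.
  + circle_form s c (- 94095 / 100000) (23895 / 100000) (- 61243 / 100000).
(* Here the system is [A' = 6 B - 8 A], [B' = 2 b - 16 B], with means 3/32 and 1/8, again raised
   slightly. *)
- apply (positive_orbit 5 S _
    (trig (943 / 10000) (174 / 10000) (- 296 / 10000)) (trig (1253 / 10000) (541 / 10000) (- 213 / 10000))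
    (trig' (174 / 10000) (- 296 / 10000)) (trig' (541 / 10000) (- 213 / 10000))
    (5 / 100) (12 / 1000) 5); try exact HS; try lra;
    try apply modulated_b_facts; try (intros; apply trig_derive); try (intros; apply trig_periodic);
    intros t; pose proof (circle_2PI t) as H; unfold trig, trig', resA, resB;
    generalize dependent (sin (2 * PI * t)); intros s; generalize (cos (2 * PI * t)); intros c H.
  + pose proof (circle_form_bound s c (174 / 10000) (- 296 / 10000) (35 / 1000) H ltac:(lra) ltac:(lra)).
    pose proof (circle_form_bound s c (715 / 10000) (- 509 / 10000) (88 / 1000) H ltac:(lra) ltac:(lra)).
    lra.
  + pose proof (circle_form_bound s c (174 / 10000) (- 296 / 10000) (35 / 1000) H ltac:(lra) ltac:(lra)).
    pose proof (circle_form_bound s c (715 / 10000) (- 509 / 10000) (88 / 1000) H ltac:(lra) ltac:(lra)).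
    lra.
  + pose proof PI_bounds as HPI.
    pose proof (circle_box_bound s c (2 * PI * (296 / 10000) - 1854 / 10000)
      (2 * PI * (174 / 10000) - 1090 / 10000) (8 / 10000) (5 / 10000) H ltac:(lra) ltac:(lra)).
    pose proof (circle_box_bound s c (2 * PI * (213 / 10000) - 1344 / 10000)
      (2 * PI * (541 / 10000) - 3408 / 10000) (8 / 10000) (12 / 10000) H ltac:(lra) ltac:(lra)).
    split; lra.
  + circle_form s c (10989 / 100000) (- 35397 / 100000) (- 96949 / 100000).
Qed.
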